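(* Let $L>0$, $t_0<T$, $\varepsilon\in\mathbb{R}$, and consider the stochastic Schrödinger equation in the Stratonovich sense $$\mathbf{i}\,d\psi+(A\psi+F(\psi))\,dt=G(\psi)\circ dW,\qquad \psi(t_0)=\varphi,$$ on $[-L,L]\times[t_0,T]$ with $\psi(-L,t)=\psi(L,t)=0$, where $A=\partial^2/\partial x^2$ with homogeneous Dirichlet boundary condition, $F(\psi)=\Psi'_{|\psi|^2}(|\psi|^2,x,t)\psi$ and $G(\psi)=\varepsilon\psi$ (multiplication by $\varepsilon \psi$). Write $P=\Re\psi$, $Q=\Im\psi$. Then the phase flow of this equation preserves the symplectic structure $$\bar\omega(t)=\int_{-L}^{L}dP\wedge dQ\;dx,$$ i.e. $\bar\omega(t)=\bar\omega(t_0)$ for all $t\in[t_0,T]$ (equivalently $\frac{d}{dt}\bar\omega(t)=0$).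
   Context: $\Psi(|\psi|^2,x,t)$ is a real-valued function, and $\Psi'_{|\psi|^2}$ denotes its derivative with respect to its first argument $|\psi|^2$; the derivatives needed below are assumed to exist. $W(t)=\sum_{k\in\mathbb{N}}\beta_k(t)\mathbf{Q}^{1/2}e_k$ is a $\mathbf{Q}$-Wiener process on $U=\mathbb{L}^2([-L,L],\mathbb{R})$, where $\mathbf{Q}\in\mathcal{L}(U)$ is nonnegative, symmetric and of finite trace, $\{e_k\}$ is an orthonormal basis of $U$ of eigenvectors of $\mathbf{Q}$, and $\{\beta_k\}$ are independent real Brownian motions on a probability space. The solution $\psi$ is assumed to exist globally on $[t_0,T]$. The symbol $\circ\, dW$ denotes the Stratonovich integral, and $G(\psi)\circ dW=\varepsilon\psi\circ dW$ is a pointwise product in $x$. In real form the equation reads $$dP=-(AQ+\Psi'_{|\psi|^2}(P^2+Q^2,x,t)Q)dt+\varepsilon Q\circ dW,\quad dQ=(AP+\Psi'_{|\psi|^2}(P^2+Q^2,x,t)P)dt-\varepsilon P\circ dW,$$ with initial data $P(t_0)=p=\Re\varphi$, $Q(t_0)=q=\Im\varphi$. In the two-form $dP\wedge dQ$, the symbol $d$ is the differential with respect to the initial data $(p,q)$, not with respect to time: $P,Q$ at time $t$ are regarded as functions of $(p,q)$, and the derivatives of $P,Q$ with respect to $(p,q)$ solve the linearization (along $(P,Q)$) of the real system $dP=-(AQ+\Psi'_{|\psi|^2}(P^2+Q^2,x,t)Q)dt+\varepsilon Q\circ dW$, $dQ=(AP+\Psi'_{|\psi|^2}(P^2+Q^2,x,t)P)dt-\varepsilon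 P\circ dW$. Thus, for two directions $\xi,\eta$ in the space of initial data, $\bar\omega(t)(\xi,\eta)=\int_{-L}^{L}\big(DP[\xi]\,DQ[\eta]-DP[\eta]\,DQ[\xi]\big)dx$. *)

(* Defs.v *)
From HB Require Import structures.
From mathcomp Require Import all_boot all_order all_algebra.
From mathcomp Require Import all_classical all_reals all_analysis.
From mathcomp Require Import complex.
Import Order.TTheory GRing.Theory Num.Theory.
Import numFieldNormedType.Exports.

Set Implicit Arguments.
Unset Strict Implicit.
Unset Printing Implicit Defensive.

Local Open Scope classical_set_scope.
Local Open Scope ring_scope.

(* The Hilbert space U = L^2([-L, L], R). Its elements are represented by
   functions on R of which only the restriction to [-L, L] matters, and
   equality in U is equality a.e. on [-L, L]. *)
Section L2.
Context {R : realType} (L : R).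
Local Notation mu := (@lebesgue_measure R).
Implicit Types (u v : R -> R) (S : (R -> R) -> R -> R).

Definition dom : set R := `[- L, L].

Definition eqU u v := {ae mu, forall x, dom x -> u x = v x}.

Definition Lpnorm (p : nat) u : \bar R :=
  ((\int[mu]_(x in dom) (`|u x| ^+ p)%:E) `^ (p%:R^-1))%E.

Definition inU u := measurable_fun dom u /\ (Lpnorm 2 u < +oo)%E.

Definition inner u v : R := \int[mu]_(x in dom) (u x * v x).

Definition bounded_op S :=
  [/\ forall u, inU u -> inU (S u),
      forall a u v, inU u -> inU v ->
        eqU (S (fun x => a * u x + v x)) (fun x => a * S u x + S v x)
    & exists M : R, forall u, inU u ->
        (Lpnorm 2 (S u) <= M%:E * Lpnorm 2 u)%E].

Definition symmetric_op S :=
  forall u v, inU u -> inU v -> inner (S u) v = inner u (S v).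

Definition nonneg_op S := forall u, inU u -> 0 <= inner (S u) u.

Definition sqrt_op Q S :=
  [/\ bounded_op S, symmetric_op S, nonneg_op S
    & forall u, inU u -> eqU (S (S u)) (Q u)].

Definition orthonormal_basis (e : nat -> R -> R) :=
  [/\ forall k, inU (e k),
      forall j k, inner (e j) (e k) = (j == k)%:R
    & forall u, inU u ->
        (fun n => Lpnorm 2 (fun x => u x - \sum_(k < n) inner u (e k) * e k x))
          @ \oo --> 0%E].

Definition finite_trace S (e : nat -> R -> R) :=
  (\sum_(k <oo) (inner (S (e k)) (e k))%:E < +oo)%E.

(* u belongs to the domain H^2 \cap H^1_0 of A = d^2/dx^2 and A u = v: u is C^1
   with absolutely continuous derivative du, the derivative of du being v. *)
Definition dirichlet_laplacian u v :=
  [/\ u (- L) = 0, u L = 0, inU v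
    & exists du : R -> R,
        (forall x, dom x -> u x = \int[mu]_(y in `[- L, x]) du y) /\
        (forall x, dom x ->
           du x = du (- L) + \int[mu]_(y in `[- L, x]) v y)].

End L2.

Section Noise.
Context {R : realType} {d : measure_display} {Omega : measurableType d}.
Variables (Pr : probability Omega R) (r0 T : R).
Implicit Types (F : R -> set (set Omega)) (beta : nat -> R -> Omega -> R).

Definition measurable_wrt (G : set (set Omega)) (X : Omega -> R) :=
  forall B : set R, measurable B -> G (X @^-1` B).

Definition filtration F :=
  [/\ forall t, t \in `[r0, T] -> sigma_algebra setT (F t),
      forall t, t \in `[r0, T] -> F t `<=` measurable
    & forall s t, r0 <= s -> s <= t -> t <= T -> F s `<=` F t].

(* Independent Brownian motions with respect to F on [r0, T], started at 0 at
   time r0. The last clause says at once that the increments over [s, t] are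
   N(0, t - s), mutually independent and jointly independent of F s. *)
Definition brownian_motions F beta :=
  [/\ forall k, {ae Pr, forall w, beta k r0 w = 0},
      forall k, {ae Pr, forall w,
        {within `[r0, T], continuous (fun t => beta k t w)}},
      forall k t, t \in `[r0, T] -> measurable_wrt (F t) (beta k t)
    & forall s t n (A : set Omega) (B : nat -> set R),
        r0 <= s -> s < t -> t <= T -> F s A -> (forall k, measurable (B k)) ->
        Pr (A `&` \bigcap_(k in `I_n)
                    ((fun w => beta k t w - beta k s w) @^-1` B k)) =
        (Pr A * \prod_(k < n) normal_prob 0 (Num.sqrt (t - s)) (B k))%E].

End Noise.

Section StochasticCalculus.
Context {R : realType} {d : measure_display} {Omega : measurableType d}.
Variables (Pr : probability Omega R) (L t0 T : R).
Local Notation mu := (@lebesgue_measure R).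

(* A random field: time, then sample point, then space. *)
Definition field (V : Type) := R -> Omega -> R -> V.

Definition measurable_field (a : R) (Y : field R) :=
  forall t, t \in `[a, T] ->
    measurable_fun (setT `*` dom L)
      (fun p : (Omega * measurableTypeR R)%type => Y t p.1 p.2).

(* W(t) = \sum_k beta_k(t) Q^(1/2) e_k, the series converging in
   L^2(Omega; U), where Qhalf = Q^(1/2). *)
Definition Q_wiener (r0 : R) (Qhalf : (R -> R) -> R -> R) (e : nat -> R -> R)
    (beta : nat -> R -> Omega -> R) (W : field R) :=
  measurable_field r0 W /\
  forall t, t \in `[r0, T] ->
    (fun n => \int[Pr]_w \int[mu]_(x in dom L)
       ((W t w x - \sum_(k < n) beta k t w * Qhalf (e k) x) ^+ 2)%:E)%E
      @ \oo --> 0%E.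

(* Convergence in probability in L^p(-L, L). *)
Definition cvg_in_prob (p : nat) (I : Type) (G : set_system I)
    (Y : I -> Omega -> R -> R) (Z : Omega -> R -> R) :=
  forall e : R, 0 < e ->
    (fun i => Pr [set w | (e%:E <= Lpnorm L p (fun x => Y i w x - Z w x)%R)%E])
      @ G --> 0%E.

(* A partition a = knot 0 < ... < knot (size s) = b is given by the sequence s
   of its knots other than a, as in itv_partition. *)
Definition knot (a b : R) (s : seq R) (i : nat) : R := nth b (a :: s) i.

Definition mesh_to_0 (a b : R) : set_system (seq R) :=
  [set A | exists2 r : R, 0 < r & forall s, itv_partition a b s ->
     (forall i, (i < size s)%N -> knot a b s i.+1 - knot a b s i < r) -> A s].

Definition ito_integral (Y W J : field R) :=
  measurable_field t0 J /\
  forall t, t \in `[t0, T] ->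
    cvg_in_prob 2 (mesh_to_0 t0 t)
      (fun s w x => \sum_(i < size s) Y (knot t0 t s i) w x *
         (W (knot t0 t s i.+1) w x - W (knot t0 t s i) w x))
      (J t).

(* The quadratic covariation [Y, W], pointwise in x. Like the bracket of two
   semimartingales, it is required to have paths of finite variation. *)
Definition bracket (Y W C : field R) :=
  [/\ measurable_field t0 C,
      forall t, t \in `[t0, T] ->
        cvg_in_prob 1 (mesh_to_0 t0 t)
          (fun s w x => \sum_(i < size s)
             (Y (knot t0 t s i.+1) w x - Y (knot t0 t s i) w x) *
             (W (knot t0 t s i.+1) w x - W (knot t0 t s i) w x))
          (C t)
    & {ae Pr, forall w, {ae mu, forall x, dom L x ->
        bounded_variation t0 T (fun t => C t w x)}}].

Definition stratonovich_integral (Y W S : field R) :=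
  exists J C : field R,
    [/\ ito_integral Y W J, bracket Y W C
      & forall t w x, S t w x = J t w x + 2^-1 * C t w x].

End StochasticCalculus.

Section Schroedinger.
Context {R : realType} {d : measure_display} {Omega : measurableType d}.
Variables (Pr : probability Omega R) (F : R -> set (set Omega)) (L t0 T : R).
Local Notation mu := (@lebesgue_measure R).
Local Notation C := R[i].
Local Notation field := (@field R d Omega).

Definition reF (z : field C) : field R := fun t w x => complex.Re (z t w x).
Definition imF (z : field C) : field R := fun t w x => complex.Im (z t w x).

Definition adapted_continuous (Y : field R) :=
  [/\ measurable_field L T t0 Y,
      forall t x, t \in `[t0, T] -> dom L x ->
        measurable_wrt (F t) (fun w => Y t w x)
    & {ae Pr, forall w, {within `[t0, T] `*` dom L,
        continuous (fun p : (R * R)%type => Y p.1 w p.2)}}].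

Definition dirichlet_bc (Y : field R) :=
  {ae Pr, forall w, forall t, t \in `[t0, T] -> Y t w (- L) = 0 /\ Y t w L = 0}.

Definition field_laplacian (Y AY : field R) :=
  {ae Pr, forall w, {ae mu, forall t, t \in `[t0, T] ->
     dirichlet_laplacian L (Y t w) (AY t w)}}.

(* Almost surely integrable in time with values in U. *)
Definition integrable_field (b : field R) :=
  measurable_fun (`[t0, T] `*` setT `*` dom L)
    (fun p : (measurableTypeR R * Omega * measurableTypeR R)%type =>
       b p.1.1 p.1.2 p.2) /\
  {ae Pr, forall w, (\int[mu]_(t in `[t0, T]) Lpnorm L 2 (b t w) < +oo)%E}.

(* psi is a strong solution on [-L, L] x [t0, T] of
     i dpsi + (A psi + N) dt = (eps psi) o dW,   psi(t0) = phi,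
   with homogeneous Dirichlet boundary conditions, in integral form; N is the
   value along psi of the zeroth-order term. *)
Definition strong_solution (eps : R) (W : field R) (phi : R -> C)
    (psi N : field C) :=
  exists Apsi S : field C,
  let drift : field C := fun t w x => Apsi t w x + N t w x in
  let Gpsi : field C := fun t w x => (eps%:C)%C * psi t w x in
  (adapted_continuous (reF psi) /\ adapted_continuous (imF psi)) /\
  (dirichlet_bc (reF psi) /\ dirichlet_bc (imF psi)) /\
  (field_laplacian (reF psi) (reF Apsi) /\
   field_laplacian (imF psi) (imF Apsi)) /\
  (integrable_field (reF drift) /\ integrable_field (imF drift)) /\
  (stratonovich_integral Pr L t0 T (reF Gpsi) W (reF S) /\
   stratonovich_integral Pr L t0 T (imF Gpsi) W (imF S)) /\
  forall t, t \in `[t0, T] ->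
    {ae Pr, forall w, {ae mu, forall x, dom L x ->
      ('i)%C * (psi t w x - phi x) +
      ((\int[mu]_(s in `[t0, t]) reF drift s w x) +i*
       (\int[mu]_(s in `[t0, t]) imF drift s w x))%C = S t w x}}.

(* The derivative of Psi with respect to its first argument. *)
Definition dPsi (Psi : R -> R -> R -> R) (r x t : R) : R :=
  derive1 (fun r' : R => Psi r' x t) r.

Definition nonlinearity (Psi : R -> R -> R -> R) (x t : R) (z : C) : C :=
  ((dPsi Psi (complex.Re z ^+ 2 + complex.Im z ^+ 2) x t)%:C)%C * z.

(* Directional derivative of the nonlinearity at z, with C seen as the real
   plane. *)
Definition dnonlinearity (Psi : R -> R -> R -> R) (x t : R) (z v : C) : C :=
  let f h := nonlinearity Psi x t (z + (h%:C)%C * v) in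
  (derive1 (fun h : R => complex.Re (f h)) 0 +i*
   derive1 (fun h : R => complex.Im (f h)) 0)%C.

Definition real_subspace (E : set (R -> C)) :=
  forall (a : R) u v, E u -> E v -> E (fun x => u x + (a%:C)%C * v x).

(* psi phi is the global solution with initial value phi, phi ranging over the
   space E of initial data. *)
Definition phase_flow (Psi : R -> R -> R -> R) (eps : R) (W : field R)
    (E : set (R -> C)) (psi : (R -> C) -> field C) :=
  real_subspace E /\
  forall phi, E phi -> strong_solution eps W phi (psi phi)
    (fun t w x => nonlinearity Psi x t (psi phi t w x)).

(* Dpsi phi xi is the derivative of the flow at phi in the direction xi, its
   real and imaginary parts being DP[xi] and DQ[xi]; it solves the equation
   linearized along psi phi, with initial value xi. *)
Definition flow_derivative (Psi : R -> R -> R -> R) (eps : R) (W : field R)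
    (E : set (R -> C)) (psi : (R -> C) -> field C)
    (Dpsi : (R -> C) -> (R -> C) -> field C) :=
  forall phi xi, E phi -> E xi ->
  let shift (h : R) : R -> C := fun x => phi x + (h%:C)%C * xi x in
  (forall t, t \in `[t0, T] ->
    cvg_in_prob Pr L 2 (0 : R)^'
      (fun h w x => (reF (psi (shift h)) t w x - reF (psi phi) t w x) / h)
      (reF (Dpsi phi xi) t) /\
    cvg_in_prob Pr L 2 (0 : R)^'
      (fun h w x => (imF (psi (shift h)) t w x - imF (psi phi) t w x) / h)
      (imF (Dpsi phi xi) t)) /\
  strong_solution eps W xi (Dpsi phi xi)
    (fun t w x => dnonlinearity Psi x t (psi phi t w x) (Dpsi phi xi t w x)).

(* The value at phi of the two-form \int dP /\ dQ dx on directions xi, eta. *)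
Definition symplectic_form (Dpsi : (R -> C) -> (R -> C) -> field C)
    (t : R) (w : Omega) (phi xi eta : R -> C) : R :=
  \int[mu]_(x in dom L)
    (reF (Dpsi phi xi) t w x * imF (Dpsi phi eta) t w x -
     reF (Dpsi phi eta) t w x * imF (Dpsi phi xi) t w x).

End Schroedinger.

(* Main.v *)
(* Write P_i, Q_i for the real and imaginary parts of the derivatives of the flow
   in the directions xi (i = 1) and eta (i = 2). Each pair solves two real
   equations -dQ + b dt = dS and dP + c dt = dS', where S and S' are the
   Stratonovich integrals of eps P and eps Q. Over a cell of a dyadic grid of
   [t0, t], the product rule with midpoint values is exact:
   d(P1 Q2) = mid P1 dQ2 + mid Q2 dP1. Replacing dS by eps mid P dW makes all
   noise terms in d(P1 Q2 - P2 Q1) cancel, so the point is that the errors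
   \sum_i mid Y_i (dS_i - eps mid P_i dW_i) tend to 0 in measure on
   Omega * [-L, L]. This follows from an Ito isometry in which x is a mere
   parameter, from the definition of the bracket, and from the tightness of
   quadratic variations. What remains is the pathwise drift
   \int_t0^t (P1 b2 - P2 b1 + Q1 c2 - Q2 c1) ds, whose integral over x vanishes
   because the linearized nonlinearity is symmetric and so is the Dirichlet
   Laplacian, by Fubini. This gives the claim at a fixed time, hence almost surely
   at all dyadic times, and then at all times by continuity. *)
Require Import Defs.
From mathcomp Require Import all_boot all_order all_algebra.
From mathcomp Require Import all_classical all_reals all_analysis.
From mathcomp Require Import measurable_realfun complex.
From mathcomp Require Import ring lra zify.
Import Order.TTheory GRing.Theory Num.Theory.
Import numFieldNormedType.Exports.
Local Open Scope classical_set_scope.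
Local Open Scope ring_scope.
Set Implicit Arguments.
Unset Strict Implicit.
Unset Printing Implicit Defensive.

(** * Iterated integrals *)

(** The solutions are known only through limits of sums in probability, and no moments of them are
    assumed, so products cannot be estimated in L^2. Convergence in measure combined with tightness
    is stable under products, which is why every estimate is phrased with [kap] and [tight]. A
    second obstacle: the definitions of the integral and of the bracket say nothing about the sum
    over a given grid, only about limits along finer and finer ones. Cells of level n are therefore
    compared with their subdivisions of level n + l, with n fixed and l tending to infinity. This
    calls for bounds uniform in l, and for dyadic grids because they are nested. Adaptedness enters
    only through the isometry. Tightness of quadratic variations has three sources: for W the
    isometry; for the Stratonovich integrals that of W and the finite variation of the bracket; for
    the solutions the equation itself, read as a formula for dP and dQ. *)

Lemma aeS {d} {T : measurableType d} {R : realType} (m : {measure set T -> \bar R})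
    (P Q : T -> Prop) :
  (forall x, P x -> Q x) -> {ae m, forall x, P x} -> {ae m, forall x, Q x}.
Proof. by move=> PQ; apply: filterS. Qed.

Lemma aeS2 {d} {T : measurableType d} {R : realType} (m : {measure set T -> \bar R})
    (P Q S : T -> Prop) : (forall x, P x -> Q x -> S x) ->
  {ae m, forall x, P x} -> {ae m, forall x, Q x} -> {ae m, forall x, S x}.
Proof. by move=> PQ; apply: filterS2. Qed.

(* Convergence to 0, for sequences of nonnegative numbers. *)
Definition to0 {R : realType} (u : nat -> R) :=
  forall e : R, 0 < e -> exists N, forall n, (N <= n)%N -> u n <= e.

Section DoubleIntegral.
Context {R : realType} {d : measure_display} {Omega : measurableType d}.
Variables (Pr : probability Omega R) (L : R).
Hypothesis L0 : 0 < L.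
Local Notation mu := (@lebesgue_measure R).
Local Notation D := (dom L).
Local Notation rfun := (Omega -> R -> R).
Implicit Types f g h : rfun.

Definition mea f := measurable_fun (setT `*` D)
  (fun p : (Omega * measurableTypeR R)%type => f p.1 p.2).

Definition pos f := forall w x, D x -> 0 <= f w x.

Definition II f : \bar R := (\int[Pr]_w \int[mu]_(x in D) (f w x)%:E)%E.

(* Iterated as in Defs, rather than almost everywhere for the product measure. *)
Definition AE2 (P : Omega -> R -> Prop) :=
  {ae Pr, forall w, {ae mu, forall x, D x -> P w x}}.

Lemma measurable_dom : measurable (D : set (measurableTypeR R)).
Proof. exact: measurable_itv. Qed.

#[local] Hint Extern 0 (measurable (dom _)) => exact: measurable_dom : core.

Lemma measurable_setTdom :
  measurable (setT `*` D : set (Omega * measurableTypeR R)%type).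
Proof. by apply: measurableX => //; exact: measurable_dom. Qed.

Lemma mu_dom : mu D = (L + L)%:E.
Proof.
rewrite /dom lebesgue_measure_itv /= lte_fin gtrN//.
by rewrite -EFinD opprK.
Qed.

Lemma AE2I (P Q : Omega -> R -> Prop) :
  AE2 P -> AE2 Q -> AE2 (fun w x => P w x /\ Q w x).
Proof.
move=> p q; move: p q; apply: aeS2 => w pw qw.
by move: pw qw; apply: aeS2 => x px qx Dx; split; [exact: px | exact: qx].
Qed.

Lemma AE2S (P Q : Omega -> R -> Prop) :
  (forall w x, D x -> P w x -> Q w x) -> AE2 P -> AE2 Q.
Proof.
move=> PQ p; move: p; apply: aeS => w pw.
by move: pw; apply: aeS => x px Dx; apply: PQ => //; exact: px.
Qed.

Lemma AE2T (P : Omega -> R -> Prop) :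
  (forall w x, D x -> P w x) -> AE2 P.
Proof. by move=> PT; apply: aeW => w; apply: aeW => x; exact: PT. Qed.

Lemma AE2_forall (P : nat -> Omega -> R -> Prop) :
  (forall n, AE2 (P n)) -> AE2 (fun w x => forall n, P n w x).
Proof.
move=> p; have {}p := ae_foralln p; move: p; apply: aeS => w pw.
have {}pw := ae_foralln pw; move: pw; apply: aeS => x px Dx n.
exact: px.
Qed.

(** Extension by zero off [-L, L]: integrals over [D] become integrals over the whole product space,
    to which Tonelli applies. *)
Let ext f : (Omega * measurableTypeR R)%type -> \bar R :=
  (fun p => (f p.1 p.2)%:E) \_ (setT `*` D).

Lemma mea_ext f : mea f -> measurable_fun setT (ext f).
Proof.
move=> mf; apply/(measurable_restrictT _ measurable_setTdom).
exact/measurable_EFinP.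
Qed.

Lemma ext_ge0 f : pos f -> forall p, (0 <= ext f p)%E.
Proof.
move=> f0 [w x]; rewrite /ext patchE; case: ifPn => //.
by rewrite inE => -[_ Dx]; rewrite lee_fin f0.
Qed.

Lemma ext_inner f w :
  (\int[mu]_(x in D) (f w x)%:E = \int[mu]_x ext f (w, x))%E.
Proof.
rewrite integral_mkcond; apply: eq_integral => x _.
rewrite /ext !patchE; congr (if _ then _ else _).
by apply/idP/idP; rewrite !inE //= => -[].
Qed.

Lemma mea_inner f : mea f -> pos f ->
  measurable_fun setT (fun w => \int[mu]_(x in D) (f w x)%:E : \bar R)%E.
Proof.
move=> mf f0.
have := @measurable_fun_fubini_tonelli_F _ _ _ _ _ mu _ (mea_ext mf)
  (ext_ge0 f0).
by apply: eq_measurable_fun => w _; rewrite ext_inner.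
Qed.

Lemma mea_inner2 f : mea f -> pos f ->
  measurable_fun D (fun x => \int[Pr]_w (f w x)%:E : \bar R)%E.
Proof.
move=> mf f0.
have := @measurable_fun_fubini_tonelli_G _ _ _ _ _ Pr _ (mea_ext mf)
  (ext_ge0 f0).
move=> /(measurable_funS measurableT (@subsetT _ D)).
apply: eq_measurable_fun => x; rewrite inE => Dx.
by apply: eq_integral => w _; rewrite /ext patchE mem_set.
Qed.

Lemma mea_sec f w : mea f -> measurable_fun D (f w).
Proof.
move=> mf; have h : measurable_fun setT (fun x : measurableTypeR R => ext f (w, x)).
  exact: (measurableT_comp (mea_ext mf) (pair1_measurable w)).
apply/measurable_EFinP.
apply: (eq_measurable_fun (fun x : measurableTypeR R => ext f (w, x))).
  by move=> x; rewrite inE => Dx; rewrite /ext patchE mem_set.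
exact: measurable_funTS.
Qed.

Lemma mea_sec2 f x : mea f -> D x -> measurable_fun setT (f^~ x).
Proof.
move=> mf Dx.
have h : measurable_fun setT (fun w => ext f (w, x)).
  exact: (measurableT_comp (mea_ext mf) (pair2_measurable (x : measurableTypeR R))).
apply/measurable_EFinP.
apply: (eq_measurable_fun (fun w => ext f (w, x))) => //.
by move=> w _; rewrite /ext patchE mem_set.
Qed.

(** The isometry is proved at a fixed point [x], where the expectation has to be taken first. *)
Lemma II_swap f : mea f -> pos f ->
  II f = (\int[mu]_(x in D) \int[Pr]_w (f w x)%:E)%E.
Proof.
move=> mf f0; rewrite /II.
under eq_integral do rewrite ext_inner.
rewrite (@fubini_tonelli _ _ _ _ _ Pr mu (ext f) (mea_ext mf) (ext_ge0 f0)).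
rewrite [RHS]integral_mkcond; apply: eq_integral => x _.
rewrite patchE; case: ifPn => [|]; rewrite ?inE ?notin_setE => Dx.
  by apply: eq_integral => w _; rewrite /ext patchE mem_set.
by apply: integral0_eq => w _; rewrite /ext patchE memNset//= => -[].
Qed.

Lemma II_le f g : mea f -> mea g -> pos f -> pos g ->
  AE2 (fun w x => f w x <= g w x) -> (II f <= II g)%E.
Proof.
move=> mf mg f0 g0 fg; apply: ae_ge0_le_integral => //.
- by move=> w _; apply: integral_ge0 => x Dx; rewrite lee_fin f0.
- exact: mea_inner.
- by move=> w _; apply: integral_ge0 => x Dx; rewrite lee_fin g0.
- exact: mea_inner.
move: fg; apply: aeS => w fgw _; apply: ae_ge0_le_integral => //.
- by move=> x Dx; rewrite lee_fin f0.
- by apply/measurable_EFinP; exact: mea_sec.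
- by move=> x Dx; rewrite lee_fin g0.
- by apply/measurable_EFinP; exact: mea_sec.
Qed.

Lemma II_D f g : mea f -> mea g -> pos f -> pos g ->
  (II (fun w x => f w x + g w x)%R = II f + II g)%E.
Proof.
move=> mf mg f0 g0; rewrite /II -ge0_integralD//=; last 4 first.
- by move=> w _; apply: integral_ge0 => x Dx; rewrite lee_fin f0.
- exact: mea_inner.
- by move=> w _; apply: integral_ge0 => x Dx; rewrite lee_fin g0.
- exact: mea_inner.
apply: eq_integral => w _; rewrite -ge0_integralD//=.
- by move=> x Dx; rewrite lee_fin f0.
- by apply/measurable_EFinP; exact: mea_sec.
- by move=> x Dx; rewrite lee_fin g0.
- by apply/measurable_EFinP; exact: mea_sec.
Qed.

Lemma II_Z f (c : R) : 0 <= c -> mea f -> pos f ->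
  (II (fun w x => c * f w x)%R = c%:E * II f)%E.
Proof.
move=> c0 mf f0; rewrite /II -ge0_integralZl_EFin//; last 2 first.
- by move=> w _; apply: integral_ge0 => x Dx; rewrite lee_fin f0.
- exact: mea_inner.
apply: eq_integral => w _; rewrite -ge0_integralZl_EFin//=.
- by move=> x Dx; rewrite lee_fin f0.
- by apply/measurable_EFinP; exact: mea_sec.
Qed.

Lemma II_ge0 f : pos f -> (0 <= II f)%E.
Proof.
by move=> f0; apply: integral_ge0 => w _; apply: integral_ge0 => x Dx;
  rewrite lee_fin f0.
Qed.

Lemma mea_cst (c : R -> R) : measurable_fun D c -> mea (fun _ => c).
Proof.
move=> mc; rewrite /mea.
apply/(measurable_restrictT _ measurable_setTdom).
have /(measurable_restrictT _ measurable_dom) h := mc.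
have := measurableT_comp h (@measurable_snd _ _ Omega (measurableTypeR R)).
apply: eq_measurable_fun => -[w x] _ /=; rewrite !patchE/=.
by congr (if _ then _ else _); apply/idP/idP; rewrite !inE //= => -[].
Qed.

Lemma II_cst (c : R -> R) : measurable_fun D c ->
  II (fun _ => c) = (\int[mu]_(x in D) (c x)%:E)%E.
Proof.
by move=> mc; rewrite /II integral_cst//= probability_setT mule1.
Qed.

(** Dominated convergence twice: in [x] at a fixed sample point, then in [w] with the integral of
    [h] as a constant bound. The iterated form of [AE2] matches this order. *)
Lemma II_dct (f_ : nat -> rfun) (h : R -> R) :
  (forall n, mea (f_ n)) -> (forall n, pos (f_ n)) ->
  mu.-integrable D (EFin \o h) ->
  (forall n w x, D x -> f_ n w x <= h x) ->
  AE2 (fun w x => f_ n w x @[n --> \oo] --> 0) ->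
  forall e : R, 0 < e -> exists N, forall n, (N <= n)%N -> (II (f_ n) <= e%:E)%E.
Proof.
move=> mf f0 ih fh f_0 e e0.
have mh : measurable_fun D h by apply/measurable_EFinP; exact: measurable_int ih.
have h0 x : D x -> 0 <= h x.
  by move=> Dx; apply: (le_trans (f0 0%N point x Dx)); exact: fh.
have inn : {ae Pr, forall w, setT w ->
    (\int[mu]_(x in D) (f_ n w x)%:E)%E @[n --> \oo] --> (cst 0%E w)}.
  move: f_0; apply: aeS => w fw _.
  have [//|//|||_ _] := @dominated_convergence _ _ _ mu _ measurable_dom
    (fun n x => (f_ n w x)%:E) (cst 0%E) (EFin \o h) _ _ _ ih.
  - by move=> n; apply/measurable_EFinP; exact: mea_sec.
  - by move: fw; apply: aeS => x h1 Dx; apply: cvg_EFin => //; [exact: nearW|exact: h1].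
  - by apply: aeW => x n Dx; rewrite gee0_abs ?lee_fin ?f0// fh.
  by rewrite integral_cst// mul0e.
have bnd : (\int[mu]_(x in D) (h x)%:E < +oo)%E by exact: integrable_lty.
have bfin : (\int[mu]_(x in D) (h x)%:E)%E \is a fin_num.
  by rewrite ge0_fin_numE// integral_ge0// => x Dx; rewrite lee_fin h0.
have [//|//|||_ _] := @dominated_convergence _ _ _ Pr setT measurableT
    (fun n w => \int[mu]_(x in D) (f_ n w x)%:E)%E (cst 0%E)
    (cst (\int[mu]_(x in D) (h x)%:E)%E) _ _ inn.
- by move=> n; exact: mea_inner.
- rewrite -(fineK bfin); exact: finite_measure_integrable_cst.
- apply: aeW => w n _; rewrite gee0_abs; last first.
    by apply: integral_ge0 => x Dx; rewrite lee_fin f0.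
  apply: ge0_le_integral => //; first by move=> x Dx; rewrite lee_fin f0.
  + by apply/measurable_EFinP; exact: mea_sec.
  + exact/measurable_EFinP.
  + by move=> x Dx; rewrite lee_fin fh.
rewrite integral_cst// mul0e => cv.
have := cv [set y | (y < e%:E)%E].
case=> [|N _ HN]; last first.
  by exists N => n Nn; apply: ltW; exact: HN.
by apply: open_ereal_lt'; rewrite lte_fin.
Qed.

End DoubleIntegral.

(** * Convergence in measure and tightness *)

Section KyFan.
Context {R : realType} {d : measure_display} {Omega : measurableType d}.
Variables (Pr : probability Omega R) (L : R).
Hypothesis L0 : 0 < L.
Local Notation mu := (@lebesgue_measure R).
Local Notation D := (dom L).
Local Notation rfun := (Omega -> R -> R).
Local Notation mea := (@mea R d Omega L).
Local Notation pos := (@pos R d Omega L).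
Local Notation II := (@II R d Omega Pr L).
Local Notation AE2 := (@AE2 R d Omega Pr L).
Implicit Types f g h : rfun.

Definition min1 (a : R) : R := Num.min 1 `|a|.

Lemma min1_ge0 a : 0 <= min1 a.
Proof. by rewrite /min1 le_min ler01 normr_ge0. Qed.

Lemma min1_le1 a : min1 a <= 1.
Proof. by rewrite /min1 ge_min lexx. Qed.

Lemma min1_le a : min1 a <= `|a|.
Proof. by rewrite /min1 ge_min lexx orbT. Qed.

Lemma min1_mono a b : `|a| <= `|b| -> min1 a <= min1 b.
Proof. by move=> ab; rewrite /min1 le_min !ge_min lexx ab orbT. Qed.

Lemma min1D a b c : `|c| <= `|a| + `|b| -> min1 c <= min1 a + min1 b.
Proof.
move=> cab; rewrite /min1; have := normr_ge0 a; have := normr_ge0 b.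
by case: (leP 1 `|a|); case: (leP 1 `|b|); case: (leP 1 `|c|) => *; lra.
Qed.

(** Either |b| >= K and the last term equals 1, or |b| < K and |ab| <= K |a|. *)
Lemma min1M K a b c : 1 <= K -> `|c| <= `|a * b| ->
  min1 c <= K * min1 a + min1 (b / K).
Proof.
move=> K1; rewrite /min1 !normrM (gtr0_norm (_ : 0 < K^-1)); last first.
  by rewrite invr_gt0; lra.
have a0 := normr_ge0 a; have b0 := normr_ge0 b => cab.
have [h|h] := leP 1 (`|b| / K).
  have : Num.min 1 `|c| <= 1 by rewrite ge_min lexx.
  have : 0 <= K * Num.min 1 `|a|.
    by apply: mulr_ge0; [lra|rewrite le_min ler01 a0].
  lra.
have {}h : `|b| < K by move: h; rewrite ltr_pdivrMr ?mul1r//; lra.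
have bK : 0 <= `|b| / K by apply: divr_ge0 => //; lra.
suff : Num.min 1 `|c| <= K * Num.min 1 `|a| by lra.
have [a1|a1] := leP 1 `|a|.
  have : Num.min 1 `|c| <= 1 by rewrite ge_min lexx.
  lra.
have : Num.min 1 `|c| <= `|c| by rewrite ge_min lexx orbT.
nra.
Qed.

(** If |a| or |b| is at least 1, so is the right-hand side; otherwise |ab| <= |a|. *)
Lemma min1M1 a b c : `|c| <= `|a * b| -> min1 c <= min1 a + min1 b.
Proof.
rewrite /min1 normrM; move: (normr_ge0 a) (normr_ge0 b).
move: `|a| `|b| `|c| => u v z u0 v0 zuv.
by case: (leP 1 u); case: (leP 1 v); case: (leP 1 z) => *; nra.
Qed.

Lemma int_dom_cst (c : R) : (\int[mu]_(x in D) c%:E = (c * (L + L))%:E)%E.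
Proof.
apply: (etrans (integral_cst mu (measurable_dom L) c%:E)).
exact: (congr1 (mule c%:E) (mu_dom L0)).
Qed.

Lemma int_prob_cst (c : R) : (\int[Pr]__ c%:E = c%:E)%E.
Proof.
apply: (etrans (integral_cst Pr measurableT c%:E)).
exact: (etrans (congr1 (mule c%:E) (probability_setT Pr)) (mule1 _)).
Qed.

Lemma integrable_dom_cst (c : R) : mu.-integrable D (EFin \o cst c).
Proof.
apply/integrableP; split; first by apply/measurable_EFinP; exact: measurable_cst.
by under eq_integral do rewrite /=; rewrite int_dom_cst ltry.
Qed.

Lemma mea_const (c : R) : mea (fun _ _ => c).
Proof. exact: measurable_cst. Qed.

Lemma meaD f g : mea f -> mea g -> mea (fun w x => f w x + g w x).
Proof. exact: measurable_funD. Qed.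

Lemma meaB f g : mea f -> mea g -> mea (fun w x => f w x - g w x).
Proof. exact: measurable_funB. Qed.

Lemma meaM f g : mea f -> mea g -> mea (fun w x => f w x * g w x).
Proof. exact: measurable_funM. Qed.

Lemma meaX f n : mea f -> mea (fun w x => f w x ^+ n).
Proof. exact: measurable_funX. Qed.

Lemma mea_norm f : mea f -> mea (fun w x => `|f w x|).
Proof. by move=> mf; exact: measurableT_comp. Qed.

Lemma mea_min f g : mea f -> mea g -> mea (fun w x => Num.min (f w x) (g w x)).
Proof. exact: measurable_minr. Qed.

Lemma mea_max f g : mea f -> mea g -> mea (fun w x => Num.max (f w x) (g w x)).
Proof. exact: measurable_maxr. Qed.

Lemma mea_min1 f : mea f -> mea (fun w x => min1 (f w x)).
Proof. by move=> mf; apply: mea_min; [exact: mea_const|exact: mea_norm]. Qed.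

Lemma mea_sum n (F : nat -> rfun) : (forall i, (i < n)%N -> mea (F i)) ->
  mea (fun w x => \sum_(i < n) F i w x).
Proof.
elim: n => [|n IH] mF.
  rewrite (_ : (fun w x => _) = fun _ _ => 0); first exact: mea_const.
  by apply/funext => w; apply/funext => x; rewrite big_ord0.
rewrite (_ : (fun w x => _) = fun w x => \sum_(i < n) F i w x + F n w x).
  2: by apply/funext => w; apply/funext => x; rewrite big_ord_recr.
by apply: meaD; [apply: IH => i ni; apply: mF; exact: ltnW|exact: mF].
Qed.

Lemma mea_bigmax n (F : nat -> rfun) : (forall i, (i < n)%N -> mea (F i)) ->
  mea (fun w x => \big[Num.max/0]_(i < n) F i w x).
Proof.
elim: n F => [|n IH] F mF.
  rewrite (_ : (fun w x => _) = fun _ _ => 0); first exact: mea_const.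
  by apply/funext => w; apply/funext => x; rewrite big_ord0.
rewrite (_ : (fun w x => _) =
    fun w x => Num.max (F 0%N w x) (\big[Num.max/0]_(i < n) F i.+1 w x)).
  by apply: mea_max; [exact: mF|apply: (IH (F \o succn)) => i ni; exact: mF].
by apply/funext => w; apply/funext => x; rewrite big_ord_recl.
Qed.

(* kap f is the integral of min(1, |f|), which metrizes convergence in measure on
   Omega * [-L, L]; it is sealed so that unification and lra never unfold it. *)
Fact kap_sealed : {k : rfun -> R | forall f, k f = fine (II (fun w x => min1 (f w x)))}.
Proof. by exists (fun f => fine (II (fun w x => min1 (f w x)))). Qed.

Definition kap := sval kap_sealed.

Let kap_def f : kap f = fine (II (fun w x => min1 (f w x))).
Proof. exact: (svalP kap_sealed). Qed.

Lemma pos_min1 f : pos (fun w x => min1 (f w x)).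
Proof. by move=> w x _; exact: min1_ge0. Qed.

Lemma kapE f : mea f -> II (fun w x => min1 (f w x)) = (kap f)%:E.
Proof.
move=> mf; rewrite kap_def fineK// ge0_fin_numE; last exact: II_ge0 (pos_min1 f).
apply: (@le_lt_trans _ _ (II (fun _ _ => 1))).
  apply: II_le => //; [exact: mea_min1|exact: mea_const|exact: pos_min1|].
  by apply: AE2T => w x _; exact: min1_le1.
rewrite (@II_cst _ _ _ Pr L (cst 1))//.
by rewrite int_dom_cst ltry.
Qed.

Lemma kap_ge0 f : 0 <= kap f.
Proof. by rewrite kap_def; apply: fine_ge0; apply: II_ge0; exact: pos_min1. Qed.

Lemma kap_le2 h f g : mea h -> mea f -> mea g ->
  AE2 (fun w x => min1 (h w x) <= min1 (f w x) + min1 (g w x)) ->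
  kap h <= kap f + kap g.
Proof.
move=> mh mf mg le; rewrite -lee_fin EFinD -!kapE// -II_D//;
  [|exact: mea_min1..|exact: pos_min1|exact: pos_min1].
apply: II_le => //; [exact: mea_min1| |exact: pos_min1|].
  by apply: meaD; exact: mea_min1.
by move=> w x _; apply: addr_ge0; exact: min1_ge0.
Qed.

Lemma kap_le h f : mea h -> mea f ->
  AE2 (fun w x => `|h w x| <= `|f w x|) -> kap h <= kap f.
Proof.
move=> mh mf le; rewrite -lee_fin -(kapE mh) -(kapE mf).
apply: II_le => //; [exact: mea_min1|exact: mea_min1|exact: pos_min1..|].
by move: le; apply: AE2S => w x _ le; exact: min1_mono.
Qed.

Lemma kap_add h f g : mea h -> mea f -> mea g ->
  AE2 (fun w x => `|h w x| <= `|f w x| + `|g w x|) -> kap h <= kap f + kap g.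
Proof.
move=> mh mf mg le; apply: kap_le2 => //.
by move: le; apply: AE2S => w x _; exact: min1D.
Qed.

(** The way tightness of [g] is exploited: a large [K] makes the last term small, and the factor [K]
    is then absorbed by the smallness of [f]. *)
Lemma kap_mul K h f g : 1 <= K -> mea h -> mea f -> mea g ->
  AE2 (fun w x => `|h w x| <= `|f w x * g w x|) ->
  kap h <= K * kap f + kap (fun w x => g w x / K).
Proof.
move=> K1 mh mf mg le.
have mgK : mea (fun w x => g w x / K) by apply: meaM => //; exact: mea_const.
have K0 : 0 <= K by lra.
rewrite -lee_fin EFinD EFinM -!kapE// -II_Z//;
  [|exact: mea_min1|exact: pos_min1].
rewrite -II_D//; last 4 first.
- by apply: meaM; [exact: mea_const|exact: mea_min1].
- exact: mea_min1.
- by move=> w x _; apply: mulr_ge0 => //; exact: min1_ge0.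
- exact: pos_min1.
apply: II_le => //; [exact: mea_min1| |exact: pos_min1| |].
- apply: meaD; last exact: mea_min1.
  by apply: meaM; [exact: mea_const|exact: mea_min1].
- move=> w x _; apply: addr_ge0; last exact: min1_ge0.
  by apply: mulr_ge0 => //; exact: min1_ge0.
by move: le; apply: AE2S => w x _; exact: min1M.
Qed.

Lemma kap_sum n (F : nat -> rfun) : (forall i, (i < n)%N -> mea (F i)) ->
  kap (fun w x => \sum_(i < n) F i w x) <= \sum_(i < n) kap (F i).
Proof.
elim: n => [|n IH] mF.
  rewrite big_ord0 -lee_fin -kapE; last first.
    by apply: (@mea_sum 0) => // i.
  rewrite /II; under eq_integral do under eq_integral do
    rewrite big_ord0 /min1 normr0 min_r//.
  by under eq_integral do rewrite integral0; rewrite integral0.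
rewrite big_ord_recr /=.
apply: le_trans; last first.
  by apply: lerD; [apply: IH => i ni; apply: mF; exact: ltnW|exact: lexx].
apply: kap_add; [exact: mea_sum| |exact: mF|].
  by apply: mea_sum => i ni; apply: mF; exact: ltnW.
by apply: AE2T => w x _; rewrite big_ord_recr /=; exact: ler_normD.
Qed.

Lemma kap_dct (f_ : nat -> rfun) : (forall n, mea (f_ n)) ->
  AE2 (fun w x => f_ n w x @[n --> \oo] --> 0) -> to0 (fun n => kap (f_ n)).
Proof.
move=> mf f0 e e0.
have [|||||N HN] := @II_dct _ _ _ Pr L (fun n w x => min1 (f_ n w x)) (cst 1)
   _ _ _ _ _ _ e0.
- by move=> n; exact: mea_min1.
- by move=> n; exact: pos_min1.
- exact: integrable_dom_cst.
- by move=> n w x _; exact: min1_le1.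
- move: f0; apply: AE2S => w x _ f0.
  apply: (@squeeze_cvgr _ _ _ _ (cst 0) (fun n => `|f_ n w x|)).
  + by near=> n; rewrite min1_ge0 min1_le.
  + exact: cvg_cst.
  + by rewrite -(normr0 R); exact: cvg_norm.
by exists N => n Nn; rewrite -lee_fin -kapE// HN.
Unshelve. all: by end_near. Qed.

Lemma kap_eq0 f : mea f -> kap f = 0 -> AE2 (fun w x => f w x = 0).
Proof.
move=> mf k0; have := kapE mf; rewrite k0 => /= I0.
have mi := mea_inner (mea_min1 mf) (pos_min1 f).
have i0 w : (0 <= \int[mu]_(x in D) (min1 (f w x))%:E)%E.
  by apply: integral_ge0 => x _; rewrite lee_fin min1_ge0.
have /(ae_eq_integral_abs Pr measurableT mi) : (\int[Pr]_w
    `|\int[mu]_(x in D) (min1 (f w x))%:E| = 0)%E.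
  by rewrite -[RHS]I0; apply: eq_integral => w _; rewrite gee0_abs.
apply: aeS => w /(_ I) h.
have mw : measurable_fun D (EFin \o (fun x => min1 (f w x))).
  by apply/measurable_EFinP; exact: mea_sec (mea_min1 mf).
have /(ae_eq_integral_abs mu (measurable_dom L) mw) :
    (\int[mu]_(x in D) `|(EFin \o (fun x => min1 (f w x))) x| = 0)%E.
  rewrite -[RHS]h; apply: eq_integral => x _ /=.
  by rewrite ger0_norm// min1_ge0.
apply: aeS => x + Dx => /(_ Dx) [].
rewrite /min1; case: (leP 1 `|f w x|) => [_|_ /eqP]; first by lra.
by rewrite normr_eq0 => /eqP.
Qed.

(** Uniqueness of the limit: kap f <= kap (f - f_n) + kap f_n, where the first term tends to 0 by
    bounded convergence. *)
Lemma kap_cvg (f_ : nat -> rfun) f : (forall n, mea (f_ n)) -> mea f ->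
  AE2 (fun w x => f_ n w x @[n --> \oo] --> f w x) ->
  to0 (fun n => kap (f_ n)) -> AE2 (fun w x => f w x = 0).
Proof.
move=> mf_ mf cv k0; apply: kap_eq0 => //.
apply/eqP; rewrite eq_le kap_ge0 andbT; apply/ler_addgt0Pr => e e0.
rewrite add0r; have e2 : 0 < e / 2 by lra.
have [N1 H1] := k0 _ e2.
have mB n : mea (fun w x => f w x - f_ n w x) by exact: meaB.
have [||N2 H2] := @kap_dct (fun n w x => f w x - f_ n w x) _ _ _ e2 => //.
  move: cv; apply: AE2S => w x _ cv; rewrite -[X in _ --> X](subrr (f w x)).
  by apply: cvgB => //; exact: cvg_cst.
have {}H1 := H1 (maxn N1 N2) (leq_maxl _ _).
have {}H2 := H2 (maxn N1 N2) (leq_maxr _ _).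
apply: (@le_trans _ _ (kap (fun w x => f w x - f_ (maxn N1 N2) w x) +
   kap (f_ (maxn N1 N2)))); last by lra.
apply: kap_add => //; apply: AE2T => w x _.
by rewrite -{1}(subrK (f_ (maxn N1 N2) w x) (f w x)); exact: ler_normD.
Qed.

Lemma kap_L1 f (a : R) : mea f -> (II (fun w x => `|f w x|)%R <= a%:E)%E ->
  kap f <= a.
Proof.
move=> mf fa; rewrite -lee_fin -(kapE mf); apply: le_trans fa.
apply: II_le => //; [exact: mea_min1|exact: mea_norm|exact: pos_min1|].
by apply: AE2T => w x _; exact: min1_le.
Qed.

(** Chebyshev in integrated form: min(1, |f|) <= dl + dl^-2 f^2 pointwise. If the integral of f^2 is
    at most dl^3, the right-hand side integrates to at most (2L + 1) dl, which is [e]. *)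
Lemma kap_L2 (e : R) : 0 < e -> exists2 a : R, 0 < a &
  forall f, mea f -> (II (fun w x => f w x ^+ 2)%R <= a%:E)%E -> kap f <= e.
Proof.
have L00 := L0; move=> e0; pose dl := e / (L + L + 1).
have L1 : 0 < L + L + 1 by lra.
have dl0 : 0 < dl by rewrite divr_gt0.
have edl : e = (L + L) * dl + dl by rewrite /dl; field; rewrite gt_eqF.
exists (dl ^+ 3); first exact: exprn_gt0.
move=> f mf fa; rewrite -lee_fin -(kapE mf).
apply: (@le_trans _ _ (II (fun w x => dl + dl^-2 * f w x ^+ 2)%R)).
  have m2 : mea (fun w x => dl^-2 * f w x ^+ 2).
    by apply: meaM; [exact: mea_const|exact: meaX].
  apply: II_le => //; [exact: mea_min1| |exact: pos_min1| |].
  - by apply: meaD => //; exact: mea_const.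
  - move=> w x _; apply: addr_ge0; first exact: ltW.
    by rewrite mulr_ge0 ?sqr_ge0// invr_ge0 sqr_ge0.
  apply: AE2T => w x _; have [h|h] := leP `|f w x| dl.
    apply: (le_trans (min1_le _)); apply: (le_trans h).
    by rewrite lerDl mulr_ge0 ?sqr_ge0// invr_ge0 sqr_ge0.
  apply: (le_trans (min1_le1 _)).
  suff : 1 <= dl^-2 * f w x ^+ 2 by lra.
  rewrite -[X in _ * X]real_normK ?num_real// ler_pdivlMl ?exprn_gt0// mulr1.
  by rewrite ler_sqr ?nnegrE ?ltW// (lt_trans dl0).
rewrite II_D//; last 4 first.
- exact: mea_const.
- by apply: meaM; [exact: mea_const|exact: meaX].
- by move=> w x _; exact: ltW.
- by move=> w x _; rewrite mulr_ge0 ?sqr_ge0// invr_ge0 sqr_ge0.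
have i0 : 0 <= dl^-2 by rewrite invr_ge0 sqr_ge0.
rewrite (II_Z Pr i0 (meaX 2 mf)); last by move=> w x _; exact: sqr_ge0.
rewrite (@II_cst _ _ _ Pr L (cst dl))// int_dom_cst.
rewrite edl EFinD [X in X%:E]mulrC; apply: leeD => //.
apply: (@le_trans _ _ ((dl^-2)%:E * (dl ^+ 3)%:E)%E).
  by rewrite lee_wpmul2l// lee_fin.
rewrite -EFinM lee_fin exprS mulrCA mulVf ?mulr1//.
by rewrite sqrf_eq0 gt_eqF.
Qed.

(* Boundedness in measure. *)
Definition tight (Y : nat -> rfun) := forall e : R, 0 < e -> exists2 K, 1 <= K &
  exists N, forall n, (N <= n)%N -> kap (fun w x => Y n w x / K) <= e.

(** The bound may depend on the point without being measurable, so it cannot be integrated. Instead,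
    if tightness fails, some subsequence Y_{n(k)} / (k + 1) stays away from 0 in measure, although
    it tends to 0 pointwise. *)
Lemma tight_bdd (Y : nat -> rfun) : (forall n, mea (Y n)) ->
  AE2 (fun w x => exists B, forall n, `|Y n w x| <= B) -> tight Y.
Proof.
move=> mY bY e e0; apply: contrapT => h.
have {}h k : exists n, e < kap (fun w x => Y n w x / k.+1%:R).
  apply: contrapT => hn; apply: h; exists k.+1%:R; first by rewrite ler1n.
  exists 0%N => n _; rewrite leNgt; apply/negP => en; apply: hn; by exists n.
have [n hn] := choice h.
have mk k : mea (fun w x => Y (n k) w x / k.+1%:R).
  by apply: meaM => //; exact: mea_const.
have [|N /(_ N (leqnn _))] := kap_dct mk _ e0; last by have := hn N; lra.
move: bY; apply: AE2S => w x _ [B hB].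
apply: (@squeeze_cvgr _ _ _ _ (fun k => - (B * k.+1%:R^-1))
    (fun k => B * k.+1%:R^-1)).
- near=> k; rewrite -ler_norml normrM (ger0_norm (_ : 0 <= _^-1))//.
  by rewrite ler_wpM2r.
- rewrite -[X in _ --> X]oppr0 -(mulr0 B); apply: cvgN.
  by apply: cvgMr; exact: cvg_harmonic.
- by rewrite -(mulr0 B); apply: cvgMr; exact: cvg_harmonic.
Unshelve. all: by end_near. Qed.

Lemma tight_L1 (Y : nat -> rfun) (C : R) : (forall n, mea (Y n)) ->
  (forall n, (II (fun w x => `|Y n w x|)%R <= C%:E)%E) -> tight Y.
Proof.
move=> mY hC e e0; pose K := Num.max 1 (C / e).
have K1 : 1 <= K by rewrite le_max lexx.
have K0 : 0 < K by lra.
exists K => //; exists 0%N => n _; apply: kap_L1.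
  by apply: meaM => //; exact: mea_const.
have -> : (fun w x => `|Y n w x / K|) = (fun w x => K^-1 * `|Y n w x|).
  apply/funext => w; apply/funext => x.
  by rewrite normrM (gtr0_norm (_ : 0 < K^-1)) ?invr_gt0// mulrC.
rewrite II_Z ?invr_ge0 ?(ltW K0)//; last exact: mea_norm.
apply: (@le_trans _ _ (K^-1%:E * C%:E)%E).
  by rewrite lee_wpmul2l// lee_fin invr_ge0 (ltW K0).
rewrite -EFinM lee_fin ler_pdivrMl// -ler_pdivrMr//.
by rewrite le_max lexx orbT.
Qed.

Lemma tight_le2 (X Y Z : nat -> rfun) :
  (forall n, mea (X n)) -> (forall n, mea (Y n)) -> (forall n, mea (Z n)) ->
  AE2 (fun w x => forall n, `|X n w x| <= `|Y n w x| + `|Z n w x|) ->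
  tight Y -> tight Z -> tight X.
Proof.
move=> mX mY mZ le tY tZ e e0; have e2 : 0 < e / 2 by lra.
have [K1 K11 [N1 H1]] := tY _ e2; have [K2 K21 [N2 H2]] := tZ _ e2.
pose K := Num.max K1 K2.
have KK1 : K1 <= K by rewrite le_max lexx.
have KK2 : K2 <= K by rewrite le_max lexx orbT.
exists K; first by lra.
exists (maxn N1 N2) => n; rewrite geq_max => /andP[n1 n2].
have mdiv (V : nat -> rfun) c : (forall n, mea (V n)) ->
    mea (fun w x => V n w x / c).
  by move=> mV; apply: meaM => //; exact: mea_const.
have {}H1 := H1 n n1; have {}H2 := H2 n n2.
suff : kap (fun w x => X n w x / K) <= kap (fun w x => Y n w x / K1) +
    kap (fun w x => Z n w x / K2) by lra.
apply: kap_add; rewrite ?mdiv//; [exact: mdiv..|].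
move: le; apply: AE2S => w x _ /(_ n) le.
have i0 : 0 < K^-1 by rewrite invr_gt0; lra.
have i1 : 0 < K1^-1 by rewrite invr_gt0; lra.
have i2 : 0 < K2^-1 by rewrite invr_gt0; lra.
have i01 : K^-1 <= K1^-1 by rewrite lef_pV2// posrE; lra.
have i02 : K^-1 <= K2^-1 by rewrite lef_pV2// posrE; lra.
rewrite !normrM (gtr0_norm i0) (gtr0_norm i1) (gtr0_norm i2).
have := normr_ge0 (Y n w x); have := normr_ge0 (Z n w x).
nra.
Qed.

Lemma tightM (X Y Z : nat -> rfun) :
  (forall n, mea (X n)) -> (forall n, mea (Y n)) -> (forall n, mea (Z n)) ->
  AE2 (fun w x => forall n, `|X n w x| <= `|Y n w x * Z n w x|) ->
  tight Y -> tight Z -> tight X.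
Proof.
move=> mX mY mZ le tY tZ e e0; have e2 : 0 < e / 2 by lra.
have [K1 K11 [N1 H1]] := tY _ e2; have [K2 K21 [N2 H2]] := tZ _ e2.
have KK1 : 1 <= K1 * K2 by nra.
exists (K1 * K2) => //.
exists (maxn N1 N2) => n; rewrite geq_max => /andP[n1 n2].
have mdiv (V : nat -> rfun) c : (forall n, mea (V n)) ->
    mea (fun w x => V n w x / c).
  by move=> mV; apply: meaM => //; exact: mea_const.
have {}H1 := H1 n n1; have {}H2 := H2 n n2.
suff : kap (fun w x => X n w x / (K1 * K2)) <= kap (fun w x => Y n w x / K1) +
    kap (fun w x => Z n w x / K2) by lra.
apply: kap_le2; rewrite ?mdiv//; [exact: mdiv..|].
move: le; apply: AE2S => w x _ /(_ n) le.
have -> : X n w x / (K1 * K2) = X n w x / K1 / K2.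
  by rewrite invfM mulrA.
have i1 : 0 < K1^-1 by rewrite invr_gt0; lra.
have i2 : 0 < K2^-1 by rewrite invr_gt0; lra.
have : `|X n w x / K1 / K2| <= `|Y n w x / K1| * `|Z n w x / K2|.
  rewrite -normrM !normrM (gtr0_norm i1) (gtr0_norm i2).
  rewrite normrM in le.
  have : 0 < K1^-1 * K2^-1 by rewrite mulr_gt0.
  nra.
by rewrite -normrM; exact: min1M1.
Qed.

Lemma tight_to0 (Y : nat -> rfun) : to0 (fun n => kap (Y n)) -> tight Y.
Proof.
move=> k0 e /k0[N HN]; exists 1 => //; exists N => n /HN.
by under [in X in _ -> X]eq_fun do under eq_fun do rewrite divr1.
Qed.

Lemma to0M (X Y Z : nat -> rfun) :
  (forall n, mea (X n)) -> (forall n, mea (Y n)) -> (forall n, mea (Z n)) ->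
  AE2 (fun w x => forall n, `|X n w x| <= `|Y n w x * Z n w x|) ->
  to0 (fun n => kap (Y n)) -> tight Z -> to0 (fun n => kap (X n)).
Proof.
move=> mX mY mZ le tY tZ e e0; have e2 : 0 < e / 2 by lra.
have [K K1 [N H]] := tZ _ e2.
have K0 : 0 < K by lra.
have [N' H'] := tY _ (divr_gt0 e2 K0).
exists (maxn N N') => n; rewrite geq_max => /andP[/H {}H /H' {}H'].
apply: (@le_trans _ _ (K * kap (Y n) + kap (fun w x => Z n w x / K))).
  by apply: kap_mul => //; move: le; apply: AE2S => w x _; exact.
by move: H'; rewrite ler_pdivlMr//; lra.
Qed.

Lemma to0D (X Y Z : nat -> rfun) :
  (forall n, mea (X n)) -> (forall n, mea (Y n)) -> (forall n, mea (Z n)) ->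
  AE2 (fun w x => forall n, `|X n w x| <= `|Y n w x| + `|Z n w x|) ->
  to0 (fun n => kap (Y n)) -> to0 (fun n => kap (Z n)) ->
  to0 (fun n => kap (X n)).
Proof.
move=> mX mY mZ le tY tZ e e0; have e2 : 0 < e / 2 by lra.
have [N H] := tY _ e2; have [N' H'] := tZ _ e2.
exists (maxn N N') => n; rewrite geq_max => /andP[/H {}H /H' {}H'].
apply: (@le_trans _ _ (kap (Y n) + kap (Z n))); last by lra.
by apply: kap_add => //; move: le; apply: AE2S => w x _; exact.
Qed.

(** Links convergence in probability of L^p norms to [kap], with threshold dl^2 for both the norm
    and the probability. On the exceptional event the inner integral is at most 2L, which
    contributes 2L dl^2. Elsewhere min(1, |f|) <= dl + dl^-p |f|^p integrates to at most 2L dl +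
    dl^p. As dl < 1, the total is at most (4L + 1) dl, and [dl] is chosen to keep this below [e]. *)
Lemma prob_kap (p : nat) (e : R) : (0 < p)%N -> 0 < e -> exists2 a : R, 0 < a &
  forall f, mea f ->
    (Pr [set w | a%:E <= Lpnorm L p (f w)] < a%:E)%E -> kap f <= e.
Proof.
have L00 := L0; move=> p0 e0; have M0 : 0 < 4 * L + 1 + e by lra.
pose dl := e / (4 * L + 1 + e).
have dl0 : 0 < dl by rewrite divr_gt0.
have dl1 : dl < 1 by rewrite ltr_pdivrMr//; lra.
have edl : (4 * L + 1) * dl <= e.
  by rewrite /dl mulrCA ler_piMr ?(ltW e0)// ler_pdivrMr// mul1r; lra.
exists (dl ^+ 2); first exact: exprn_gt0.
move=> f mf.
have mp : mea (fun w x => `|f w x| ^+ p) by apply: meaX; exact: mea_norm.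
have pp : pos (fun w x => `|f w x| ^+ p) by move=> w x _; exact: exprn_ge0.
pose S := [set w | ((dl ^+ 2)%:E <= Lpnorm L p (f w))%E].
have mS : measurable S.
  rewrite -[S]setTI; apply: measurable_lee => //.
  rewrite /Lpnorm; apply: (measurableT_comp (measurable_poweR _)).
  exact: (mea_inner mp pp).
rewrite -/S => PS; rewrite -lee_fin -(kapE mf).
pose c := (L + L + 1) * dl.
have c0 : 0 <= c by rewrite /c; nra.
apply: (@le_trans _ _ (\int[Pr]_w (c%:E + ((L + L) * \1_S w)%:E))%E); last first.
  rewrite ge0_integralD//; last 2 first.
  - by move=> w _; rewrite lee_fin mulr_ge0//; lra.
  - by apply/measurable_EFinP; apply: measurable_funM.
  rewrite int_prob_cst.
  under eq_integral do rewrite EFinM.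
  rewrite ge0_integralZl_EFin//; last 2 first.
  - exact/measurable_EFinP.
  - lra.
  rewrite integral_indic// setIT.
  have PSf : Pr S \is a fin_num by exact: fin_num_measure.
  rewrite [leLHS](_ : _ = (c + (L + L) * fine (Pr S))%:E); last first.
    exact: (congr2 adde erefl (congr1 (mule (L + L)%:E) (esym (fineK PSf)))).
  rewrite lee_fin.
  have : fine (Pr S) < dl ^+ 2 by rewrite -lte_fin fineK.
  have : 0 <= fine (Pr S) by exact: fine_ge0.
  move: (fine (Pr S)) => y y0 ydl; rewrite /c.
  have : (L + L) * y <= (L + L) * (dl * dl) by rewrite ler_pM2l; lra.
  have : (L + L) * (dl * dl) <= (L + L) * (dl * 1).
    by rewrite !ler_pM2l; lra.
  by move: edl; rewrite mulr1 !mulrDl !mul1r; lra.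
apply: ge0_le_integral => //.
- by move=> w _; apply: integral_ge0 => x _; rewrite lee_fin min1_ge0.
- exact: mea_inner (mea_min1 mf) (pos_min1 f).
- apply: emeasurable_funD => //; apply/measurable_EFinP.
  by apply: measurable_funM.
move=> w _; rewrite indicE; case: (boolP (w \in S)) => wS.
  rewrite mulr1; apply: (@le_trans _ _ (L + L)%:E); last by rewrite leeDr.
  apply: (@le_trans _ _ (\int[mu]_(x in D) 1%:E)%E).
    apply: (ge0_le_integral mu (measurable_dom L)) => //.
    + by move=> x _; rewrite lee_fin min1_ge0.
    + by apply/measurable_EFinP; exact: mea_sec (mea_min1 mf).
    + by move=> x _; rewrite lee_fin min1_le1.
  by rewrite int_dom_cst mul1r.
rewrite mulr0 adde0.
have {wS} : (Lpnorm L p (f w) < (dl ^+ 2)%:E)%E.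
  by rewrite ltNge; apply/negP => h; move/negP: wS; apply; rewrite inE.
set V := (\int[mu]_(x in D) (`|f w x| ^+ p)%:E)%E.
have V0 : (0 <= V)%E by apply: integral_ge0 => x _; rewrite lee_fin exprn_ge0.
rewrite /Lpnorm -/V => hV.
have {hV} : (V <= (dl ^+ 2 ^+ p)%:E)%E.
  have [p' pE] : exists p', p = p'.+1 by exists p.-1; rewrite prednK.
  move/ltW: hV => /(@gt0_ler_poweR _ p%:R (ler0n _ _)).
  rewrite -poweRrM mulVf ?pnatr_eq0 ?lt0n_neq0// poweRe1//.
  rewrite !in_itv/= !leey !andbT poweR_ge0 lee_fin sqr_ge0 => /(_ isT isT).
  by rewrite powR_mulrn ?sqr_ge0.
move=> hV.
apply: (@le_trans _ _ (\int[mu]_(x in D) (dl%:E + (dl ^- p)%:E * (`|f w x| ^+ p)%:E))%E).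
  have mfp : measurable_fun D (fun x => (`|f w x| ^+ p)%:E).
    by apply/measurable_EFinP; exact: mea_sec mp.
  apply: (ge0_le_integral mu (measurable_dom L)) => //.
  + by move=> x _; rewrite lee_fin min1_ge0.
  + by apply/measurable_EFinP; exact: mea_sec (mea_min1 mf).
  + by apply: emeasurable_funD => //; exact: measurable_funeM.
  move=> x _; rewrite -EFinM -EFinD lee_fin.
  have dp : 0 < dl ^+ p by exact: exprn_gt0.
  have [h|h] := leP `|f w x| dl.
    apply: (le_trans (min1_le _)); apply: (le_trans h).
    by rewrite lerDl mulr_ge0 ?exprn_ge0// invr_ge0 ltW.
  apply: (le_trans (min1_le1 _)).
  suff : 1 <= dl ^- p * `|f w x| ^+ p by lra.
  by rewrite ler_pdivlMl// mulr1 lerXn2r// ?nnegrE ?ltW// (lt_trans dl0).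
have dp : 0 < dl ^+ p by exact: exprn_gt0.
rewrite (ge0_integralD mu (measurable_dom L))//; last 3 first.
- by move=> x _; rewrite lee_fin ltW.
- by move=> x _; rewrite -EFinM lee_fin mulr_ge0 ?exprn_ge0// invr_ge0 ltW.
- by apply: measurable_funeM; apply/measurable_EFinP; exact: mea_sec mp.
rewrite (ge0_integralZl_EFin mu (measurable_dom L)); last 3 first.
- by move=> x _; rewrite lee_fin exprn_ge0.
- by apply/measurable_EFinP; exact: mea_sec mp.
- by rewrite invr_ge0 ltW.
rewrite int_dom_cst.
apply: (@le_trans _ _ ((dl * (L + L))%:E + (dl ^- p)%:E * (dl ^+ 2 ^+ p)%:E)%E).
  by rewrite EFinM leeD2l// lee_wpmul2l// lee_fin invr_ge0 ltW.
rewrite -EFinM -EFinD lee_fin exprAC expr2 mulKf ?gt_eqF//.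
have : dl ^+ p <= dl ^+ 1 by rewrite ler_wiXn2l// ltW.
by rewrite /c expr1; nra.
Qed.

End KyFan.

(** Reduces a bound uniform in [l] to sequences (n_k, l_k) with n_k >= k, along which dominated
    convergence can be used even though the pointwise rates are random. *)
Lemma unif_of_seq {R : realType} (P : R -> nat -> nat -> Prop) :
  (forall n_ l_ : nat -> nat, (forall k, (k <= n_ k)%N) ->
     forall e : R, 0 < e -> exists N, forall k, (N <= k)%N -> P e (n_ k) (l_ k)) ->
  forall e : R, 0 < e -> exists N, forall n l, (N <= n)%N -> P e n l.
Proof.
move=> h e e0; apply: contrapT => hN.
have {}hN k : exists nl : nat * nat, (k <= nl.1)%N /\ ~ P e nl.1 nl.2.
  apply: contrapT => hk; apply: hN; exists k => n l kn.
  by apply: contrapT => en; apply: hk; exists (n, l).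
have [f hf] := choice hN.
have [N /(_ N (leqnn _))] := h (fun k => (f k).1) (fun k => (f k).2)
  (fun k => (hf k).1) e e0.
by have := (hf N).2.
Qed.

(** * Gaussian moments *)

Section NormalMoments.
Context {R : realType}.
Local Notation mu := (@lebesgue_measure R).
Variable sigma : R.
Hypothesis sigma0 : 0 < sigma.
Local Notation N := (normal_prob 0 sigma).

(** The Radon-Nikodym derivative of the law agrees almost everywhere with the Gaussian density,
    because both have the same integral over every measurable set. *)
Lemma integral_normal (f : R -> \bar R) : (forall x, 0 <= f x)%E ->
  measurable_fun setT f ->
  (\int[N]_x f x = \int[mu]_x (f x * (normal_pdf 0 sigma x)%:E))%E.
Proof.
move=> f0 mf.
rewrite -(Radon_Nikodym_SigmaFinite.change_of_variables
  (normal_prob_dominates 0 sigma) f0 measurableT mf).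
have mp : measurable_fun setT (fun x : R => (normal_pdf 0 sigma x)%:E).
  by apply/measurable_EFinP; exact: measurable_normal_pdf.
have ig := Radon_Nikodym_SigmaFinite.f_integrable (normal_prob_dominates 0 sigma).
apply: ae_eq_integral => //.
- by apply: emeasurable_funM => //; exact: measurable_int ig.
- exact: emeasurable_funM.
apply: ae_eqe_mul2l; apply: integral_ae_eq => //.
move=> A _ mA.
by rewrite -(Radon_Nikodym_SigmaFinite.f_integral (normal_prob_dominates 0 sigma)).
Qed.

(** A crude bound by comparison of densities: x^2 times the density of N(0, s^2) is at most 6 s^2
    times that of N(0, 4 s^2), which integrates to 1. With u = x^2 / (8 s^2), the quotient of the
    densities is 2 exp(-3u), and 16 s^2 u exp(-3u) <= (16/3) s^2 because 3u <= exp(3u). *)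
Lemma normal_second_moment :
  (\int[N]_x (x ^+ 2)%:E <= (6 * sigma ^+ 2)%:E)%E.
Proof.
have s0 : sigma != 0 by rewrite gt_eqF.
have s20 : 2 * sigma != 0 by rewrite mulf_neq0// pnatr_eq0.
rewrite integral_normal//; last 2 first.
- by move=> x; rewrite lee_fin sqr_ge0.
- by apply/measurable_EFinP; exact: measurable_funX.
apply: (@le_trans _ _
  (\int[mu]_x ((6 * sigma ^+ 2)%:E * (normal_pdf 0 (2 * sigma) x)%:E))%E).
  apply: ge0_le_integral => //.
  - by move=> x _; rewrite -EFinM lee_fin mulr_ge0 ?sqr_ge0// normal_pdf_ge0.
  - apply: emeasurable_funM; apply/measurable_EFinP.
      exact: measurable_funX.
    exact: measurable_normal_pdf.
  - apply: emeasurable_funM; apply/measurable_EFinP.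
      exact: measurable_cst.
    exact: measurable_normal_pdf.
  move=> x _; rewrite -!EFinM lee_fin !normal_pdfE//.
  rewrite /normal_peak /normal_fun !subr0.
  have pk : Num.sqrt (sigma ^+ 2 * pi *+ 2) =
      2^-1 * Num.sqrt ((2 * sigma) ^+ 2 * pi *+ 2).
    have sq2 s : Num.sqrt (s ^+ 2 * pi *+ 2) = `|s| * Num.sqrt (pi *+ 2) :> R.
      by rewrite -mulrnAr sqrtrM ?sqr_ge0// sqrtr_sqr.
    by rewrite !sq2 normrM (ger0_norm (ler0n R 2)) -mulrA mulKf.
  rewrite pk invfM invrK.
  set p := (Num.sqrt _)^-1.
  have p0 : 0 <= p by rewrite invr_ge0 sqrtr_ge0.
  have sg : 0 < sigma ^+ 2 by exact: exprn_gt0.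
  pose u := x ^+ 2 / (8 * sigma ^+ 2).
  have u0 : 0 <= u by rewrite divr_ge0 ?sqr_ge0// mulr_ge0// ltW.
  have -> : - x ^+ 2 / (sigma ^+ 2 *+ 2) = - (4 * u).
    by rewrite /u -mulr_natr; field; rewrite ?gt_eqF//.
  have -> : - x ^+ 2 / ((2 * sigma) ^+ 2 *+ 2) = - u.
    by rewrite /u -mulr_natr exprMn; field; rewrite ?gt_eqF//.
  have -> : x ^+ 2 = 8 * sigma ^+ 2 * u.
    by rewrite /u; field; rewrite gt_eqF.
  have -> : - (4 * u) = - u - 3 * u by ring.
  rewrite expRD (expRN (3 * u)).
  have e3 : 3 * u <= expR (3 * u) by apply: le_trans (expR_ge1Dx _); lra.
  have e0 : 0 < expR (3 * u) by exact: expR_gt0.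
  have eu := expR_ge0 (- u).
  have h : 3 * u / expR (3 * u) <= 1 by rewrite ler_pdivrMr ?mul1r.
  have -> : 8 * sigma ^+ 2 * u * (2 * p * (expR (- u) / expR (3 * u))) =
     (16 / 3 * (sigma ^+ 2 * (p * expR (- u)))) * (3 * u / expR (3 * u)).
    by field; rewrite gt_eqF.
  have q0 : 0 <= sigma ^+ 2 * (p * expR (- u)).
    by rewrite !mulr_ge0// ltW.
  rewrite -mulrA -[leRHS]mulrA; move: q0; set q := sigma ^+ 2 * _ => q0.
  apply: (@le_trans _ _ (16 / 3 * (q * 1))); last by lra.
  by apply: ler_wpM2l; [lra|exact: ler_wpM2l].
rewrite ge0_integralZl_EFin//; last 3 first.
- by move=> x _; rewrite lee_fin normal_pdf_ge0.
- by apply/measurable_EFinP; exact: measurable_normal_pdf.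
- by rewrite mulr_ge0// sqr_ge0.
by rewrite integral_normal_pdf mule1.
Qed.

Lemma integrable_normal_sqr : N.-integrable setT (fun x => (x ^+ 2)%:E).
Proof.
apply/integrableP; split.
  by apply/measurable_EFinP; exact: measurable_funX.
under eq_integral do rewrite gee0_abs ?lee_fin ?sqr_ge0//.
exact: le_lt_trans normal_second_moment (ltry _).
Qed.

Lemma integrable_normal_id : N.-integrable setT (fun x => x%:E).
Proof.
have i1 : N.-integrable setT (fun x : R => (1 + x ^+ 2)%:E).
  exact: (@integrableD _ _ _ N setT measurableT (fun=> 1%:E)
    (fun x => (x ^+ 2)%:E) (finite_measure_integrable_cst N 1 measurableT)
    integrable_normal_sqr).
apply: (le_integrable measurableT _ _ i1).
  by apply/measurable_EFinP; exact: measurable_id.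
move=> x _; rewrite /= lee_fin.
have -> : `|1 + x ^+ 2| = 1 + x ^+ 2 by rewrite ger0_norm// addr_ge0// sqr_ge0.
rewrite -(real_normK (num_real x)); have := normr_ge0 x; nra.
Qed.

Lemma integral_normal_neg (f : R -> \bar R) : (forall x, 0 <= f x)%E ->
  measurable_fun setT f -> (\int[N]_x f (- x)%R = \int[N]_x f x)%E.
Proof.
move=> f0 mf; have s0 : sigma != 0 by rewrite gt_eqF.
have mN : measurable_fun setT (-%R : R -> R) by exact: measurable_funN.
rewrite !integral_normal//; last exact: measurableT_comp.
have mp : measurable_fun setT (fun x : R => (normal_pdf 0 sigma x)%:E).
  by apply/measurable_EFinP; exact: measurable_normal_pdf.
have nn x : (0 <= f x * (normal_pdf 0 sigma x)%:E)%E.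
  by rewrite mule_ge0// lee_fin normal_pdf_ge0.
pose phi : measurableTypeR R -> measurableTypeR R := -%R.
pose g : measurableTypeR R -> \bar R := fun x => (f x * (normal_pdf 0 sigma x)%:E)%E.
have mg : measurable_fun setT g by exact: emeasurable_funM.
have e := @ge0_integral_pushforward _ _ _ _ _ phi mN mu setT g measurableT mg
  (fun y _ => nn y).
transitivity (\int[pushforward mu phi]_x g x)%E.
  apply: etrans (esym e).
  rewrite preimage_setT; apply: eq_integral => x _ /=; rewrite /g /phi.
  by rewrite !normal_pdfE// /normal_fun !subr0 sqrrN.
by apply: eq_measure_integral => A mA _; exact: lebesgue_measureN.
Qed.

(** By symmetry the positive and negative parts have the same integral, which is finite thanks to
    the second moment. *)
Lemma normal_mean : (\int[N]_x x%:E = 0)%E.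
Proof.
rewrite integralE.
have mx : measurable_fun setT (fun x : R => x%:E).
  by apply/measurable_EFinP; exact: measurable_id.
have -> : (\int[N]_x (fun x : R => x%:E)^\- x = \int[N]_x (fun x : R => x%:E)^\+ x)%E.
  rewrite -[RHS]integral_normal_neg//; last exact: measurable_funepos.
  by apply: eq_integral => x _; rewrite funenegE funeposE EFinN.
rewrite subee//.
by apply: integrable_pos_fin_num => //; exact: integrable_normal_id.
Qed.

End NormalMoments.

(** * Independence *)

Section Independence.
Context {R : realType} {d : measure_display} {Omega : measurableType d}.
Variable Pr : probability Omega R.
Implicit Types X Y Z : Omega -> R.

Definition indep X Z := forall A B : set R, measurable A -> measurable B ->
  Pr (X @^-1` A `&` Z @^-1` B) = (Pr (X @^-1` A) * Pr (Z @^-1` B))%E.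

Definition rv X (mX : measurable_fun setT X) : {mfun Omega >-> R} :=
  MeasurableFun.Pack (MeasurableFun.Class (isMeasurableFun.Build _ _ _ _ X mX)).

Lemma measurable_pairX X Z : measurable_fun setT X -> measurable_fun setT Z ->
  measurable_fun setT (fun w => (X w, Z w)).
Proof. by move=> mX mZ; exact/measurable_fun_pair. Qed.

Lemma indep_law X Z (mX : measurable_fun setT X) (mZ : measurable_fun setT Z) :
  indep X Z -> forall E, measurable E ->
  (distribution Pr (rv mX) \x distribution Pr (rv mZ))%E E =
    pushforward Pr (fun w => (X w, Z w)) E.
Proof.
move=> iXZ E mE.
pose f w := (X w, Z w); have mf : measurable_fun setT f by exact: measurable_pairX.
have := @product_measure_unique _ _ _ _ R (distribution Pr (rv mX))
  (distribution Pr (rv mZ)) (distribution Pr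
   (MeasurableFun.Pack (MeasurableFun.Class (isMeasurableFun.Build _ _ _ _ f mf)))).
apply => // A B mA mB; exact: iXZ.
Qed.

(** Fubini for the product of the two laws, which is the joint law by [indep_law]; Tonelli for the
    absolute values supplies the integrability. *)
Lemma indepM X Z : measurable_fun setT X -> measurable_fun setT Z ->
  indep X Z -> Pr.-integrable setT (EFin \o X) -> Pr.-integrable setT (EFin \o Z) ->
  Pr.-integrable setT (EFin \o (fun w => X w * Z w)) /\
  (\int[Pr]_w (X w * Z w)%:E = \int[Pr]_w (X w)%:E * \int[Pr]_w (Z w)%:E)%E.
Proof.
move=> mX mZ iXZ iX iZ.
pose m1 := distribution Pr (rv mX); pose m2 := distribution Pr (rv mZ).
pose f w := (X w, Z w); have mf : measurable_fun setT f by exact: measurable_pairX.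
have m12 (g : R * R -> \bar R) :
    (\int[m1 \x m2]_p g p = \int[pushforward Pr f]_p g p)%E.
  by apply: eq_measure_integral => A mA _; exact: indep_law.
pose g (p : R * R) : \bar R := (p.1 * p.2)%:E.
have mg : measurable_fun setT g.
  by apply/measurable_EFinP; apply: measurable_funM.
have mag : measurable_fun setT (abse \o g) by exact: measurableT_comp.
have ia1 : (\int[m1]_a `|a|%:E < +oo)%E.
  rewrite (@ge0_integral_distribution _ _ _ _ _ Pr (rv mX) (fun a : R => `|a|%:E))//.
    by have /integrableP[] := iX.
  by apply/measurable_EFinP; exact: normr_measurable.
have ia2 : (\int[m2]_a `|a|%:E < +oo)%E.
  rewrite (@ge0_integral_distribution _ _ _ _ _ Pr (rv mZ) (fun a : R => `|a|%:E))//.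
    by have /integrableP[] := iZ.
  by apply/measurable_EFinP; exact: normr_measurable.
have i20 : (0 <= \int[m2]_a `|a|%:E)%E by exact: integral_ge0.
have f2 : (\int[m2]_a `|a|%:E)%E \is a fin_num by rewrite ge0_fin_numE.
have absf : (\int[m1 \x m2]_p `|g p| < +oo)%E.
  rewrite fubini_tonelli1//.
  have -> : fubini_F m2 (fun p => `|g p|)%E =
      (fun a => (fine (\int[m2]_a `|a|%:E))%:E * `|a|%:E)%E.
    apply/funext => a; rewrite fineK// /fubini_F muleC -ge0_integralZl_EFin//.
      by apply: eq_integral => b _; rewrite /g /= normrM EFinM.
    by apply/measurable_EFinP; exact: normr_measurable.
  rewrite ge0_integralZl_EFin//; last 2 first.
  - by apply/measurable_EFinP; exact: normr_measurable.
  - exact: fine_ge0.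
  by rewrite fineK// lte_mul_pinfty.
have ig : (m1 \x m2)%E.-integrable setT g by apply/integrableP; split.
have iXZ' : Pr.-integrable setT (EFin \o (fun w => X w * Z w)).
  apply/integrableP; split.
    by apply/measurable_EFinP; exact: measurable_funM.
  move: absf; rewrite m12 ge0_integral_pushforward// preimage_setT.
split => //.
transitivity (\int[pushforward Pr f]_p g p)%E.
  by rewrite integral_pushforward// preimage_setT.
rewrite -m12 -integral12_prod_meas1//.
have ib : (\int[m2]_b b%:E = \int[Pr]_w (Z w)%:E)%E.
  apply: (@integral_distribution _ _ _ _ _ Pr (rv mZ) (fun a : R => a%:E)) => //.
  exact/measurable_EFinP/measurable_id.
have ib1 : m2.-integrable setT (fun b => b%:E).
  by apply/integrableP; split => //; exact/measurable_EFinP/measurable_id.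
have ia : (\int[m1]_a a%:E = \int[Pr]_w (X w)%:E)%E.
  apply: (@integral_distribution _ _ _ _ _ Pr (rv mX) (fun a : R => a%:E)) => //.
  exact/measurable_EFinP/measurable_id.
have ia' : m1.-integrable setT (fun b => b%:E).
  by apply/integrableP; split => //; exact/measurable_EFinP/measurable_id.
have fZ : (\int[Pr]_w (Z w)%:E)%E \is a fin_num by exact: integrable_fin_num.
rewrite -ib -ia.
under eq_integral => a _.
  rewrite /fubini_F; under eq_integral do rewrite /g /= EFinM.
  rewrite integralZl// ib -(fineK fZ) muleC; over.
by rewrite integralZl// ib -[in RHS](fineK fZ) muleC.
Qed.

(** For fixed C, the measures E -> Pr((X, Y) in E, Z in C) and Pr(Z in C) times the law of (X, Y)
    agree on rectangles, hence on all measurable sets of the plane, in particular on the preimage of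
    A under multiplication. *)
Lemma indep_pair X Y Z : measurable_fun setT X -> measurable_fun setT Y ->
  measurable_fun setT Z ->
  (forall A B C : set R, measurable A -> measurable B -> measurable C ->
    Pr (X @^-1` A `&` Y @^-1` B `&` Z @^-1` C) =
    (Pr (X @^-1` A `&` Y @^-1` B) * Pr (Z @^-1` C))%E) ->
  indep (fun w => X w * Y w) Z.
Proof.
move=> mX mY mZ h A C mA mC.
pose f w := (X w, Y w); have mf : measurable_fun setT f by exact: measurable_pairX.
have mZC : measurable (Z @^-1` C) by rewrite -[_ @^-1` _]setTI; exact: mZ.
pose r : {nonneg R} := NngNum (fine_ge0 (measure_ge0 Pr (Z @^-1` C))).
have rE : r%:num%:E = Pr (Z @^-1` C) by rewrite /= fineK// fin_num_measure.
pose law : {measure set (R * R) -> \bar R} := distribution Pr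
   (MeasurableFun.Pack (MeasurableFun.Class (isMeasurableFun.Build _ _ _ _ f mf))).
pose m1 : {measure set (R * R) -> \bar R} := mscale r law.
pose PrC : {measure set Omega -> \bar R} := mrestr Pr mZC.
pose m2 : {measure set (R * R) -> \bar R} := pushforward PrC f.
have mM : measurable ((fun p : R * R => p.1 * p.2) @^-1` A).
  rewrite -[_ @^-1` _]setTI.
  by apply: (measurable_funM measurable_fst measurable_snd) => //.
suff /(_ _ mM) : forall E, measurable E -> m2 mf E = m1 E.
  by rewrite -rE muleC.
apply: (measure_unique [set A `*` B | A in measurable & B in measurable]
  (fun=> setT)).
- exact: measurable_prod_measurableType.
- move=> _ _ [A1 mA1 [B1 mB1 <-]] [A2 mA2 [B2 mB2 <-]].
  rewrite -setXI; exists (A1 `&` A2); first exact: measurableI.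
  by exists (B1 `&` B2) => //; exact: measurableI.
- by move=> _; exists setT => //; exists setT => //; rewrite setXTT.
- by rewrite bigcup_const.
- move=> _ [A1 mA1 [B1 mB1 <-]].
  have := h _ _ _ mA1 mB1 mC; rewrite -rE muleC.
  exact.
- move=> _; change (Pr (f @^-1` setT `&` Z @^-1` C) < +oo)%E.
  rewrite preimage_setT setTI.
  exact: (le_lt_trans (probability_le1 Pr mZC) (ltry 1)).
Qed.

End Independence.

(** * Ito isometry for Brownian motions *)

Section Expectation.
Context {R : realType} {d : measure_display} {Omega : measurableType d}.
Variable Pr : probability Omega R.
Implicit Types X Y Z : Omega -> R.

Definition L1 X := Pr.-integrable setT (EFin \o X).

Definition Ex X : R := \int[Pr]_w X w.

Lemma L1_meas X : L1 X -> measurable_fun setT X.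
Proof. by move=> iX; apply/measurable_EFinP; exact: measurable_int iX. Qed.

Lemma ExE X : L1 X -> (\int[Pr]_w (X w)%:E = (Ex X)%:E)%E.
Proof. by move=> iX; rewrite /Ex /Rintegral fineK//; exact: integrable_fin_num. Qed.

Lemma L1D X Y : L1 X -> L1 Y -> L1 (fun w => X w + Y w).
Proof. by move=> iX iY; exact: (integrableD measurableT iX iY). Qed.

Lemma L1Z c X : L1 X -> L1 (fun w => c * X w).
Proof. by move=> iX; exact: (integrableZl measurableT c iX). Qed.

Lemma L1_sum n (X : nat -> Omega -> R) : (forall i, (i < n)%N -> L1 (X i)) ->
  L1 (fun w => \sum_(i < n) X i w).
Proof.
elim: n => [|n IH] iX.
  rewrite (_ : (fun w => _) = cst 0); first exact: finite_measure_integrable_cst.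
  by apply/funext => w; rewrite big_ord0.
rewrite (_ : (fun w => _) = fun w => \sum_(i < n) X i w + X n w).
  by apply: L1D; [apply: IH => i ni; apply: iX; exact: ltnW|exact: iX].
by apply/funext => w; rewrite big_ord_recr.
Qed.

Lemma ExD X Y : L1 X -> L1 Y -> Ex (fun w => X w + Y w) = Ex X + Ex Y.
Proof. by move=> iX iY; exact: (RintegralD measurableT iX iY). Qed.

Lemma ExZ c X : L1 X -> Ex (fun w => c * X w) = c * Ex X.
Proof. by move=> iX; exact: (RintegralZl c measurableT iX). Qed.

Lemma Ex_sum0 n (X : nat -> Omega -> R) : (forall i, (i < n)%N -> L1 (X i)) ->
  Ex (fun w => \sum_(i < n) X i w) = \sum_(i < n) Ex (X i).
Proof.
elim: n => [|n IH] iX.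
  rewrite big_ord0 /Ex; under eq_Rintegral do rewrite big_ord0.
  by rewrite /Rintegral integral0.
rewrite big_ord_recr /= -IH => [|i ni]; last by apply: iX; exact: ltnW.
rewrite -ExD; [|apply: L1_sum => i ni; apply: iX; exact: ltnW|exact: iX].
by congr Ex; apply/funext => w; rewrite big_ord_recr.
Qed.

Lemma Ex_ge0 X : (forall w, 0 <= X w) -> 0 <= Ex X.
Proof. by move=> X0; exact: Rintegral_ge0. Qed.

Lemma L1_le X Y : measurable_fun setT X -> (forall w, `|X w| <= Y w) ->
  L1 Y -> L1 X.
Proof.
move=> mX XY iY; apply: (le_integrable measurableT _ _ iY).
  exact/measurable_EFinP.
by move=> w _ /=; rewrite lee_fin (le_trans (XY w))// ler_norm.
Qed.

Lemma L1_cst (c : R) : L1 (fun _ => c).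
Proof. exact: finite_measure_integrable_cst. Qed.

Lemma L1_sqr X : measurable_fun setT X -> L1 (fun w => X w ^+ 2) -> L1 X.
Proof.
move=> mX i2; apply: (@L1_le _ (fun w => 1 + X w ^+ 2)) => //.
  move=> w; rewrite -(real_normK (num_real (X w))).
  by have := normr_ge0 (X w); nra.
by apply: L1D => //; exact: L1_cst.
Qed.

Lemma L1_mul X Y : measurable_fun setT X -> measurable_fun setT Y ->
  L1 (fun w => X w ^+ 2) -> L1 (fun w => Y w ^+ 2) -> L1 (fun w => X w * Y w).
Proof.
move=> mX mY iX iY; apply: (@L1_le _ (fun w => X w ^+ 2 + Y w ^+ 2)).
- exact: measurable_funM.
- move=> w; rewrite normrM -(real_normK (num_real (X w))).
  rewrite -(real_normK (num_real (Y w))).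
  by have := normr_ge0 (X w); have := normr_ge0 (Y w); nra.
- exact: L1D.
Qed.

Lemma L1_indep X Z : indep Pr X Z -> L1 X -> L1 Z ->
  L1 (fun w => X w * Z w) /\ Ex (fun w => X w * Z w) = Ex X * Ex Z.
Proof.
move=> iXZ iX iZ.
have [i e] := indepM (L1_meas iX) (L1_meas iZ) iXZ iX iZ.
by split => //; rewrite {1}/Ex /Rintegral e (ExE iX) (ExE iZ).
Qed.

End Expectation.

Section Brownian.
Context {R : realType} {d : measure_display} {Omega : measurableType d}.
Variables (Pr : probability Omega R) (r0 T : R).
Variables (F : R -> set (set Omega)) (beta : nat -> R -> Omega -> R).
Hypothesis r0T : r0 <= T.
Hypothesis filtF : filtration r0 T F.
Hypothesis brown : brownian_motions Pr r0 T F beta.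
Implicit Types X Y Z : Omega -> R.
Local Notation L1 := (L1 Pr).
Local Notation Ex := (Ex Pr).

(** The time constraints are part of the predicate so that the properties of the filtration, stated
    on [r0, T], apply directly. *)
Definition adp s X := r0 <= s /\ s <= T /\ measurable_wrt (F s) X.

(** [F s] is a sigma-algebra and thus equals the one it generates. Adaptedness becomes ordinary
    measurability for another structure on [Omega], from which closure under the algebraic and
    lattice operations is inherited. *)
Lemma adpP s X : r0 <= s -> s <= T ->
  adp s X <-> measurable_fun (setT : set (g_sigma_algebraType (F s))) X.
Proof.
move=> rs sT; have [sF _ _] := filtF.
have sE : <<s F s >> = F s.
  by apply: sigma_algebra_id; apply: sF; rewrite in_itv /= rs sT.
split=> [[_ [_ mX]] _ B mB|mX].
  by rewrite setTI /measurable /= sE; exact: mX.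
split=> //; split=> // B mB.
have := mX measurableT B mB; rewrite setTI.
by rewrite {1}/measurable /= sE.
Qed.

Lemma adp_le s t X : adp s X -> s <= t -> t <= T -> adp t X.
Proof.
move=> [rs [sT mX]] st tT; have [_ _ mF] := filtF.
split; first exact: le_trans st.
by split=> // B mB; apply: (mF s) => //; exact: mX.
Qed.

Lemma adp_meas s X : adp s X -> measurable_fun setT X.
Proof.
move=> [rs [sT mX]] _ B mB; rewrite setTI; have [_ Fm _] := filtF.
by apply: (Fm s); [rewrite in_itv /= rs sT|exact: mX].
Qed.

Lemma adpD s X Y : adp s X -> adp s Y -> adp s (fun w => X w + Y w).
Proof.
move=> aX aY; have [rs [sT _]] := aX.
move: aX aY => /(adpP _ rs sT) aX /(adpP _ rs sT) aY.
by apply/adpP => //; exact: measurable_funD.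
Qed.

Lemma adpB s X Y : adp s X -> adp s Y -> adp s (fun w => X w - Y w).
Proof.
move=> aX aY; have [rs [sT _]] := aX.
move: aX aY => /(adpP _ rs sT) aX /(adpP _ rs sT) aY.
by apply/adpP => //; exact: measurable_funB.
Qed.

Lemma adpM s X Y : adp s X -> adp s Y -> adp s (fun w => X w * Y w).
Proof.
move=> aX aY; have [rs [sT _]] := aX.
move: aX aY => /(adpP _ rs sT) aX /(adpP _ rs sT) aY.
by apply/adpP => //; exact: measurable_funM.
Qed.

Lemma adp_min s X Y : adp s X -> adp s Y -> adp s (fun w => Num.min (X w) (Y w)).
Proof.
move=> aX aY; have [rs [sT _]] := aX.
move: aX aY => /(adpP _ rs sT) aX /(adpP _ rs sT) aY.
by apply/adpP => //; exact: measurable_minr.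
Qed.

Lemma adp_max s X Y : adp s X -> adp s Y -> adp s (fun w => Num.max (X w) (Y w)).
Proof.
move=> aX aY; have [rs [sT _]] := aX.
move: aX aY => /(adpP _ rs sT) aX /(adpP _ rs sT) aY.
by apply/adpP => //; exact: measurable_maxr.
Qed.

Lemma adp_cst s (c : R) : r0 <= s -> s <= T -> adp s (fun _ => c).
Proof. by move=> rs sT; apply/adpP => //; exact: measurable_cst. Qed.

Lemma adp_sum s n (X : nat -> Omega -> R) : r0 <= s -> s <= T ->
  (forall i, (i < n)%N -> adp s (X i)) -> adp s (fun w => \sum_(i < n) X i w).
Proof.
move=> rs sT; elim: n => [|n IH] aX.
  rewrite (_ : (fun w => _) = cst 0); first exact: adp_cst.
  by apply/funext => w; rewrite big_ord0.
rewrite (_ : (fun w => _) = fun w => \sum_(i < n) X i w + X n w).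
  by apply: adpD; [apply: IH => i ni; apply: aX; exact: ltnW|exact: aX].
by apply/funext => w; rewrite big_ord_recr.
Qed.

Lemma adp_beta k s t : r0 <= s -> s <= t -> t <= T -> adp t (beta k s).
Proof.
move=> rs st tT; have sT := le_trans st tT.
apply: (@adp_le s) => //; split=> //; split=> //.
by have [_ _ + _] := brown; apply; rewrite in_itv /= rs sT.
Qed.

Definition incr k s t w := beta k t w - beta k s w.

Lemma meas_incr k s t : r0 <= s -> s <= t -> t <= T ->
  measurable_fun setT (incr k s t).
Proof.
move=> rs st tT; apply: (@adp_meas t); apply: adpB; last exact: adp_beta.
by apply: adp_beta => //; exact: le_trans st.
Qed.

(** * Brownian increments over one interval *)

Section Increment.
Variables s t : R.
Hypothesis (rs : r0 <= s) (st : s < t) (tT : t <= T).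
Local Notation N := (normal_prob 0 (Num.sqrt (t - s))).
Local Notation incr k := (incr k s t).

Let sig0 : 0 < Num.sqrt (t - s).
Proof. by rewrite sqrtr_gt0 subr_gt0. Qed.

Let NT : N setT = 1%E.
Proof. exact: probability_setT. Qed.

(** The joint law of the first max(j, k) + 1 increments is applied with B at index j, C at index k
    and the whole line elsewhere, where the factor is 1. *)
Lemma incr2 j k (A : set Omega) (B C : set R) : j != k -> F s A ->
  measurable B -> measurable C ->
  Pr (A `&` incr j @^-1` B `&` incr k @^-1` C) = (Pr A * (N B * N C))%E.
Proof.
move=> jk FA mB mC; have [_ _ _ h] := brown.
pose n := (maxn j k).+1.
have jn : (j < n)%N by rewrite ltnS leq_maxl.
have kn : (k < n)%N by rewrite ltnS leq_maxr.
pose B' i := if i == j then B else if i == k then C else setT.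
have mB' i : measurable (B' i) by rewrite /B'; case: ifP => // _; case: ifP.
have := h s t n A B' rs st tT FA mB'.
have -> : A `&` \bigcap_(i in `I_n) ((fun w => beta i t w - beta i s w) @^-1` B' i) =
    A `&` incr j @^-1` B `&` incr k @^-1` C.
  apply/seteqP; split=> w.
    move=> [Aw hw]; split; first split => //.
      by have := hw j jn; rewrite /B' /= eqxx.
    by have := hw k kn; rewrite /B' /= eqxx eq_sym (negbTE jk).
  move=> [[Aw Bw] Cw]; split=> // i _; rewrite /= /B'.
  case: ifPn => [/eqP ->|_] //.
  by case: ifPn => [/eqP ->|_].
move=> ->; congr (_ * _)%E.
rewrite (bigD1 (Ordinal jn))//= (bigD1 (Ordinal kn))/=; last first.
  by apply/eqP => -[/esym/eqP]; rewrite (negbTE jk).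
rewrite big1 ?mule1; last first.
  move=> i /andP[ij ik]; rewrite /B'.
  have -> : (i == j :> nat) = false.
    by apply/negbTE; apply: contra ij => /eqP e; apply/eqP/val_inj.
  have -> : (i == k :> nat) = false.
    by apply/negbTE; apply: contra ik => /eqP e; apply/eqP/val_inj.
  exact: NT.
by rewrite /B' eqxx eq_sym (negbTE jk) eqxx.
Qed.

Let FT : F s setT.
Proof.
have [sF _ _] := filtF.
have [] := sF s _; first by rewrite in_itv /= rs (le_trans (ltW st)).
move=> F0 FC _; rewrite -(setD0 setT); exact: FC.
Qed.

Lemma incr1 k (A : set Omega) (B : set R) : F s A -> measurable B ->
  Pr (A `&` incr k @^-1` B) = (Pr A * N B)%E.
Proof.
(* An auxiliary second increment, on which no constraint is put. *)
move=> FA mB; have kk : k != k.+1 by rewrite neq_ltn leqnn.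
have := incr2 kk FA mB measurableT.
by rewrite NT mule1 preimage_setT setIT.
Qed.

Lemma incr_law k (B : set R) : measurable B -> Pr (incr k @^-1` B) = N B.
Proof.
move=> mB; have := incr1 k FT mB.
rewrite setTI => ->.
exact: (etrans (congr1 (fun y => y * N B)%E (probability_setT Pr)) (mul1e _)).
Qed.

Lemma indep_incr k X : adp s X -> indep Pr X (incr k).
Proof.
move=> [_ [_ mX]] A B mA mB; rewrite incr_law// incr1//; exact: mX.
Qed.

Let mincr k : measurable_fun setT (incr k).
Proof. by apply: meas_incr => //; exact: ltW. Qed.

(** For the cross terms of [comb_sqr], where a weighted increment is multiplied by another one. *)
Lemma indep_incr2 j k X : j != k -> adp s X ->
  indep Pr (fun w => X w * incr j w) (incr k).
Proof.
move=> jk aX; apply: indep_pair => //; first exact: adp_meas aX.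
move=> A B C mA mB mC; have [_ [_ mX]] := aX.
rewrite incr_law// incr2//; last exact: mX.
by rewrite incr1 ?muleA//; exact: mX.
Qed.

Lemma incr_integral k (f : R -> \bar R) : measurable_fun setT f ->
  (forall x, 0 <= f x)%E -> (\int[Pr]_w f (incr k w) = \int[N]_x f x)%E.
Proof.
move=> mf f0.
pose phi : Omega -> measurableTypeR R := incr k.
have mphi : measurable_fun setT phi by exact: mincr.
have e := @ge0_integral_pushforward _ _ _ _ _ phi mphi Pr setT f measurableT mf
  (fun y _ => f0 y).
transitivity (\int[pushforward Pr phi]_x f x)%E.
  by rewrite preimage_setT in e; exact: esym e.
by apply: eq_measure_integral => A mA _; exact: incr_law.
Qed.

Lemma incr_sqr k : L1 (fun w => incr k w ^+ 2) /\
  0 <= Ex (fun w => incr k w ^+ 2) <= 6 * (t - s).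
Proof.
have m2 : measurable_fun setT (fun x : R => (x ^+ 2)%:E).
  by apply/measurable_EFinP; exact: measurable_funX.
have e := incr_integral k m2 (fun x => sqr_ge0 x).
have := normal_second_moment sig0; rewrite sqr_sqrtr; last first.
  by rewrite subr_ge0 ltW.
move=> le.
have i : L1 (fun w => incr k w ^+ 2).
  apply/integrableP; split.
    by apply/measurable_EFinP; exact: measurable_funX.
  under eq_integral do rewrite /= ger0_norm ?sqr_ge0//.
  by rewrite e; exact: le_lt_trans le (ltry _).
split=> //; rewrite Ex_ge0/=; last by move=> w; exact: sqr_ge0.
by rewrite -lee_fin -ExE// e.
Qed.

Lemma incr_mean k : L1 (incr k) /\ Ex (incr k) = 0.
Proof.
have i : L1 (incr k) by apply: L1_sqr => //; exact: (incr_sqr k).1.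
split=> //; rewrite /Ex /Rintegral.
pose phi : Omega -> measurableTypeR R := incr k.
have mphi : measurable_fun setT phi by exact: mincr.
have mid : measurable_fun setT (fun x : measurableTypeR R => x%:E).
  by apply/measurable_EFinP; exact: measurable_id.
have e := @integral_pushforward _ _ _ _ _ phi mphi Pr setT (fun x => x%:E) mid.
rewrite preimage_setT in e.
suff -> : (\int[Pr]_w (incr k w)%:E = 0)%E by [].
rewrite -[RHS](normal_mean sig0).
transitivity (\int[pushforward Pr phi]_x x%:E)%E; first exact: (esym (e i measurableT)).
by apply: eq_measure_integral => A mA _; exact: incr_law.
Qed.

(** With [c k] in the role of [phi k x], this is the increment at the point [x] of the n-th partial
    sum of the series defining W. *)
Definition comb (c : nat -> R) n w := \sum_(k < n) c k * incr k w.

Lemma comb_mean c n X : adp s X -> L1 X ->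
  L1 (fun w => X w * comb c n w) /\ Ex (fun w => X w * comb c n w) = 0.
Proof.
move=> aX iX.
have h k : L1 (fun w => c k * (X w * incr k w)) /\
    Ex (fun w => c k * (X w * incr k w)) = 0.
  have [i m] := incr_mean k.
  have [i' m'] := L1_indep (indep_incr k aX) iX i.
  by split; [exact: L1Z|rewrite ExZ// m' m !mulr0].
rewrite (_ : (fun w => _) = fun w => \sum_(k < n) c k * (X w * incr k w)).
  split; first by apply: (L1_sum (X := fun k w => c k * (X w * incr k w))) => k _; exact: (h k).1.
  rewrite (Ex_sum0 (X := fun k w => c k * (X w * incr k w))) => [|k _].
    by rewrite big1// => k _; exact: (h k).2.
  exact: (h k).1.
apply/funext => w; rewrite /comb mulr_sumr; apply: eq_bigr => k _.
by rewrite mulrCA.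
Qed.

(** Induction on [n]: the last increment is centred and independent of X times any earlier one, so
    the cross terms have mean 0 and only the squares remain. The factor 6 is that of
    [normal_second_moment]. *)
Lemma comb_sqr c n X : adp s X -> L1 X -> (forall w, 0 <= X w) ->
  L1 (fun w => X w * comb c n w ^+ 2) /\
  Ex (fun w => X w * comb c n w ^+ 2) <=
    6 * (\sum_(k < n) c k ^+ 2) * (t - s) * Ex X.
Proof.
move=> aX iX X0.
elim: n => [|n [IHi IHe]].
  have -> : (fun w => X w * comb c 0 w ^+ 2) = fun _ => 0.
    by apply/funext => w; rewrite /comb big_ord0 expr0n mulr0.
  split; first exact: L1_cst.
  by rewrite big_ord0 mulr0 !mul0r /Ex /Rintegral integral0.
have -> : (fun w => X w * comb c n.+1 w ^+ 2) = fun w => X w * comb c n w ^+ 2 +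
    (2 * c n * \sum_(k < n) c k * (X w * incr k w * incr n w) +
     c n ^+ 2 * (X w * incr n w ^+ 2)).
  apply/funext => w; rewrite /comb big_ord_recr /=.
  rewrite (_ : \sum_(k < n) c k * (X w * incr k w * incr n w) =
    X w * incr n w * \sum_(k < n) c k * incr k w); first by ring.
  by rewrite mulr_sumr; apply: eq_bigr => k _; ring.
have [i2 /andP[e20 e2]] := incr_sqr n; have [i1 e1] := incr_mean n.
have hk k : (k < n)%N -> L1 (fun w => c k * (X w * incr k w * incr n w)) /\
    Ex (fun w => c k * (X w * incr k w * incr n w)) = 0.
  move=> kn; have nk : k != n by rewrite neq_ltn kn.
  have [ik ek] := incr_mean k.
  have [ik' _] := L1_indep (indep_incr k aX) iX ik.
  have [i' m'] := L1_indep (indep_incr2 nk aX) ik' i1.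
  by split; [exact: L1Z|rewrite ExZ// m' e1 !mulr0].
have ind2 : indep Pr X (fun w => incr n w ^+ 2).
  move=> A B mA mB; apply: (indep_incr n aX mA (B := (fun y => y ^+ 2) @^-1` B)).
  rewrite -[_ @^-1` _]setTI.
  by apply: (measurable_funX 2 (@measurable_id _ _ setT)).
have [ix2 ex2] := L1_indep ind2 iX i2.
have isum := L1_sum (fun k kn => (hk k kn).1).
have esum : Ex (fun w => \sum_(k < n) c k * (X w * incr k w * incr n w)) = 0.
  rewrite (Ex_sum0 (fun k kn => (hk k kn).1)).
  by apply: big1 => k _; exact: (hk k _).2.
have iA := L1Z (2 * c n) isum; have iB := L1Z (c n ^+ 2) ix2.
split; first by apply: L1D => //; exact: L1D.
rewrite ExD//; last exact: L1D.
rewrite ExD// (ExZ (2 * c n) isum) (ExZ (c n ^+ 2) ix2) esum mulr0 add0r ex2.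
have EX0 : 0 <= Ex X by exact: Ex_ge0.
rewrite big_ord_recr /=; move: IHe; set A := \sum_(k < n) _ => IHe.
have -> : 6 * (A + c n ^+ 2) * (t - s) * Ex X =
   6 * A * (t - s) * Ex X + c n ^+ 2 * (Ex X * (6 * (t - s))) by ring.
apply: lerD => //; have c20 : 0 <= c n ^+ 2 by exact: sqr_ge0.
by apply: ler_wpM2l => //; apply: ler_wpM2l.
Qed.

End Increment.

(** The law of an increment is prescribed for s < t only; for s = t the increment is 0. *)
Lemma comb_sqr_le s t c n X : r0 <= s -> s <= t -> t <= T ->
  adp s X -> L1 X -> (forall w, 0 <= X w) ->
  L1 (fun w => X w * comb s t c n w ^+ 2) /\
  Ex (fun w => X w * comb s t c n w ^+ 2) <=
    6 * (\sum_(k < n) c k ^+ 2) * (t - s) * Ex X.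
Proof.
move=> rs st tT aX iX X0; move: st; rewrite le_eqVlt => /orP[/eqP <-|st].
  rewrite subrr mulr0 mul0r.
  have -> : (fun w => X w * comb s s c n w ^+ 2) = fun _ => 0.
    apply/funext => w; rewrite /comb big1 ?expr0n ?mulr0// => k _.
    by rewrite /incr subrr mulr0.
  by split; [exact: L1_cst|rewrite /Ex /Rintegral integral0].
exact: comb_sqr.
Qed.

Lemma comb_mean_le s t c n X : r0 <= s -> s <= t -> t <= T -> adp s X -> L1 X ->
  Ex (fun w => X w * comb s t c n w) = 0.
Proof.
move=> rs st tT aX iX; move: st; rewrite le_eqVlt => /orP[/eqP <-|st].
  have -> : (fun w => X w * comb s s c n w) = fun _ => 0.
    apply/funext => w; rewrite /comb big1 ?mulr0// => k _.
    by rewrite /incr subrr mulr0.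
  by rewrite /Ex /Rintegral integral0.
by have [] := comb_mean rs st tT c n aX iX.
Qed.

Lemma adp_comb s t c n : r0 <= s -> s <= t -> t <= T -> adp t (comb s t c n).
Proof.
move=> rs st tT; have rt := le_trans rs st.
apply: (adp_sum (X := fun k w => c k * incr k s t w)) => // k _.
apply: adpM; first exact: adp_cst.
by apply: adpB; exact: adp_beta.
Qed.

(** Induction on the number of cells. The partial sum S and the next integrand are known at time
    [u N], while the next increment is centred given that past, so the cross term in (S + V)^2 has
    mean 0. Boundedness of [H] makes all products integrable. *)
Lemma ito_isometry_le (u : nat -> R) (H : nat -> Omega -> R) c n K N :
  (forall j, (j < N)%N -> [/\ r0 <= u j, u j <= u j.+1 & u j.+1 <= T]) ->
  (forall j, (j < N)%N -> adp (u j) (H j)) ->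
  (forall j w, (j < N)%N -> `|H j w| <= K) ->
  let S w := \sum_(j < N) H j w * comb (u j) (u j.+1) c n w in
  [/\ L1 (fun w => S w ^+ 2), (0 < N)%N -> adp (u N) S &
   Ex (fun w => S w ^+ 2) <= 6 * (\sum_(k < n) c k ^+ 2) *
     \sum_(j < N) (u j.+1 - u j) * Ex (fun w => H j w ^+ 2)].
Proof.
elim: N => [|N IH] hu aH bH /=.
  have -> : (fun w => (\sum_(j < 0) H j w * comb (u j) (u j.+1) c n w) ^+ 2) =
      fun _ => 0.
    by apply/funext => w; rewrite big_ord0 expr0n.
  split=> //; first exact: L1_cst.
  by rewrite big_ord0 mulr0 /Ex /Rintegral integral0.
have [rN NN NT] := hu N (leqnn _).
have [|||iS aS eS] := IH; [by move=> j jN; apply: hu; exact: ltnW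
  |by move=> j jN; apply: aH; exact: ltnW|by move=> j w jN; apply: bH; exact: ltnW|].
set S := fun w => \sum_(j < N) _ in iS aS eS.
(* For [N = 0] the induction hypothesis gives no adaptedness, since nothing is assumed there about
   [u 0]; the empty sum is the constant 0. *)
have {}aS : adp (u N) S.
  case: N {hu aH bH IH eS} @S iS aS rN NN NT => [|N] S iS aS rN NN NT.
    have -> : S = fun _ => 0 by apply/funext => w; rewrite /S big_ord0.
    by apply: adp_cst => //; exact: le_trans NT.
  exact: aS.
have aHN := aH N (leqnn _); have mHN := adp_meas aHN; have mS := adp_meas aS.
have iH2 : L1 (fun w => H N w ^+ 2).
  apply: (@L1_le _ _ _ _ _ (fun _ => K ^+ 2)); last exact: L1_cst.
    exact: measurable_funX.
  move=> w; rewrite normrX lerXn2r ?nnegrE ?bH//.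
  by apply: le_trans (bH N w (leqnn _)).
have aH2 : adp (u N) (fun w => H N w ^+ 2) by exact: (adpM aHN aHN).
have [iV eV] := comb_sqr_le c n rN NN NT aH2 iH2 (fun w => sqr_ge0 _).
pose V w := H N w * comb (u N) (u N.+1) c n w.
have aV : adp (u N.+1) V.
  by apply: adpM; [exact: adp_le aHN NN NT|exact: adp_comb].
have iV2 : L1 (fun w => V w ^+ 2).
  by move: iV; congr L1; apply/funext => w; rewrite /V exprMn.
have iSV : L1 (fun w => S w * V w) by apply: L1_mul => //; exact: adp_meas aV.
have iSH : L1 (fun w => S w * H N w) by exact: L1_mul.
have eSV : Ex (fun w => S w * V w) = 0.
  rewrite -[RHS](comb_mean_le c n rN NN NT (adpM aS aHN) iSH).
  by congr Ex; apply/funext => w; rewrite /V mulrA.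
have SE : (fun w => \sum_(j < N.+1) H j w * comb (u j) (u j.+1) c n w) =
    fun w => S w + V w.
  by apply/funext => w; rewrite big_ord_recr.
have S2E : (fun w => (\sum_(j < N.+1) H j w * comb (u j) (u j.+1) c n w) ^+ 2) =
    fun w => S w ^+ 2 + (2 * (S w * V w) + V w ^+ 2).
  by apply/funext => w; rewrite big_ord_recr /= -/(S w) -/(V w); ring.
rewrite S2E SE; have iSV2 := L1Z 2 iSV; split.
- by apply: L1D => //; exact: L1D.
- by move=> _; apply: adpD => //; exact: adp_le aS NN NT.
rewrite ExD//; last exact: L1D.
rewrite ExD// ExZ// eSV mulr0 add0r big_ord_recr /= mulrDr; apply: lerD => //.
rewrite mulrA; apply: le_trans eV; rewrite le_eqVlt; apply/orP; left; apply/eqP.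
by congr Ex; apply/funext => w; rewrite /V exprMn.
Qed.

End Brownian.

(** * Ito isometry for the Wiener process *)

Lemma sqr_sum_le {R : realType} n (a : nat -> R) :
  (\sum_(i < n) a i) ^+ 2 <= n%:R * \sum_(i < n) a i ^+ 2.
Proof.
elim: n => [|n IH]; first by rewrite !big_ord0 expr0n mul0r.
rewrite !big_ord_recr /= -natr1.
have A0 : 0 <= \sum_(i < n) a i ^+ 2 by apply: sumr_ge0 => i _; exact: sqr_ge0.
move: (\sum_(i < n) a i) (\sum_(i < n) a i ^+ 2) A0 IH => S A A0 IH.
have [n0|n0] := eqVneq n 0%N.
  have S0 : S = 0.
    by apply/eqP; rewrite -sqrf_eq0 eq_le sqr_ge0 andbT (le_trans IH)// n0 mul0r.
  by rewrite S0 n0; nra.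
have nn : 0 < n%:R :> R by rewrite ltr0n lt0n.
have h : 2 * S * a n <= A + n%:R * a n ^+ 2.
  have : 0 <= (S - n%:R * a n) ^+ 2 by exact: sqr_ge0.
  nra.
nra.
Qed.

Section Wiener.
Context {R : realType} {d : measure_display} {Omega : measurableType d}.
Variables (Pr : probability Omega R) (L r0 T : R).
Variables (F : R -> set (set Omega)) (beta : nat -> R -> Omega -> R).
Variables (phi : nat -> R -> R) (W : @field R d Omega R).
Local Notation mu := (@lebesgue_measure R).
Local Notation D := (dom L).
Local Notation rfun := (Omega -> R -> R).
Local Notation mea := (@mea R d Omega L).
Local Notation pos := (@pos R d Omega L).
Local Notation II := (@II R d Omega Pr L).
Local Notation AE2 := (@AE2 R d Omega Pr L).
Local Notation adp := (@adp R d Omega r0 T F).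
Hypothesis L0 : 0 < L.
Hypothesis r0T : r0 <= T.
Hypothesis filtF : filtration r0 T F.
Hypothesis brown : brownian_motions Pr r0 T F beta.
Hypothesis mphi : forall k, measurable_fun D (phi k).
Hypothesis trace : (\sum_(k <oo) \int[mu]_(x in D) (phi k x ^+ 2)%:E < +oo)%E.
Hypothesis mW : forall t, r0 <= t -> t <= T -> mea (W t).
Hypothesis cvW : forall t, r0 <= t -> t <= T ->
  (fun n => II (fun w x => (W t w x - \sum_(k < n) beta k t w * phi k x) ^+ 2)%R)
    @ \oo --> 0%E.

(** The variance of the series at [x] per unit of time. Finite trace makes it integrable over [D];
    on the null set where the series diverges, [fine] returns 0. *)
Definition cov x : R := fine (\sum_(k <oo) (phi k x ^+ 2)%:E)%E.

Let covE x : \bar R := (\sum_(k <oo) (phi k x ^+ 2)%:E)%E.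

Let mphi2 k : measurable_fun D (fun x => (phi k x ^+ 2)%:E).
Proof. by apply/measurable_EFinP; exact: measurable_funX. Qed.

Let mcovE : measurable_fun D covE.
Proof.
apply: ge0_emeasurable_sum => [k x _ _|k _]; last exact: mphi2.
by rewrite lee_fin sqr_ge0.
Qed.

Let icovE : mu.-integrable D covE.
Proof.
apply/integrableP; split; first exact: mcovE.
under eq_integral => x _.
  rewrite gee0_abs; last by apply: nneseries_ge0 => k _ _; rewrite lee_fin sqr_ge0.
  over.
rewrite integral_nneseries//; first exact: measurable_dom.
by move=> k x _; rewrite lee_fin sqr_ge0.
Qed.

Lemma cov_ge0 x : 0 <= cov x.
Proof.
by apply: fine_ge0; apply: nneseries_ge0 => k _ _; rewrite lee_fin sqr_ge0.
Qed.

Lemma measurable_cov : measurable_fun D cov.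
Proof. by apply: measurableT_comp mcovE; exact: fine_measurable. Qed.

Lemma integrable_cov : mu.-integrable D (EFin \o cov).
Proof.
apply: le_integrable icovE; first exact: measurable_dom.
  by apply/measurable_EFinP; exact: measurable_cov.
move=> x _ /=; rewrite (gee0_abs (_ : (0 <= covE x)%E)); last first.
  by apply: nneseries_ge0 => k _ _; rewrite lee_fin sqr_ge0.
rewrite ger0_norm ?cov_ge0// /cov -/(covE x).
have : (0 <= covE x)%E.
  by apply: nneseries_ge0 => k _ _; rewrite lee_fin sqr_ge0.
by case: (covE x) => //= _; exact: leey.
Qed.

(** Only almost everywhere, because of the default value of [cov] where the series diverges. *)
Lemma cov_part :
  {ae mu, forall x, D x -> forall n, \sum_(k < n) phi k x ^+ 2 <= cov x}.
Proof.
have := integrable_ae (measurable_dom L) icovE.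
apply: aeS => x + Dx => /(_ Dx) fx n.
rewrite -lee_fin /cov fineK// -sumEFin.
rewrite -(big_mkord xpredT (fun k => (phi k x ^+ 2)%:E)).
by apply: nneseries_lim_ge => k _ _; rewrite lee_fin sqr_ge0.
Qed.

Lemma mea_w (X : Omega -> R) : measurable_fun setT X -> mea (fun w _ => X w).
Proof.
move=> mX; apply: measurable_funTS.
exact: (measurableT_comp mX measurable_fst).
Qed.

Let Wn n (t : R) : rfun := fun w x => \sum_(k < n) beta k t w * phi k x.

Let mWn n t : r0 <= t -> t <= T -> mea (Wn n t).
Proof.
move=> rt tT; apply: (mea_sum (F := fun k w x => beta k t w * phi k x)) => k _.
apply: meaM; last exact: mea_cst.
by apply: mea_w; exact: (adp_meas filtF (adp_beta filtF brown k rt (lexx t) tT)).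
Qed.

Section Isometry.
Variables (N : nat) (u : nat -> R) (H : nat -> rfun) (K : R).
Hypothesis hu : forall j, (j < N)%N -> [/\ r0 <= u j, u j <= u j.+1 & u j.+1 <= T].
Hypothesis mH : forall j, (j < N)%N -> mea (H j).
Hypothesis aH : forall j x, (j < N)%N -> D x -> adp (u j) (H j ^~ x).
Hypothesis bH : forall j w x, (j < N)%N -> D x -> `|H j w x| <= K.

Let hu1 j : (j < N)%N -> r0 <= u j /\ u j <= T.
Proof. by move=> /hu[a b c]; split => //; exact: le_trans c. Qed.

Let hu2 j : (j < N)%N -> r0 <= u j.+1 /\ u j.+1 <= T.
Proof. by move=> /hu[a b c]; split => //; exact: le_trans b. Qed.

Let mdW j : (j < N)%N -> mea (fun w x => W (u j.+1) w x - W (u j) w x).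
Proof.
move=> jN; have [? ?] := hu1 jN; have [? ?] := hu2 jN.
by apply: meaB; apply: mW.
Qed.

Let mdWn n j : (j < N)%N -> mea (fun w x => Wn n (u j.+1) w x - Wn n (u j) w x).
Proof.
move=> jN; have [? ?] := hu1 jN; have [? ?] := hu2 jN.
by apply: meaB; apply: mWn.
Qed.

Definition bracket_sum : rfun := fun w x =>
  cov x * \sum_(j < N) (u j.+1 - u j) * H j w x ^+ 2.

Lemma mea_bracket_sum : mea bracket_sum.
Proof.
apply: meaM; first exact: (mea_cst measurable_cov).
apply: (mea_sum (F := fun j w x => (u j.+1 - u j) * H j w x ^+ 2)) => j jN.
by apply: meaM; [exact: mea_const|apply: meaX; exact: mH].
Qed.

Lemma bracket_sum_ge0 : pos bracket_sum.
Proof.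
move=> w x _; apply: mulr_ge0; first exact: cov_ge0.
apply: sumr_ge0 => j _; apply: mulr_ge0; last exact: sqr_ge0.
by rewrite subr_ge0; have [] := hu (ltn_ord j).
Qed.

(** The noise multiplies pointwise in [x]. At each fixed [x] the integrand is thus a bounded adapted
    real process and [Wn] a finite combination of Brownian motions, so [ito_isometry_le] applies;
    Tonelli then integrates over [x]. *)
Lemma Wn_isometry n :
  (II (fun w x => (\sum_(j < N) H j w x *
      (Wn n (u j.+1) w x - Wn n (u j) w x)) ^+ 2)%R <=
   II (fun w x => 6 * bracket_sum w x)%R)%E.
Proof.
pose S : rfun := fun w x =>
  \sum_(j < N) H j w x * (Wn n (u j.+1) w x - Wn n (u j) w x).
pose Bn : rfun := fun w x => 6 * ((\sum_(k < n) phi k x ^+ 2) *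
  \sum_(j < N) (u j.+1 - u j) * H j w x ^+ 2).
have mS2 : mea (fun w x => S w x ^+ 2).
  apply: meaX; apply: (mea_sum (F := fun j w x => H j w x *
    (Wn n (u j.+1) w x - Wn n (u j) w x))) => j jN.
  by apply: meaM; [exact: mH|exact: mdWn].
have mBn : mea Bn.
  apply: meaM; first exact: mea_const.
  apply: meaM.
    apply: (mea_cst (c := fun x => \sum_(k < n) phi k x ^+ 2)).
    by apply: measurable_sum => k; exact: measurable_funX.
  apply: (mea_sum (F := fun j w x => (u j.+1 - u j) * H j w x ^+ 2)) => j jN.
  by apply: meaM; [exact: mea_const|apply: meaX; exact: mH].
have Bn0 : pos Bn.
  move=> w x _; rewrite /Bn mulr_ge0// mulr_ge0//.
    by apply: sumr_ge0 => k _; exact: sqr_ge0.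
  apply: sumr_ge0 => j _; apply: mulr_ge0; last exact: sqr_ge0.
  by rewrite subr_ge0; have [] := hu (ltn_ord j).
have S20 : pos (fun w x => S w x ^+ 2) by move=> w x _; exact: sqr_ge0.
apply: (@le_trans _ _ (II Bn)); last first.
  apply: II_le => //.
  - by apply: meaM; [exact: mea_const|exact: mea_bracket_sum].
  - by move=> w x Dx; rewrite mulr_ge0// bracket_sum_ge0.
  apply: aeW => w; move: cov_part; apply: aeS => x + Dx => /(_ Dx n) le.
  rewrite /Bn /bracket_sum ler_pM2l// ler_wpM2r//.
  apply: sumr_ge0 => j _; apply: mulr_ge0; last exact: sqr_ge0.
  by rewrite subr_ge0; have [] := hu (ltn_ord j).
rewrite (II_swap Pr mS2 S20) (II_swap Pr mBn Bn0).
have mswap f : mea f -> pos f ->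
    measurable_fun D (fun x => (\int[Pr]_w (f w x)%:E)%E).
  by move=> mf f0; exact: mea_inner2.
apply: (ge0_le_integral mu (measurable_dom L)).
- by move=> x Dx; apply: integral_ge0 => w _; rewrite lee_fin S20.
- exact: mswap.
- exact: mswap.
move=> x Dx.
have hH2 j : (j < N)%N -> L1 Pr (fun w => H j w x ^+ 2).
  move=> jN; apply: (@L1_le _ _ _ _ _ (fun _ => K ^+ 2)); last exact: L1_cst.
    by apply: measurable_funX; exact: mea_sec2 (mH jN) Dx.
  move=> w; rewrite normrX lerXn2r ?nnegrE ?bH//.
  by apply: le_trans (bH w jN Dx).
have [iS _ eS] := @ito_isometry_le _ _ _ Pr _ _ _ _ filtF brown u
  (fun j w => H j w x) (fun k => phi k x) n K N hu (fun j jN => aH jN Dx)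
  (fun j w jN => bH w jN Dx).
have SE w : \sum_(j < N) H j w x * comb beta (u j) (u j.+1) (phi^~ x) n w = S w x.
  apply: eq_bigr => j _; congr (_ * _); rewrite /comb /Wn -sumrB.
  by apply: eq_bigr => k _; rewrite /incr mulrC mulrBl.
have {}iS : L1 Pr (fun w => S w x ^+ 2).
  by move: iS; congr L1; apply/funext => w; rewrite SE.
have {}eS : Ex Pr (fun w => S w x ^+ 2) <= 6 * (\sum_(k < n) phi k x ^+ 2) *
     \sum_(j < N) (u j.+1 - u j) * Ex Pr (fun w => H j w x ^+ 2).
  apply: le_trans eS; rewrite le_eqVlt; apply/orP; left; apply/eqP.
  by congr Ex; apply/funext => w; rewrite SE.
have iB j : (j < N)%N -> L1 Pr (fun w => (u j.+1 - u j) * H j w x ^+ 2).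
  by move=> jN; apply: L1Z; exact: hH2.
have iB' := L1_sum iB.
have BnE : (fun w => Bn w x) = fun w => 6 * (\sum_(k < n) phi k x ^+ 2) *
    \sum_(j < N) (u j.+1 - u j) * H j w x ^+ 2.
  by apply/funext => w; rewrite /Bn mulrA.
have iBn : L1 Pr (fun w => Bn w x) by rewrite BnE; exact: L1Z.
rewrite (ExE iS) (ExE iBn) lee_fin; apply: (le_trans eS).
rewrite BnE ExZ// (Ex_sum0 iB) le_eqVlt; apply/orP; left; apply/eqP.
by congr (_ * _); apply: eq_bigr => j _; rewrite ExZ//; exact: hH2.
Qed.

(* 12 = 2 * 6: the crude bound 6 s^2 on the second moment of N(0, s^2) is doubled
   when passing from the partial sums of the series to W. *)
Lemma W_isometry :
  (II (fun w x => (\sum_(j < N) H j w x *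
      (W (u j.+1) w x - W (u j) w x)) ^+ 2)%R <=
   II (fun w x => 12 * bracket_sum w x)%R)%E.
Proof.
have mB := mea_bracket_sum; have B0 := bracket_sum_ge0.
apply/lee_addgt0Pr => e e0.
(* The factor by which the squared errors of [Wn] at the ends of the cells contribute: 2 from (X +
   Y)^2 <= 2 X^2 + 2 Y^2, N from Cauchy-Schwarz, K^2 from the bound on [H], 2 from (a - b)^2 <= 2
   a^2 + 2 b^2. *)
pose c : R := (2 * N%:R * K ^+ 2 * 2).
have c0 : 0 <= c.
  by rewrite /c; apply: mulr_ge0 => //; apply: mulr_ge0; [exact: mulr_ge0|exact: sqr_ge0].
pose E n t : rfun := fun w x => (W t w x - Wn n t w x) ^+ 2.
have mE n t : r0 <= t -> t <= T -> mea (E n t).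
  by move=> rt tT; apply: meaX; apply: meaB; [exact: mW|exact: mWn].
have E0 n t : pos (E n t) by move=> w x _; exact: sqr_ge0.
(* Chosen so that the 2N endpoint errors, each at most [dl], contribute at most [e] after
   multiplication by [c]. *)
pose dl := e / (2 * (c + 1) * N.+1%:R).
have dl0 : 0 < dl by rewrite divr_gt0// !mulr_gt0//; lra.
have [n hn] : exists n, forall j, (j < N)%N ->
    (II (E n (u j)) <= dl%:E)%E /\ (II (E n (u j.+1)) <= dl%:E)%E.
  have h j : (j < N)%N -> exists m, forall n, (m <= n)%N ->
      (II (E n (u j)) <= dl%:E)%E /\ (II (E n (u j.+1)) <= dl%:E)%E.
    move=> jN.
    have h1 t : r0 <= t -> t <= T ->
        exists m, forall n, (m <= n)%N -> (II (E n t) <= dl%:E)%E.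
      move=> rt tT; have cv := cvW rt tT; have := cv [set y | (y < dl%:E)%E].
      case=> [|m _ hm]; first by apply: open_ereal_lt'; rewrite lte_fin.
      by exists m => n mn; apply: ltW; exact: hm.
    have [a1 a2] := hu1 jN; have [b1 b2] := hu2 jN.
    have [m1 h1m] := h1 _ a1 a2; have [m2 h2m] := h1 _ b1 b2.
    exists (maxn m1 m2) => n; rewrite geq_max => /andP[p1 p2].
    by split; [exact: h1m|exact: h2m].
  have [m hm] : exists m : nat -> nat, forall j, (j < N)%N -> forall n,
      (m j <= n)%N ->
      (II (E n (u j)) <= dl%:E)%E /\ (II (E n (u j.+1)) <= dl%:E)%E.
    have h' j : exists m, (j < N)%N -> forall n, (m <= n)%N ->
      (II (E n (u j)) <= dl%:E)%E /\ (II (E n (u j.+1)) <= dl%:E)%E.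
      by case: (ltnP j N) => [/h[m hm]|_]; [exists m|exists 0%N].
    have [m hm] := choice h'; by exists m.
  exists (\max_(j < N) m j)%N => j jN; apply: hm => //.
  exact: (leq_bigmax (Ordinal jN)).
pose A : rfun := fun w x => (\sum_(j < N) H j w x *
  (Wn n (u j.+1) w x - Wn n (u j) w x)) ^+ 2.
have mA : mea A.
  apply: meaX; apply: (mea_sum (F := fun j w x => H j w x *
    (Wn n (u j.+1) w x - Wn n (u j) w x))) => j jN.
  by apply: meaM; [exact: mH|exact: mdWn].
have A0 : pos A by move=> w x _; exact: sqr_ge0.
pose G j : rfun := fun w x => E n (u j.+1) w x + E n (u j) w x.
have mG j : (j < N)%N -> mea (G j).
  move=> jN; have [? ?] := hu1 jN; have [? ?] := hu2 jN.
  by apply: meaD; apply: mE.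
have G0 j : pos (G j) by move=> w x Dx; apply: addr_ge0; exact: E0.
pose SG : rfun := fun w x => \sum_(j < N) G j w x.
have mSG : mea SG by apply: mea_sum => j jN; exact: mG.
have SG0 : pos SG by move=> w x Dx; apply: sumr_ge0 => j _; exact: G0.
have ISG : (II SG <= (N%:R * (dl + dl))%:E)%E.
  have : forall M, (M <= N)%N ->
      (II (fun w x => \sum_(j < M) G j w x)%R <= (M%:R * (dl + dl))%:E)%E.
    elim=> [|M IH] MN.
      rewrite mul0r; apply: (@le_trans _ _ (II (fun _ _ => 0))).
        apply: II_le => //; [exact: (mea_sum (n := 0))|exact: mea_const| |].
          by move=> w x _; rewrite big_ord0.
        by apply: AE2T => w x _; rewrite big_ord0.
      rewrite (@II_cst _ _ _ Pr L (cst 0)) ?integral0//.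
    apply: (@le_trans _ _ (II (fun w x => \sum_(j < M) G j w x + G M w x)%R)).
      apply: II_le.
      + by apply: mea_sum => j jM; apply: mG; exact: leq_trans MN.
      + apply: meaD; last exact: mG.
        by apply: mea_sum => j jM; apply: mG; apply: leq_trans MN; exact: ltnW.
      + by move=> w x Dx; apply: sumr_ge0 => j _; exact: G0.
      + move=> w x Dx; apply: addr_ge0; last exact: G0.
        by apply: sumr_ge0 => j _; exact: G0.
      by apply: AE2T => w x _; rewrite big_ord_recr.
    rewrite II_D//; last 3 first.
    + by apply: mea_sum => j jM; apply: mG; apply: leq_trans MN; exact: ltnW.
    + exact: mG.
    + by move=> w x Dx; apply: sumr_ge0 => j _; exact: G0.
    rewrite -natr1 mulrDl mul1r EFinD; apply: leeD; first by apply: IH; exact: ltnW.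
    have [a1 a2] := hu1 MN; have [b1 b2] := hu2 MN.
    rewrite II_D//; [|exact: mE..].
    have [h1 h2] := hn _ MN.
    exact: (leeD h2 h1).
  by apply.
apply: (@le_trans _ _ (II (fun w x => 2 * A w x + c * SG w x)%R)).
  apply: II_le.
  - apply: meaX; apply: (mea_sum (F := fun j w x => H j w x *
      (W (u j.+1) w x - W (u j) w x))) => j jN.
    by apply: meaM; [exact: mH|exact: mdW].
  - by apply: meaD; apply: meaM => //; exact: mea_const.
  - by move=> w x _; exact: sqr_ge0.
  - by move=> w x Dx; rewrite addr_ge0// mulr_ge0// ?A0// SG0.
  apply: AE2T => w x Dx.
  have -> : \sum_(j < N) H j w x * (W (u j.+1) w x - W (u j) w x) =
    \sum_(j < N) H j w x * (Wn n (u j.+1) w x - Wn n (u j) w x) +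
    \sum_(j < N) H j w x * ((W (u j.+1) w x - Wn n (u j.+1) w x) -
       (W (u j) w x - Wn n (u j) w x)).
    by rewrite -big_split; apply: eq_bigr => j _ /=; ring.
  rewrite /A; set X := \sum_(j < N) _; set Y := \sum_(j < N) _.
  have XY : (X + Y) ^+ 2 <= 2 * X ^+ 2 + 2 * Y ^+ 2.
    by have := sqr_ge0 (X - Y); nra.
  apply: (le_trans XY); rewrite lerD2l.
  have h1 := sqr_sum_le N (fun j => H j w x * ((W (u j.+1) w x - Wn n (u j.+1) w x) -
       (W (u j) w x - Wn n (u j) w x))).
  have h2 : \sum_(j < N) (H j w x * ((W (u j.+1) w x - Wn n (u j.+1) w x) -
       (W (u j) w x - Wn n (u j) w x))) ^+ 2 <= K ^+ 2 * 2 * SG w x.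
    rewrite /SG mulr_sumr; apply: ler_sum => j _.
    rewrite exprMn -mulrA; apply: ler_pM; [exact: sqr_ge0|exact: sqr_ge0| |].
      rewrite -real_normK ?num_real// lerXn2r ?nnegrE ?bH//.
      by apply: le_trans (bH w (ltn_ord j) Dx).
    rewrite /G /E; set a := W _ w x - _; set b := W _ w x - _.
    by have := sqr_ge0 (a + b); nra.
  have N0 : 0 <= N%:R :> R by [].
  apply: (@le_trans _ _ (2 * (N%:R * (K ^+ 2 * 2 * SG w x)))).
    apply: ler_wpM2l => //; apply: (le_trans h1); exact: ler_wpM2l.
  by rewrite /c le_eqVlt; apply/orP; left; apply/eqP; ring.
rewrite II_D//; last 4 first.
- by apply: meaM => //; exact: mea_const.
- by apply: meaM => //; exact: mea_const.
- by move=> w x Dx; rewrite mulr_ge0// A0.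
- by move=> w x Dx; rewrite mulr_ge0// SG0.
rewrite II_Z// II_Z//; apply: leeD.
  apply: (@le_trans _ _ (2%:E * II (fun w x => 6 * bracket_sum w x)%R)%E).
    by rewrite lee_wpmul2l// Wn_isometry.
  rewrite !II_Z// muleA -EFinM.
  by rewrite (_ : 2 * 6 = 12 :> R)//; ring.
apply: (@le_trans _ _ (c%:E * (N%:R * (dl + dl))%:E)%E).
  by rewrite lee_wpmul2l.
rewrite -EFinM lee_fin.
have -> : e = dl * (2 * (c + 1) * N.+1%:R).
  by rewrite /dl mulfVK// gt_eqF// !mulr_gt0//; lra.
have h (a b c' : R) : 0 <= a -> 0 < b -> 0 <= c' ->
    c' * (a * (b + b)) <= b * (2 * (c' + 1) * (a + 1)).
  by move=> *; nra.
by rewrite -[N.+1%:R]natr1; exact: h.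
Qed.

End Isometry.
End Wiener.

(** * Dyadic grids *)

Section Grid.
Context {R : realType}.
Variables (t0 t : R).
Hypothesis t0t : t0 < t.

Definition tau (n i : nat) : R := t0 + (t - t0) * i%:R / (2 ^ n)%:R.

Let p2 n : 0 < (2 ^ n)%:R :> R.
Proof. by rewrite ltr0n expn_gt0. Qed.

Lemma tau0 n : tau n 0 = t0.
Proof. by rewrite /tau mulr0 mul0r addr0. Qed.

Lemma tau_last n : tau n (2 ^ n) = t.
Proof. by rewrite /tau mulfK ?gt_eqF// addrC subrK. Qed.

Lemma tau_mono n i j : (i <= j)%N -> tau n i <= tau n j.
Proof.
move=> ij; rewrite /tau lerD2l ler_pM2r ?invr_gt0// ler_pM2l ?subr_gt0//.
by rewrite ler_nat.
Qed.

Lemma tau_lt n i j : (i < j)%N -> tau n i < tau n j.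
Proof.
move=> ij; rewrite /tau ltrD2l ltr_pM2r ?invr_gt0// ltr_pM2l ?subr_gt0//.
by rewrite ltr_nat.
Qed.

Lemma tau_ge n i : t0 <= tau n i.
Proof. by rewrite -(tau0 n) tau_mono. Qed.

Lemma tau_le n i : (i <= 2 ^ n)%N -> tau n i <= t.
Proof. by move=> ij; rewrite -[leRHS](tau_last n) tau_mono. Qed.

Lemma tauM n l i : tau (n + l) (i * 2 ^ l) = tau n i.
Proof.
rewrite /tau expnD !natrM; congr (_ + _); field.
by rewrite !gt_eqF.
Qed.

Lemma tau_near n i j k : (i <= k)%N -> (j <= k)%N -> (k <= i + 1)%N -> (k <= j + 1)%N ->
  `|tau n i - tau n j| <= (t - t0) / (2 ^ n)%:R.
Proof.
move=> ik jk ki kj.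
rewrite /tau opprD addrACA subrr add0r -!mulrBl -mulrBr !normrM.
rewrite (gtr0_norm (_ : 0 < t - t0)) ?subr_gt0//.
rewrite (gtr0_norm (_ : 0 < (2 ^ n)%:R^-1)) ?invr_gt0//.
rewrite -mulrA ler_pM2l ?subr_gt0// ler_piMl ?invr_ge0 ?(ltW (p2 n))//.
rewrite ler_norml; apply/andP; split.
  by rewrite lerNl opprB lerBlDr -[1]/(1%:R) -natrD ler_nat; lia.
by rewrite lerBlDr -[1]/(1%:R) -natrD ler_nat; lia.
Qed.

(** [k %/ 2 ^ l] is the index of the cell of level [n] that contains the k-th point of level
    [n + l]. *)
Lemma tau_low n l k : tau n (k %/ 2 ^ l) <= tau (n + l) k.
Proof. by rewrite -(tauM n l) tau_mono// leq_divM. Qed.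

Lemma tau_low_near n l k :
  tau (n + l) k - tau n (k %/ 2 ^ l) <= (t - t0) / (2 ^ n)%:R.
Proof.
have : tau (n + l) k <= tau (n + l) ((k %/ 2 ^ l).+1 * 2 ^ l).
  by rewrite tau_mono// ltnW// ltn_ceil// expn_gt0.
rewrite tauM lerBlDr => /le_trans; apply.
rewrite -lerBlDr; apply: (le_trans (ler_norm _)).
by apply: (@tau_near _ _ _ (k %/ 2 ^ l).+1); lia.
Qed.

Lemma tau_step n i : tau n i.+1 - tau n i = (t - t0) / (2 ^ n)%:R.
Proof.
rewrite /tau opprD addrACA subrr add0r -mulrBl -mulrBr -natr1.
by rewrite [_ + 1]addrC addrK mulr1.
Qed.

Lemma step_cvg0 (e : R) : 0 < e -> exists N, forall n, (N <= n)%N ->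
  (t - t0) / (2 ^ n)%:R <= e.
Proof.
move=> e0; have x0 : 0 < (t - t0) / e by rewrite divr_gt0// subr_gt0.
exists (Num.truncn ((t - t0) / e)).+1 => n nN.
rewrite ler_pdivrMr// -ler_pdivrMl// mulrC.
apply: (@le_trans _ _ (Num.truncn ((t - t0) / e)).+1%:R).
  by apply/ltW; exact: truncnS_gt.
rewrite ler_nat; apply: leq_trans nN _.
by apply: ltnW; exact: ltn_expl.
Qed.

(** For s = t the index is [2 ^ n], and the next point lies beyond [t]. *)
Lemma tau_floor n s : t0 <= s -> s <= t ->
  exists k, [/\ (k <= 2 ^ n)%N, tau n k <= s & s < tau n k.+1].
Proof.
move=> t0s st; have tt0 : 0 < t - t0 by rewrite subr_gt0.
pose k := Num.truncn ((s - t0) / (t - t0) * (2 ^ n)%:R).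
have r0 : 0 <= (s - t0) / (t - t0) * (2 ^ n)%:R.
  apply: mulr_ge0; [apply: divr_ge0; [by rewrite subr_ge0|exact: ltW]|].
  exact/ltW/p2.
have /andP[k1 k2] : k%:R <= (s - t0) / (t - t0) * (2 ^ n)%:R < k.+1%:R.
  exact: truncn_itv.
have tauE j : tau n j = t0 + j%:R / (2 ^ n)%:R * (t - t0).
  by rewrite /tau; ring.
exists k; split.
- rewrite -(ler_nat R); apply: (le_trans k1).
  rewrite -[leRHS]mul1r; apply: ler_wpM2r; first exact/ltW/p2.
  by rewrite ler_pdivrMr// mul1r lerD2r.
- by rewrite tauE -lerBrDl -ler_pdivlMr// ler_pdivrMr.
- by rewrite tauE -ltrBlDl -ltr_pdivrMr// ltr_pdivlMr.
Qed.

(** Indices start at 1: the left end t0 is implicit in the convention for partitions. *)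
Definition gridseq n i := [seq tau n j | j <- iota 1 i].

Lemma size_gridseq n i : size (gridseq n i) = i.
Proof. by rewrite size_map size_iota. Qed.

Lemma knot_gridseq n i j : (j <= i)%N -> knot t0 (tau n i) (gridseq n i) j = tau n j.
Proof.
rewrite /knot; case: j => [|j] ji; first by rewrite /= tau0.
by rewrite /= (nth_map 0%N) ?size_iota// nth_iota.
Qed.

Lemma gridseq_partition n i : itv_partition t0 (tau n i) (gridseq n i).
Proof.
rewrite /itv_partition; split; last first.
  rewrite /gridseq; case: i => [|i]; first by rewrite /= tau0.
  by rewrite -[i.+1]addn1 iotaD map_cat last_cat /= add1n addn1.
rewrite -(tau0 n) /gridseq.
elim: i 0%N => //= i IH m; rewrite tau_lt//=; exact: (IH m.+1).
Qed.

Lemma gridseq_mesh n i j : (j < size (gridseq n i))%N ->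
  knot t0 (tau n i) (gridseq n i) j.+1 - knot t0 (tau n i) (gridseq n i) j =
  (t - t0) / (2 ^ n)%:R.
Proof.
by rewrite size_gridseq => ji; rewrite !knot_gridseq ?tau_step// ltnW.
Qed.

End Grid.

Lemma sum_blocks {R : realType} A B (f : nat -> R) :
  \sum_(i < A) \sum_(j < B) f (i * B + j)%N = \sum_(k < A * B) f k.
Proof.
rewrite -(big_mkord xpredT f) big_nat_mul big_mkord; apply: eq_bigr => i _.
rewrite -(big_mkord xpredT (fun j => f (i * B + j)%N)).
rewrite -{2}[(i * B)%N]add0n big_addn mulSn addnK.
by apply: eq_bigr => j _; rewrite addnC.
Qed.

(** * Square-integrable functions and the trace of the covariance *)

Section SquareIntegrable.
Context {R : realType} (L : R).
Hypothesis L0 : 0 < L.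
Local Notation mu := (@lebesgue_measure R).
Local Notation D := (dom L).
Implicit Types u v : R -> R.

Lemma inU_sqr u : inU L u -> (\int[mu]_(x in D) (u x ^+ 2)%:E < +oo)%E.
Proof.
move=> [_ /lty_poweRy]; rewrite invr_eq0 pnatr_eq0 => /(_ isT).
by under eq_integral do rewrite real_normK ?num_real//.
Qed.

Lemma inU_integrableM u v : inU L u -> inU L v ->
  mu.-integrable D (fun x => (u x * v x)%:E).
Proof.
move=> hu hv; have [mu_ _] := hu; have [mv _] := hv.
have mD := measurable_dom L.
apply/integrableP; split.
  by apply/measurable_EFinP; exact: measurable_funM.
have m2 (w : R -> R) : measurable_fun D w -> measurable_fun D (fun x => (w x ^+ 2)%:E).
  by move=> mw; apply/measurable_EFinP; exact: measurable_funX.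
apply: (@le_lt_trans _ _ (\int[mu]_(x in D) ((u x ^+ 2)%:E + (v x ^+ 2)%:E))%E).
  apply: (ge0_le_integral mu mD) => //.
  - by apply: measurableT_comp => //; apply/measurable_EFinP; exact: measurable_funM.
  - by apply: emeasurable_funD; exact: m2.
  move=> x _; rewrite -EFinD lee_fin.
  have := sqr_ge0 (u x + v x); have := sqr_ge0 (u x - v x).
  have := sqr_ge0 (u x); have := sqr_ge0 (v x).
  by rewrite ler_norml => *; apply/andP; split; nra.
rewrite (ge0_integralD mu mD)//; last 4 first.
- by move=> x _; rewrite lee_fin sqr_ge0.
- exact: m2.
- by move=> x _; rewrite lee_fin sqr_ge0.
- exact: m2.
by rewrite lte_add_pinfty// inU_sqr.
Qed.

Lemma inner_sqrE u : inU L u -> (\int[mu]_(x in D) (u x ^+ 2)%:E = (inner L u u)%:E)%E.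
Proof.
move=> hu; rewrite /inner /Rintegral fineK//.
apply: integrable_fin_num; first exact: measurable_dom.
exact: inU_integrableM.
Qed.

Lemma inner_eqU u v w : inU L u -> inU L v -> inU L w -> eqU L u v ->
  inner L u w = inner L v w.
Proof.
move=> [mu_ _] [mv _] [mw _] uv; congr fine; apply: ae_eq_integral.
- exact: measurable_dom.
- by apply/measurable_EFinP; exact: measurable_funM.
- by apply/measurable_EFinP; exact: measurable_funM.
by move: uv; apply: aeS => x uv Dx; rewrite uv.
Qed.

(** By symmetry of the square root, the inner product of Q e_k with e_k is the squared norm of Qhalf
    e_k: the trace of Q is the squared Hilbert-Schmidt norm of its square root. *)
Lemma trace_half Q Qhalf (e : nat -> R -> R) :
  bounded_op L Q -> sqrt_op L Q Qhalf -> (forall k, inU L (e k)) ->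
  finite_trace L Q e ->
  (\sum_(k <oo) \int[mu]_(x in D) (Qhalf (e k) x ^+ 2)%:E < +oo)%E.
Proof.
move=> [bQ _ _] [[bH _ _] symH _ QH] ie; rewrite /finite_trace.
rewrite (_ : (\sum_(k <oo) (inner L (Q (e k)) (e k))%:E)%E =
  (\sum_(k <oo) \int[mu]_(x in D) (Qhalf (e k) x ^+ 2)%:E)%E)//.
apply: eq_eseriesr => k _; rewrite inner_sqrE; last exact: bH.
rewrite -symH//; last exact: bH.
congr EFin; symmetry; apply: inner_eqU => //.
- by apply: (bH); exact: bH.
- exact: bQ.
- exact: QH.
Qed.

End SquareIntegrable.

(** * Integrals over rectangles *)

(** Passes from inner integrals with extended values, finite only almost everywhere, to the
    real-valued integrals of the statements. *)
Lemma integrable_fine {R : realType} (E : set (measurableTypeR R))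
    (h : R -> \bar R) :
  measurable E -> (@lebesgue_measure R).-integrable E h ->
  (@lebesgue_measure R).-integrable E (fun x => (fine (h x))%:E) /\
  (\int[@lebesgue_measure R]_(x in E) (fine (h x))%:E =
   \int[@lebesgue_measure R]_(x in E) h x)%E.
Proof.
move=> mE ih; have mh := measurable_int _ ih.
have mfh : measurable_fun E (fun x => (fine (h x))%:E).
  apply/measurable_EFinP; apply: (measurableT_comp _ mh); exact: fine_measurable.
split.
  apply: le_integrable ih => // x _ /=; case: (h x) => //= *; exact: leey.
apply: ae_eq_integral => //; have := integrable_ae mE ih.
by apply: aeS => x hx Ex; rewrite fineK// hx.
Qed.

Section RectangleIntegral.
Context {R : realType}.
Variables (A E : set R) (f : R -> R -> R).
Local Notation mu := (@lebesgue_measure R).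
Hypothesis mA : measurable (A : set (measurableTypeR R)).
Hypothesis mE : measurable (E : set (measurableTypeR R)).
Hypothesis mf : measurable_fun (A `*` E)
  (fun p : (measurableTypeR R * measurableTypeR R)%type => f p.1 p.2).

Let fe (p : measurableTypeR R * measurableTypeR R) : \bar R :=
  ((fun p => (f p.1 p.2)%:E) \_ (A `*` E)) p.

Let feE s x : A s -> E x -> fe (s, x) = (f s x)%:E.
Proof. by move=> As Ex; rewrite /fe patchE mem_set. Qed.

Let feA s x : ~ A s -> fe (s, x) = 0%E.
Proof. by move=> As; rewrite /fe patchE memNset//= => -[]. Qed.

Let feE0 s x : ~ E x -> fe (s, x) = 0%E.
Proof. by move=> Ex; rewrite /fe patchE memNset//= => -[]. Qed.

Let mfe : measurable_fun setT fe.
Proof.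
apply/(measurable_restrictT _ (measurableX mA mE)).
exact/measurable_EFinP.
Qed.

(** [g] is the identity for Fubini and the absolute value for integrability. *)
Let int1 (g : \bar R -> \bar R) s : g 0%E = 0%E ->
  (\int[mu]_x g (fe (s, x)) = ((fun s => \int[mu]_(x in E) g (f s x)%:E) \_ A) s)%E.
Proof.
move=> g0; rewrite patchE; case: ifPn => [|]; rewrite ?inE ?notin_setE => As.
  rewrite [RHS]integral_mkcond; apply: eq_integral => x _.
  rewrite patchE; case: ifPn => [|]; rewrite ?inE ?notin_setE => Ex.
    by rewrite feE.
  by rewrite feE0.
by apply: integral0_eq => x _; rewrite feA.
Qed.

Let int2 (g : \bar R -> \bar R) x : g 0%E = 0%E ->
  (\int[mu]_s g (fe (s, x)) = ((fun x => \int[mu]_(s in A) g (f s x)%:E) \_ E) x)%E.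
Proof.
move=> g0; rewrite patchE; case: ifPn => [|]; rewrite ?inE ?notin_setE => Ex.
  rewrite [RHS]integral_mkcond; apply: eq_integral => s _.
  rewrite patchE; case: ifPn => [|]; rewrite ?inE ?notin_setE => As.
    by rewrite feE.
  by rewrite feA.
by apply: integral0_eq => s _; rewrite feE0.
Qed.

Lemma measurable_rect_section s : A s -> measurable_fun E (f s).
Proof.
move=> As; apply/measurable_EFinP/(measurable_restrictT _ mE).
rewrite (_ : _ \_ E = fun x => fe (s, x)).
  exact: (measurableT_comp mfe (pair1_measurable s)).
apply/funext => x; rewrite patchE.
by case: ifPn => [|]; rewrite ?inE ?notin_setE => Ex; [rewrite feE|rewrite feE0].
Qed.

Lemma measurable_rect_section2 x : E x -> measurable_fun A (f ^~ x).
Proof.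
move=> Ex; apply/measurable_EFinP/(measurable_restrictT _ mA).
rewrite (_ : _ \_ A = fun s => fe (s, x)).
  exact: (measurableT_comp mfe (pair2_measurable x)).
apply/funext => s; rewrite patchE.
by case: ifPn => [|]; rewrite ?inE ?notin_setE => As; [rewrite feE|rewrite feA].
Qed.

Lemma measurable_rect_inner :
  measurable_fun A (fun s => \int[mu]_(x in E) `|f s x|%:E)%E.
Proof.
apply/(measurable_restrictT _ mA).
rewrite (_ : _ \_ A = fun s => (\int[mu]_x `|fe (s, x)|)%E).
  apply: (measurable_fun_fubini_tonelli_F (abse \o fe)) => //=.
  exact: measurableT_comp.
by apply/funext => s; rewrite (int1 (g := abse))// abse0.
Qed.

Hypothesis fin : (\int[mu]_(s in A) \int[mu]_(x in E) `|f s x|%:E < +oo)%E.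

Let ife : (mu \x mu)%E.-integrable setT fe.
Proof.
apply/(integrable12ltyP mu mu mfe).
apply: le_lt_trans fin; rewrite [leRHS]integral_mkcond le_eqVlt; apply/orP; left.
apply/eqP; apply: eq_integral => s _.
by rewrite (int1 (g := abse))// abse0.
Qed.

Lemma rect_section_integrable :
  {ae mu, forall x, E x -> mu.-integrable A (fun s => (f s x)%:E)}.
Proof.
have := ae_integrable2 ife; apply: aeS => x ix Ex.
apply/(integrable_mkcond _ mA); rewrite (_ : _ \_ A = fun s => fe (s, x)); first exact: ix.
apply/funext => s; rewrite patchE.
by case: ifPn => [|]; rewrite ?inE ?notin_setE => As; [rewrite feE|rewrite feA].
Qed.

Let iG : mu.-integrable E (fun x => \int[mu]_(s in A) (f s x)%:E)%E.
Proof.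
have mG : measurable_fun setT (fubini_G mu fe) by exact: measurable_fubini_G ife.
have iG : mu.-integrable setT (fubini_G mu fe).
  apply/integrableP; split => //.
  apply: le_lt_trans ((integrable21ltyP mu mu mfe).1 ife).
  apply: ge0_le_integral => //.
  - exact: measurableT_comp.
  - apply: (measurable_fun_fubini_tonelli_G (abse \o fe)) => //=.
    exact: measurableT_comp.
  move=> x _; apply: le_abse_integral => //.
  exact: (measurableT_comp mfe (pair2_measurable x)).
apply/(integrable_mkcond _ mE); rewrite (_ : _ \_ E = fubini_G mu fe); first exact: iG.
by apply/funext => x; rewrite /fubini_G (int2 (g := id)).
Qed.

Let iF : mu.-integrable A (fun s => \int[mu]_(x in E) (f s x)%:E)%E.
Proof.
apply/(integrable_mkcond _ mA); rewrite (_ : _ \_ A = fubini_F mu fe).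
  exact: integrable_fubini_F ife.
by apply/funext => s; rewrite /fubini_F (int1 (g := id)).
Qed.

Lemma rect_integrable :
  mu.-integrable E (fun x => (\int[mu]_(s in A) f s x)%R%:E).
Proof. exact: (integrable_fine mE iG).1. Qed.

Lemma rect_integrable1 :
  mu.-integrable A (fun s => (\int[mu]_(x in E) f s x)%R%:E).
Proof. exact: (integrable_fine mA iF).1. Qed.

Lemma rect_Fubini :
  \int[mu]_(x in E) (\int[mu]_(s in A) f s x) =
  \int[mu]_(s in A) (\int[mu]_(x in E) f s x).
Proof.
congr fine; rewrite (integrable_fine mE iG).2 (integrable_fine mA iF).2.
rewrite integral_mkcond [RHS]integral_mkcond.
transitivity (\int[mu]_x \int[mu]_s fe (s, x))%E.
  by apply: eq_integral => x _; rewrite (int2 (g := id)).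
rewrite -(Fubini ife).
by apply: eq_integral => s _; rewrite (int1 (g := id)).
Qed.

End RectangleIntegral.

(** * Symmetry of the Dirichlet Laplacian *)

Section Green.
Context {R : realType} (L : R).
Hypothesis L0 : 0 < L.
Local Notation mu := (@lebesgue_measure R).
Local Notation D := (dom L).
Implicit Types u v g h : R -> R.

Let LL : - L <= L. Proof. by rewrite ge0_cp// ltW. Qed.

Let mD := measurable_dom L.

Lemma continuous_inU u : {within D, continuous u} -> inU L u.
Proof.
move=> cu; have cD : compact D by exact: segment_compact.
split; first exact: subspace_continuous_measurable_fun.
apply: poweR_lty.
have cu2 : {within D, continuous (fun x => u x * u x : R^o)}.
  by move=> x; apply: continuousM; exact: cu.
have /integrableP[_] := continuous_compact_integrable cD cu2.
congr (_ < _)%E; apply: eq_integral => x _ /=.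
by rewrite normrM expr2.
Qed.

Lemma inU_integrable u : inU L u -> mu.-integrable D (EFin \o u).
Proof.
move=> hu; have h1 : inU L (cst 1).
  by apply: continuous_inU => x; exact: cvg_cst.
rewrite (_ : EFin \o u = fun x => (u x * (cst 1 : R -> R) x)%:E).
  exact: inU_integrableM.
by apply/funext => x /=; rewrite mulr1.
Qed.

(** Integration by parts for primitives of integrable functions: both sides are the integral of g(y)
    h(x) over the triangle y <= x. *)
Lemma primitive_Fubini g h : mu.-integrable D (EFin \o g) ->
  mu.-integrable D (EFin \o h) ->
  \int[mu]_(x in D) ((\int[mu]_(y in `[- L, x]) g y) * h x) =
  \int[mu]_(y in D) (g y * (\int[mu]_(x in D) h x - \int[mu]_(x in `[- L, y]) h x)).
Proof.
move=> ig ih; have mg := measurable_int _ ig; have mh := measurable_int _ ih.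
pose f (y x : R) : R := if y <= x then g y * h x else 0.
have mf : measurable_fun (D `*` D)
    (fun p : (measurableTypeR R * measurableTypeR R)%type => f p.1 p.2).
  have mDD : measurable (D `*` D : set (measurableTypeR R * measurableTypeR R)).
    exact: measurableX.
  apply: measurable_fun_if => //.
  - by apply: measurable_fun_ler; apply: measurable_funTS;
      [exact: measurable_fst|exact: measurable_snd].
  - apply: measurable_funM.
      apply: (measurable_comp (F := D)) (measurable_funTS measurable_fst) => //.
        by move=> _ [[a b] [[/= Da _] _] <-].
      exact/measurable_EFinP.
    apply: (measurable_comp (F := D)) (measurable_funTS measurable_snd) => //.
      by move=> _ [[a b] [[/= _ Db] _] <-].
    exact/measurable_EFinP.
have fE1 x y : f y x = (if y <= x then g y else 0) * h x.
  by rewrite /f; case: ifP; rewrite ?mul0r.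
have fE2 x y : f y x = g y * (if y <= x then h x else 0).
  by rewrite /f; case: ifP; rewrite ?mulr0.
have mhe : measurable_fun D (fun x => `|h x|%:E).
  by apply/measurable_EFinP; apply: measurableT_comp => //; exact/measurable_EFinP.
have mge : measurable_fun D (fun x => `|g x|%:E).
  by apply/measurable_EFinP; apply: measurableT_comp => //; exact/measurable_EFinP.
have fin : (\int[mu]_(y in D) \int[mu]_(x in D) `|f y x|%:E < +oo)%E.
  pose c := (\int[mu]_(x in D) `|h x|%:E)%E.
  have cfin : (c < +oo)%E by have /integrableP[_] := ih.
  have c0 : (0 <= c)%E by apply: integral_ge0 => x _; rewrite lee_fin.
  have cE : c = (fine c)%:E by rewrite fineK// ge0_fin_numE.
  apply: (@le_lt_trans _ _ (\int[mu]_(y in D) ((fine c)%:E * `|g y|%:E))%E).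
    apply: ge0_le_integral => //.
    - by move=> y _; apply: integral_ge0 => x _; rewrite lee_fin.
    - exact: measurable_rect_inner mf.
    - exact: measurable_funeM.
    move=> y Dy; rewrite -cE muleC -ge0_integralZl_EFin//.
    apply: (ge0_le_integral mu mD) => //.
    - apply/measurable_EFinP; apply: measurableT_comp => //.
      exact: measurable_rect_section mf _ Dy.
    - exact: measurable_funeM.
    move=> x Dx; rewrite -EFinM lee_fin /f; case: ifP; rewrite ?normrM//.
    by rewrite normr0 mulr_ge0.
  rewrite ge0_integralZl_EFin//; last exact: fine_ge0.
  have /integrableP[_ gfin] := ig.
  by rewrite lte_mul_pinfty// lee_fin fine_ge0.
have restr (k : R -> R) (P : set R) : measurable (P : set (measurableTypeR R)) ->
    mu.-integrable D (EFin \o k) -> mu.-integrable D (EFin \o (k \_ P)).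
  move=> mP ik; rewrite -restrict_EFin; apply/integrable_restrict => //.
  by apply: integrableS ik => //; exact: measurableI.
transitivity (\int[mu]_(x in D) \int[mu]_(y in D) f y x).
  apply: eq_Rintegral => x; rewrite inE => Dx; under [RHS]eq_Rintegral do rewrite fE1.
  have -> : `[- L, x]%classic = D `&` `]-oo, x].
    apply/seteqP; split => y; rewrite /dom /= !in_itv/=.
      by move: Dx; rewrite /dom /= in_itv/= => /andP[_ xL] /andP[-> yx];
        rewrite yx (le_trans yx).
    by move=> [/andP[-> _] ->].
  rewrite Rintegral_mkcondr -RintegralZr//; last exact: restr.
  apply: eq_Rintegral => y _; rewrite patchE; congr (_ * _).
  by congr (if _ then _ else _); apply/idP/idP; rewrite inE /= in_itv.
rewrite (rect_Fubini mD mD mf fin); apply: eq_Rintegral => y; rewrite inE => Dy.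
under eq_Rintegral do rewrite fE2.
rewrite (_ : (\int[mu]_(x in D) h x - \int[mu]_(x in `[- L, y]) h x) =
  \int[mu]_(x in D) (h \_ `[y, +oo[) x).
  rewrite -RintegralZl//; last exact: restr.
  apply: eq_Rintegral => x _; rewrite patchE; congr (_ * _).
  by congr (if _ then _ else _); apply/idP/idP; rewrite inE /= in_itv /= andbT.
move: Dy; rewrite /dom /= in_itv/= => /andP[Ly yL].
rewrite Rintegral_itvB ?bnd_simp//.
(* The single point [y] is negligible. *)
rewrite Rintegral_itv_obnd_cbnd; last first.
  by apply: integrableS ih => //; apply: subset_itvr; rewrite bnd_simp.
rewrite -Rintegral_mkcondr; congr (Rintegral _ _ _).
apply/seteqP; split => x; rewrite /dom /= !in_itv/= andbT.
  by move=> /andP[yx ->]; rewrite yx (le_trans Ly).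
by move=> [/andP[_ ->] ->].
Qed.

Lemma dirichlet_laplacian_sym u v u' v' :
  dirichlet_laplacian L u v -> dirichlet_laplacian L u' v' ->
  \int[mu]_(x in D) (u x * v' x) = \int[mu]_(x in D) (u' x * v x).
Proof.
(* One integration by parts, [a'] being the derivative of [dw']. The boundary term at L contains
   w(L) = 0, and there is none at -L because w is the integral of [dw] from -L. The result is
   symmetric in the two functions. *)
have half (w a dw a' dw' : R -> R) : w L = 0 -> inU L a -> inU L a' ->
    (forall x, D x -> w x = \int[mu]_(y in `[- L, x]) dw y) ->
    (forall x, D x -> dw x = dw (- L) + \int[mu]_(y in `[- L, x]) a y) ->
    (forall x, D x -> dw' x = dw' (- L) + \int[mu]_(y in `[- L, x]) a' y) ->
    \int[mu]_(x in D) (w x * a' x) = - \int[mu]_(x in D) (dw x * dw' x).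
  move=> wL ua ua' wE dwE dwE'.
  have DL : D L by rewrite /dom /= in_itv/= LL lexx.
  have udw b db : inU L b ->
      (forall x, D x -> db x = db (- L) + \int[mu]_(y in `[- L, x]) b y) -> inU L db.
    move=> ub dbE; apply: continuous_inU.
    apply: (@subspace_eq_continuous _ _ _
      (fun x => db (- L) + \int[mu]_(y in `[- L, x]) b y)).
      by move=> x; rewrite inE => Dx; exact: esym (dbE x Dx).
    move=> x; apply: cvgD; first exact: cvg_cst.
    by apply: parameterized_integral_continuous => //; exact: inU_integrable.
  have udw1 := udw _ _ ua dwE; have udw2 := udw _ _ ua' dwE'.
  transitivity (\int[mu]_(x in D) ((\int[mu]_(y in `[- L, x]) dw y) * a' x)).
    by apply: eq_Rintegral => x; rewrite inE => Dx; rewrite wE.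
  rewrite primitive_Fubini; [|exact: inU_integrable..].
  transitivity (\int[mu]_(y in D) (dw y * dw' L - dw y * dw' y)).
    apply: eq_Rintegral => y; rewrite inE => Dy.
    have -> : \int[mu]_(x in D) a' x = dw' L - dw' (- L) by rewrite (dwE' L)// addrC addKr.
    have -> : \int[mu]_(x in `[- L, y]) a' x = dw' y - dw' (- L).
      by rewrite (dwE' y)// addrC addKr.
    by ring.
  rewrite RintegralB//; last 2 first.
  - rewrite (_ : _ \o _ = fun y => (dw' L)%:E * (dw y)%:E)%E.
      by apply: integrableZl => //; exact: inU_integrable.
    by apply/funext => y /=; rewrite mulrC.
  - exact: inU_integrableM.
  rewrite RintegralZr//; last exact: inU_integrable.
  by rewrite -(wE L)// wL mul0r sub0r.
move=> [_ uL uv [du [uE duE]]] [_ u'L uv' [du' [u'E du'E]]].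
rewrite (half u v du v' du')// (half u' v' du' v du)//.
by congr (- _); apply: eq_Rintegral => x _; rewrite mulrC.
Qed.

End Green.

(** * Riemann sums of drifts *)

Section Drift.
Context {R : realType}.
Variables (L t0 t : R).
Hypothesis L0 : 0 < L.
Hypothesis t0t : t0 < t.
Local Notation mu := (@lebesgue_measure R).
Local Notation D := (dom L).
Local Notation A := (`[t0, t]%classic : set R).
Local Notation tau := (tau t0 t).
Implicit Types (Y b f g : R -> R -> R).

(** What is retained of a sample path of a solution: boundedness, and continuity in time that is
    uniform in [x]; in [x] itself only measurability is kept. *)
Definition path_coef Y := [/\ forall s, A s -> measurable_fun D (Y s),
  exists B, forall s x, A s -> D x -> `|Y s x| <= B &
  forall e : R, 0 < e -> exists2 dlt : R, 0 < dlt & forall s s' x, A s -> A s' -> D x ->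
    `|s - s'| <= dlt -> `|Y s x - Y s' x| <= e].

Definition space_time_L1 b :=
  measurable_fun (A `*` D)
    (fun p : (measurableTypeR R * measurableTypeR R)%type => b p.1 p.2) /\
  (\int[mu]_(s in A) \int[mu]_(x in D) `|b s x|%:E < +oo)%E.

Let mA : measurable (A : set (measurableTypeR R)).
Proof. exact: measurable_itv. Qed.

Let mD : measurable (D : set (measurableTypeR R)) := measurable_dom L.

Let tauA n i : (i <= 2 ^ n)%N -> A (tau n i).
Proof. by move=> i_n; rewrite /= in_itv/= tau_ge//= tau_le. Qed.

(* By approximation with step functions in time. *)
Lemma path_coef_measurable Y : path_coef Y ->
  measurable_fun (A `*` D)
    (fun p : (measurableTypeR R * measurableTypeR R)%type => Y p.1 p.2).
Proof.
move=> [mY _ uY].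
(* The extra cell of index [2 ^ n] covers the endpoint [t]. *)
pose h n (p : measurableTypeR R * measurableTypeR R) := \sum_(i < (2 ^ n).+1)
  \1_(`[tau n i, tau n i.+1[ : set (measurableTypeR R)) p.1 * Y (tau n i) p.2.
apply: (@measurable_fun_cvg _ _ _ _ h).
  move=> n; apply: measurable_sum => i; apply: measurable_funM.
    apply: (measurable_comp (F := setT)) => //.
    by apply: measurable_funTS; exact: measurable_fst.
  apply: (measurable_comp (F := D)) (measurable_funTS measurable_snd) => //.
    by move=> _ [[a b] [/= _ Db] <-].
  by apply: mY; apply: tauA; rewrite -ltnS.
move=> [s x] [/= As Dx]; move: (As); rewrite /= in_itv/= => /andP[t0s st].
apply/cvgrPdist_le => e e0; have [dl dl0 hdl] := uY _ e0.
have [N hN] := step_cvg0 t0t dl0; exists N => // n /= Nn.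
have [k [kn ks sk]] := tau_floor t0t n t0s st; rewrite -ltnS in kn.
rewrite /h (bigD1 (Ordinal kn))//= big1 ?addr0; last first.
  move=> i; rewrite -val_eqE /= => ik; rewrite indicE memNset ?mul0r//=.
  rewrite in_itv/= => /andP[is_ si]; move: ik; rewrite neq_ltn => /orP[ik|ki].
    have := tau_mono t0t n ik; rewrite leNgt => /negP; apply.
    exact: le_lt_trans ks si.
  have := tau_mono t0t n ki; rewrite leNgt => /negP; apply.
  exact: le_lt_trans is_ sk.
rewrite indicE mem_set/= ?in_itv/= ?ks ?sk// mul1r.
apply: hdl => //; first by apply: tauA; rewrite -ltnS.
rewrite ger0_norm ?subr_ge0//; apply: le_trans (hN n Nn).
by rewrite -(tau_step t0 t n k) lerD2r ltW.
Qed.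

Lemma path_coef_mul Y b : path_coef Y -> space_time_L1 b ->
  space_time_L1 (fun s x => Y s x * b s x).
Proof.
move=> pY [mb fb]; have mY := path_coef_measurable pY.
have mYb : measurable_fun (A `*` D)
    (fun p : (measurableTypeR R * measurableTypeR R)%type => Y p.1 p.2 * b p.1 p.2).
  exact: measurable_funM.
split; first exact: mYb.
have [_ [B hB] _] := pY.
apply: (@le_lt_trans _ _
  (\int[mu]_(s in A) ((`|B|)%:E * \int[mu]_(x in D) `|b s x|%:E))%E).
  apply: ge0_le_integral => //.
  - by move=> s _; apply: integral_ge0 => x _; rewrite lee_fin.
  - exact: (@measurable_rect_inner _ A D (fun s x => Y s x * b s x) mA mD mYb).
  - by apply: measurable_funeM; exact: (measurable_rect_inner mA mD mb).
  move=> s As; have mbs := measurable_rect_section mA mD mb As.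
  have mYbs := @measurable_rect_section _ A D (fun s x => Y s x * b s x) mA mD mYb s As.
  rewrite -ge0_integralZl_EFin//; last first.
    by apply/measurable_EFinP; exact: measurableT_comp.
  apply: (ge0_le_integral mu mD) => //.
  - by apply/measurable_EFinP; exact: measurableT_comp.
  - by apply: measurable_funeM; apply/measurable_EFinP; exact: measurableT_comp.
  move=> x Dx; rewrite -EFinM lee_fin normrM ler_wpM2r//.
  by apply: le_trans (ler_norm _); exact: hB.
rewrite ge0_integralZl_EFin//; last 2 first.
- by move=> s _; apply: integral_ge0 => x _; rewrite lee_fin.
- exact: (measurable_rect_inner mA mD mb).
by rewrite lte_mul_pinfty// lee_fin.
Qed.

Lemma space_time_L1D f g : space_time_L1 f -> space_time_L1 g ->
  space_time_L1 (fun s x => f s x + g s x).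
Proof.
move=> [mf ff] [mg fg].
have mfg : measurable_fun (A `*` D)
    (fun p : (measurableTypeR R * measurableTypeR R)%type => f p.1 p.2 + g p.1 p.2).
  exact: measurable_funD.
split; first exact: mfg.
apply: (@le_lt_trans _ _ (\int[mu]_(s in A) (\int[mu]_(x in D) `|f s x|%:E +
    \int[mu]_(x in D) `|g s x|%:E))%E).
  apply: ge0_le_integral => //.
  - by move=> s _; apply: integral_ge0 => x _; rewrite lee_fin.
  - exact: (@measurable_rect_inner _ A D (fun s x => f s x + g s x) mA mD mfg).
  - by apply: emeasurable_funD; [exact: (measurable_rect_inner mA mD mf)|
      exact: (measurable_rect_inner mA mD mg)].
  move=> s As.
  have mfs := measurable_rect_section mA mD mf As.
  have mgs := measurable_rect_section mA mD mg As.
  have mfgs := @measurable_rect_section _ A D (fun s x => f s x + g s x) mA mD mfg s As.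
  rewrite -ge0_integralD//; last 2 first.
  - by apply/measurable_EFinP; exact: measurableT_comp.
  - by apply/measurable_EFinP; exact: measurableT_comp.
  apply: (ge0_le_integral mu mD) => //.
  - by apply/measurable_EFinP; exact: measurableT_comp.
  - by apply: emeasurable_funD; apply/measurable_EFinP; exact: measurableT_comp.
  by move=> x _; rewrite -EFinD lee_fin ler_normD.
rewrite ge0_integralD//; last 4 first.
- by move=> s _; apply: integral_ge0 => x _; rewrite lee_fin.
- exact: (measurable_rect_inner mA mD mf).
- by move=> s _; apply: integral_ge0 => x _; rewrite lee_fin.
- exact: (measurable_rect_inner mA mD mg).
by rewrite lte_add_pinfty.
Qed.

Lemma space_time_L1N f : space_time_L1 f -> space_time_L1 (fun s x => - f s x).
Proof.
move=> [mf ff]; split.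
  rewrite (_ : (fun p => - f p.1 p.2) = (fun p => -1 * f p.1 p.2)).
    exact: measurable_funM.
  by apply/funext => p; rewrite mulN1r.
by under eq_integral do under eq_integral do rewrite normrN.
Qed.

Let tau_itv n i : (i <= 2 ^ n)%N ->
  (`[t0, tau n i]%classic : set R) `<=` A.
Proof.
move=> i_n s; rewrite /= !in_itv/= => /andP[-> st].
by rewrite (le_trans st)//= tau_le.
Qed.

(** On each cell the average of the end values of y differs from y by at most its oscillation, so
    the error is at most the modulus of continuity times the L^1 norm of b. [key] accumulates this
    bound cell by cell. *)
Lemma riemann_drift (y b : R -> R) : measurable_fun A y ->
  (exists B, forall s, A s -> `|y s| <= B) ->
  (forall e : R, 0 < e -> exists2 dlt : R, 0 < dlt & forall s s', A s -> A s' ->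
    `|s - s'| <= dlt -> `|y s - y s'| <= e) ->
  mu.-integrable A (EFin \o b) ->
  (fun n => \sum_(i < 2 ^ n) ((y (tau n i.+1) + y (tau n i)) / 2) *
    (\int[mu]_(s in `[t0, tau n i.+1]) b s - \int[mu]_(s in `[t0, tau n i]) b s))
  @ \oo --> \int[mu]_(s in A) (y s * b s).
Proof.
move=> my [B hB] uy ib; have mb := measurable_int _ ib.
have {}mb : measurable_fun A b by exact/measurable_EFinP.
have iyb : mu.-integrable A (EFin \o (fun s => y s * b s)).
  have iB : mu.-integrable A (fun s => (B%:E * (b s)%:E)%E) by exact: integrableZl.
  apply: (le_integrable mA _ _ iB) => //.
    by apply/measurable_EFinP; exact: measurable_funM.
  move=> s As /=; rewrite lee_fin !normrM ler_wpM2r//.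
  by apply: le_trans (ler_norm _); exact: hB.
have inb : mu.-integrable A (EFin \o (fun s => `|b s|)).
  by have := integrable_abse ib; apply: eq_integrable => // s _.
pose I (f : R -> R) n i := \int[mu]_(s in `[t0, tau n i]) f s.
have I0 (f : R -> R) n : I f n 0%N = 0 by rewrite /I tau0 set_itv1 Rintegral_set1.
have IS (f : R -> R) n i : mu.-integrable A (EFin \o f) -> (i < 2 ^ n)%N ->
    I f n i.+1 - I f n i = \int[mu]_(s in `]tau n i, tau n i.+1]) f s.
  move=> if_ i_n; rewrite /I Rintegral_itvB ?bnd_simp ?tau_ge//.
    by apply: integrableS if_ => //; exact: tau_itv.
  by rewrite tau_mono.
have sub n i : (i < 2 ^ n)%N -> `]tau n i, tau n i.+1]%classic `<=` A.
  move=> i_n s; rewrite /= !in_itv/= => /andP[is_ si].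
  by rewrite (le_trans (tau_ge t0t n i) (ltW is_))//= (le_trans si)// tau_le.
apply/cvgrPdist_le => e e0.
pose c := \int[mu]_(s in A) `|b s|.
have c0 : 0 <= c by apply: Rintegral_ge0.
have ec : 0 < e / (c + 1) by rewrite divr_gt0// ltr_wpDl.
have [dl dl0 hdl] := uy _ ec; have [N hN] := step_cvg0 t0t dl0.
exists N => // n /= Nn.
have key k : (k <= 2 ^ n)%N -> `|I (fun s => y s * b s) n k -
    \sum_(i < k) ((y (tau n i.+1) + y (tau n i)) / 2) * (I b n i.+1 - I b n i)| <=
    e / (c + 1) * I (fun s => `|b s|) n k.
  elim: k => [|k IH] kn; first by rewrite !I0 big_ord0 subrr normr0 mulr0.
  have {}IH := IH (ltnW kn); rewrite big_ord_recr /=.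
  have h1 := IS _ _ _ iyb kn; have h2 := IS _ _ _ ib kn; have h3 := IS _ _ _ inb kn.
  set m := _ / 2 in IH *; set J := `]tau n k, tau n k.+1]%classic in h1 h2 h3.
  have mJ : measurable (J : set (measurableTypeR R)) by exact: measurable_itv.
  have iJ (f : R -> R) : mu.-integrable A (EFin \o f) -> mu.-integrable J (EFin \o f).
    by move=> if_; apply: integrableS if_ => //; exact: sub.
  have im : mu.-integrable J (EFin \o (fun s => m * b s)).
    rewrite (_ : _ \o _ = fun s => (m%:E * (b s)%:E)%E)//.
    by apply: integrableZl => //; exact: iJ.
  have id : mu.-integrable J (EFin \o (fun s => y s * b s - m * b s)).
    rewrite (_ : _ \o _ = fun s => ((y s * b s)%:E - (m * b s)%:E)%E)//.
    by apply: integrableB => //; exact: iJ.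
  have : `|\int[mu]_(s in J) (y s * b s) - m * \int[mu]_(s in J) b s| <=
      e / (c + 1) * \int[mu]_(s in J) `|b s|.
    rewrite -RintegralZl//; last exact: iJ.
    rewrite -RintegralB//; last exact: iJ.
    apply: (le_trans (le_normr_Rintegral _ _)) => //.
    rewrite -RintegralZl//; last exact: iJ.
    apply: le_Rintegral => //.
    - have := integrable_abse id; apply: eq_integrable => // s _.
    - rewrite (_ : _ \o _ = fun s => ((e / (c + 1))%:E * `|b s|%:E)%E)//.
      by apply: integrableZl => //; exact: iJ.
    move=> s Js; rewrite -mulrBl normrM ler_wpM2r//.
    have As := sub _ _ kn _ Js.
    move: Js; rewrite /J /= in_itv/= => /andP[ks sk].
    have step : tau n k.+1 - tau n k <= dl.
      by rewrite tau_step; exact: hN.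
    have d1 : `|y s - y (tau n k.+1)| <= e / (c + 1).
      apply: hdl => //; first exact: tauA.
      by rewrite distrC ger0_norm ?subr_ge0//; lra.
    have d2 : `|y s - y (tau n k)| <= e / (c + 1).
      apply: hdl => //; first by apply: tauA; exact: ltnW.
      by have ks' := ltW ks; rewrite ger0_norm ?subr_ge0//; lra.
    move: d1 d2; rewrite /m !ler_norml => /andP[? ?] /andP[? ?].
    by apply/andP; split; lra.
  rewrite -h1 -h2 -h3 => hJ.
  rewrite [X in `|X|](_ : _ = (I (fun s => y s * b s) n k -
      \sum_(i < k) (y (tau n i.+1) + y (tau n i)) / 2 * (I b n i.+1 - I b n i)) +
      (I (fun s => y s * b s) n k.+1 - I (fun s => y s * b s) n k -
       m * (I b n k.+1 - I b n k))); last by ring.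
  apply: (le_trans (ler_normD _ _)).
  rewrite -[leRHS](_ : e / (c + 1) * I (fun s => `|b s|) n k + e / (c + 1) *
    (I (fun s => `|b s|) n k.+1 - I (fun s => `|b s|) n k) = _); last by ring.
  exact: lerD.
have := key (2 ^ n)%N (leqnn _); rewrite /I tau_last => /le_trans; apply.
rewrite -/c; apply: (@le_trans _ _ (e / (c + 1) * (c + 1))).
  by rewrite ler_pM2l// lerDl.
by rewrite divfK// gt_eqF// ltr_wpDl.
Qed.

End Drift.

(** * The linearized nonlinearity *)

Section Linearization.
Context {R : realType}.
Local Notation C := R[i].

(** With g the function [dPsi] of its first argument and r = |z|^2, the derivative is g(r) v + 2
    g'(r) <z, v> z, with <z, v> the real inner product of the plane. It is the Hessian of Psi(|z|^2)
    / 2 applied to v, hence symmetric. The coefficients do not depend on the direction v. *)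
Lemma dnonlinearityE (Psi : R -> R -> R -> R) (x t : R) (z : C) :
  derivable (fun r => dPsi Psi r x t) (complex.Re z ^+ 2 + complex.Im z ^+ 2) 1 ->
  exists a b : R, forall v,
    complex.Re (dnonlinearity Psi x t z v) = a * complex.Re v +
      b * (complex.Re z * complex.Re v + complex.Im z * complex.Im v) * complex.Re z /\
    complex.Im (dnonlinearity Psi x t z v) = a * complex.Im v +
      b * (complex.Re z * complex.Re v + complex.Im z * complex.Im v) * complex.Im z.
Proof.
case: z => zr zi /=; set r := _ + _; set g := (fun r => dPsi Psi r x t) => dg.
exists (g r), (2 * 'D_1 g r); case=> vr vi /=.
pose rho (h : R) := (zr + h * vr) ^+ 2 + (zi + h * vi) ^+ 2.
have lin (a b : R) : is_derive (0 : R) 1 (fun h : R => a + h * b) b.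
  apply: is_derive_eq; rewrite /GRing.scale /=; ring.
have drho : is_derive (0 : R) 1 rho (2 * (zr * vr + zi * vi)).
  have h1 := lin zr vr; have h2 := lin zi vi.
  apply: is_derive_eq; rewrite /= !mul0r !addr0 /GRing.scale /=; ring.
have rho0 : rho 0 = r by rewrite /rho !mul0r !addr0.
have dgr : is_derive (rho 0) 1 g ('D_1 g r) by rewrite rho0; exact/derivableP.
have dcomp := is_derive1_comp dgr drho.
have key (a b : R) : derive1 (fun h : R => (g \o rho) h * (a + h * b)) 0 =
    g r * b + 2 * 'D_1 g r * (zr * vr + zi * vi) * a.
  have h1 := lin a b; rewrite derive1E.
  have h : is_derive (0 : R) 1 (fun h : R => (g \o rho) h * (a + h * b))
      (g r * b + 2 * 'D_1 g r * (zr * vr + zi * vi) * a).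
    apply: is_derive_eq; rewrite /= rho0 mul0r addr0 /GRing.scale /=; ring.
  by rewrite derive_val.
split.
  rewrite -key; congr (derive1 _ 0); apply/funext => h /=.
  by rewrite /rho /g !mul0r !(subr0, addr0, add0r).
rewrite -key; congr (derive1 _ 0); apply/funext => h /=.
by rewrite /rho /g !mul0r !(subr0, addr0, add0r).
Qed.

End Linearization.

(** * Drift of the symplectic form along a path *)

Section PathwiseDrift.
Context {R : realType}.
Variables (L t0 t : R).
Hypothesis L0 : 0 < L.
Hypothesis t0t : t0 < t.
Local Notation mu := (@lebesgue_measure R).
Local Notation D := (dom L).
Local Notation A := (`[t0, t]%classic : set R).
Local Notation tau := (tau t0 t).
Local Notation path_coef := (path_coef L t0 t).
Local Notation space_time_L1 := (space_time_L1 L t0 t).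
Implicit Types (P Q a c : R -> R -> R).

Let mA : measurable (A : set (measurableTypeR R)).
Proof. exact: measurable_itv. Qed.

Let mD : measurable (D : set (measurableTypeR R)) := measurable_dom L.

Lemma bounded_inU (u : R -> R) (B : R) : measurable_fun D u ->
  (forall x, D x -> `|u x| <= B) -> inU L u.
Proof.
move=> mu_ hB; split => //; apply: poweR_lty.
apply: (@le_lt_trans _ _ (\int[mu]_(x in D) (B ^+ 2)%:E)%E).
  apply: (ge0_le_integral mu mD) => //.
  - by apply/measurable_EFinP; apply: measurable_funX; exact: measurableT_comp.
  move=> x Dx; rewrite lee_fin lerXn2r ?nnegrE//; last exact: hB.
  exact: le_trans (hB x Dx).
by rewrite int_dom_cst// ltry.
Qed.

Lemma path_coef_inU P s : path_coef P -> A s -> inU L (P s).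
Proof.
move=> [mP [B hB] _] As; apply: (bounded_inU (B := B)); first exact: mP.
by move=> x; exact: hB.
Qed.

(** With N the L^2 norm, |u| <= (|u|^2 + (N + 1)^2) / (2 (N + 1)) is integrated over an interval of
    length 2L. Using N + 1 rather than N keeps the denominator positive. *)
Lemma Lpnorm_L1 (u : R -> R) : measurable_fun D u ->
  (\int[mu]_(x in D) `|u x|%:E <= (L + 1)%:E * Lpnorm L 2 u + L%:E)%E.
Proof.
have L00 := L0; move=> mu_.
rewrite /Lpnorm; set V := (\int[mu]_(x in D) (`|u x| ^+ 2)%:E)%E.
have V0 : (0 <= V)%E by apply: integral_ge0 => x _; rewrite lee_fin exprn_ge0.
have m2 : measurable_fun D (fun x => (`|u x| ^+ 2)%:E).
  by apply/measurable_EFinP; apply: measurable_funX; exact: measurableT_comp.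
have [->|Vy] := eqVneq V +oo%E.
  rewrite poweRyr ?invr_eq0 ?pnatr_eq0// gt0_muley ?lte_fin; last by lra.
  by rewrite addye// leey.
pose v := fine V; have VE : V = v%:E by rewrite fineK// ge0_fin_numE// ltey.
have v0 : 0 <= v by exact: fine_ge0.
rewrite {1}VE poweR_EFin -EFinM -EFinD.
set N := v `^ _; have N0 : 0 <= N by exact: powR_ge0.
have NN : N * N = v.
  rewrite /N -powRD; last by rewrite implybE; apply/orP; left; apply/eqP; lra.
  by rewrite (_ : 2%:R^-1 + 2%:R^-1 = 1 :> R) ?powRr1//; lra.
pose e1 := (2 * (N + 1))^-1; pose e2 := (N + 1) / 2.
have e10 : 0 <= e1 by rewrite invr_ge0; lra.
have e20 : 0 <= e2 by rewrite /e2; lra.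
apply: (@le_trans _ _ (\int[mu]_(x in D) (e1%:E * (`|u x| ^+ 2)%:E + e2%:E))%E).
  apply: (ge0_le_integral mu mD) => //.
  - by apply/measurable_EFinP; exact: measurableT_comp.
  - by apply: emeasurable_funD => //; exact: measurable_funeM.
  move=> x _; rewrite -EFinM -EFinD lee_fin /e1 /e2.
  have n0 : 0 < N + 1 by lra.
  rewrite (_ : _ + _ = (`|u x| ^+ 2 + (N + 1) ^+ 2) / (2 * (N + 1))); last first.
    by field; rewrite gt_eqF.
  rewrite ler_pdivlMr ?mulr_gt0//.
  by have := sqr_ge0 (`|u x| - (N + 1)); nra.
rewrite ge0_integralD//; last 2 first.
- by move=> x _; rewrite -EFinM lee_fin mulr_ge0// exprn_ge0.
- exact: measurable_funeM.
rewrite ge0_integralZl_EFin// -/V VE int_dom_cst// -EFinM -EFinD lee_fin.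
have : e1 * v <= N / 2.
  rewrite /e1 mulrC ler_pdivrMr; last by lra.
  by rewrite -NN; nra.
by rewrite /e2; nra.
Qed.

(** A sum of squares is at most the square of the sum of absolute values, and the increments of a
    primitive of b are dominated by those of a primitive of |b|, which telescope. *)
Lemma drift_sqr (b : R -> R) n : mu.-integrable A (EFin \o b) ->
  \sum_(i < 2 ^ n) (\int[mu]_(s in `[t0, tau n i.+1]) b s -
                    \int[mu]_(s in `[t0, tau n i]) b s) ^+ 2 <=
  (\int[mu]_(s in A) `|b s|) ^+ 2.
Proof.
move=> ib.
have inb : mu.-integrable A (EFin \o (fun s => `|b s|)).
  by have := integrable_abse ib; apply: eq_integrable => // s _.
pose I (f : R -> R) i := \int[mu]_(s in `[t0, tau n i]) f s.
have sub i : (i <= 2 ^ n)%N -> (`[t0, tau n i]%classic : set R) `<=` A.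
  move=> i_n s; rewrite /= !in_itv/= => /andP[-> st].
  by rewrite (le_trans st)//= tau_le.
have sub' i : (i < 2 ^ n)%N -> `]tau n i, tau n i.+1]%classic `<=` A.
  move=> i_n s; rewrite /= !in_itv/= => /andP[is_ si].
  by rewrite (le_trans (tau_ge t0t n i) (ltW is_))//= (le_trans si)// tau_le.
have IS (f : R -> R) i : mu.-integrable A (EFin \o f) -> (i < 2 ^ n)%N ->
    I f i.+1 - I f i = \int[mu]_(s in `]tau n i, tau n i.+1]) f s.
  move=> if_ i_n; rewrite /I Rintegral_itvB ?bnd_simp ?tau_ge//.
    by apply: integrableS if_ => //; exact: sub.
  by rewrite tau_mono.
have le1 i : (i < 2 ^ n)%N -> `|I b i.+1 - I b i| <=
    I (fun s => `|b s|) i.+1 - I (fun s => `|b s|) i.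
  move=> i_n; rewrite !IS//; apply: le_normr_Rintegral => //.
  by apply: integrableS ib => //; exact: sub'.
have S1 : \sum_(i < 2 ^ n) `|I b i.+1 - I b i| <= \int[mu]_(s in A) `|b s|.
  apply: (@le_trans _ _ (\sum_(i < 2 ^ n)
      (I (fun s => `|b s|) i.+1 - I (fun s => `|b s|) i))).
    by apply: ler_sum => i _; exact: le1.
  rewrite -(big_mkord xpredT (fun i => I (fun s => `|b s|) i.+1 - I (fun s => `|b s|) i)).
  by rewrite telescope_sumr// /I tau_last// tau0 set_itv1 Rintegral_set1 subr0.
have S0 : 0 <= \sum_(i < 2 ^ n) `|I b i.+1 - I b i| by exact: sumr_ge0.
apply: (@le_trans _ _ ((\sum_(i < 2 ^ n) `|I b i.+1 - I b i|) ^+ 2)); last first.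
  by rewrite lerXn2r ?nnegrE// (le_trans S0).
rewrite [leRHS]expr2 mulr_sumr; apply: ler_sum => i _.
rewrite -real_normK ?num_real// expr2 ler_wpM2r//.
by rewrite (bigD1 i)//= lerDl; exact: sumr_ge0.
Qed.

Variables P1 Q1 P2 Q2 a1 c1 a2 c2 : R -> R -> R.
Hypothesis (pP1 : path_coef P1) (pQ1 : path_coef Q1).
Hypothesis (pP2 : path_coef P2) (pQ2 : path_coef Q2).
Hypothesis (ia1 : space_time_L1 a1) (ic1 : space_time_L1 c1).
Hypothesis (ia2 : space_time_L1 a2) (ic2 : space_time_L1 c2).

(** The drift of P1 Q2 - P2 Q1 when the noise is dropped, that is, when dQ_i = a_i dt and dP_i = -
    c_i dt; these signs come from the factor i in front of dpsi. *)
Definition drift_density s x : R :=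
  P1 s x * a2 s x - P2 s x * a1 s x + Q1 s x * c2 s x - Q2 s x * c1 s x.

Definition drift_incr (b : R -> R -> R) n i x : R :=
  \int[mu]_(s in `[t0, tau n i.+1]) b s x - \int[mu]_(s in `[t0, tau n i]) b s x.

Definition drift_sum n x : R := \sum_(i < 2 ^ n)
  ((P1 (tau n i.+1) x + P1 (tau n i) x) / 2 * drift_incr a2 n i x -
   (P2 (tau n i.+1) x + P2 (tau n i) x) / 2 * drift_incr a1 n i x +
   (Q1 (tau n i.+1) x + Q1 (tau n i) x) / 2 * drift_incr c2 n i x -
   (Q2 (tau n i.+1) x + Q2 (tau n i) x) / 2 * drift_incr c1 n i x).

Lemma drift_section b : space_time_L1 b ->
  {ae mu, forall x, D x -> mu.-integrable A (EFin \o (b ^~ x))}.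
Proof. by move=> [mb fb]; exact: rect_section_integrable. Qed.

Lemma drift_sum_cvg : {ae mu, forall x, D x ->
  (fun n => drift_sum n x) @ \oo --> \int[mu]_(s in A) drift_density s x}.
Proof.
have pair P b : path_coef P -> space_time_L1 b -> {ae mu, forall x, D x ->
    mu.-integrable A (EFin \o (fun s => P s x * b s x)) /\
    (fun n => \sum_(i < 2 ^ n) (P (tau n i.+1) x + P (tau n i) x) / 2 *
      drift_incr b n i x) @ \oo --> \int[mu]_(s in A) (P s x * b s x)}.
  move=> pP ib; have := drift_section ib; have := drift_section (path_coef_mul t0t pP ib).
  apply: aeS2 => x h1 h2 Dx; split; first exact: h1.
  have [_ [B hB] uP] := pP.
  apply: riemann_drift => //; last exact: h2.
  - have mP := path_coef_measurable t0t pP.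
    exact: (measurable_rect_section2 mA mD mP).
  - by exists B => s As; exact: hB.
  - move=> e /uP[dl dl0 hdl]; exists dl => // s s' As As'; exact: hdl.
have k1 := pair _ _ pP1 ia2; have k2 := pair _ _ pP2 ia1.
have k3 := pair _ _ pQ1 ic2; have k4 := pair _ _ pQ2 ic1.
move: (aeS2 (fun x p q => conj p q) k1 k2) (aeS2 (fun x p q => conj p q) k3 k4).
apply: aeS2 => x [h1 h2] [h3 h4] Dx.
have [i1 {}h1] := h1 Dx; have [i2 {}h2] := h2 Dx.
have [i3 {}h3] := h3 Dx; have [i4 {}h4] := h4 Dx.
have i12 : mu.-integrable A (EFin \o (fun s => P1 s x * a2 s x - P2 s x * a1 s x)).
  by rewrite (_ : _ \o _ = (fun s => (P1 s x * a2 s x)%:E - (P2 s x * a1 s x)%:E)%E)//;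
    exact: integrableB.
have i123 : mu.-integrable A (EFin \o (fun s => P1 s x * a2 s x - P2 s x * a1 s x +
    Q1 s x * c2 s x)).
  rewrite (_ : _ \o _ = (fun s => (P1 s x * a2 s x - P2 s x * a1 s x)%:E +
    (Q1 s x * c2 s x)%:E)%E)//.
  exact: integrableD.
rewrite RintegralB// RintegralD// RintegralB//.
rewrite (_ : (fun n => drift_sum n x) = (fun n =>
  \sum_(i < 2 ^ n) (P1 (tau n i.+1) x + P1 (tau n i) x) / 2 * drift_incr a2 n i x -
  \sum_(i < 2 ^ n) (P2 (tau n i.+1) x + P2 (tau n i) x) / 2 * drift_incr a1 n i x +
  \sum_(i < 2 ^ n) (Q1 (tau n i.+1) x + Q1 (tau n i) x) / 2 * drift_incr c2 n i x -
  \sum_(i < 2 ^ n) (Q2 (tau n i.+1) x + Q2 (tau n i) x) / 2 * drift_incr c1 n i x)).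
  by apply: cvgB => //; apply: cvgD => //; exact: cvgB.
by apply/funext => n; rewrite -sumrB -big_split -sumrB.
Qed.

Lemma space_time_L1_density : space_time_L1 drift_density.
Proof.
have h1 := path_coef_mul t0t pP1 ia2; have h2 := path_coef_mul t0t pP2 ia1.
have h3 := path_coef_mul t0t pQ1 ic2; have h4 := path_coef_mul t0t pQ2 ic1.
apply: (space_time_L1D (g := fun s x => - (Q2 s x * c1 s x))); last exact: space_time_L1N.
apply: space_time_L1D h3.
by apply: (space_time_L1D (g := fun s x => - (P2 s x * a1 s x))); last exact: space_time_L1N.
Qed.

Lemma drift_density_integral :
  {ae mu, forall s, A s -> \int[mu]_(x in D) drift_density s x = 0} ->
  \int[mu]_(x in D) (\int[mu]_(s in A) drift_density s x) = 0.
Proof.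
move=> z; have [mf ff] := space_time_L1_density.
rewrite (rect_Fubini mA mD mf ff).
have if_ := rect_integrable1 mA mD mf ff.
transitivity (fine (\int[mu]_(s in A) (cst 0%E s))%E); last by rewrite integral0.
congr fine; apply: ae_eq_integral => //; first exact: measurable_int if_.
by move: z; apply: aeS => s hs As; rewrite /= hs.
Qed.

(** The formula assumed for [drift_density] expresses that the zeroth-order terms have already
    cancelled. Symmetry of the Laplacian cancels the remaining terms in pairs, P1 against P2 and Q1
    against Q2. *)
Lemma drift_density_zero Apsi1 Apsi2 B1 B2 :
  {ae mu, forall s, A s -> [/\ dirichlet_laplacian L (P1 s) (Apsi1 s),
    dirichlet_laplacian L (P2 s) (Apsi2 s), dirichlet_laplacian L (Q1 s) (B1 s) &
    dirichlet_laplacian L (Q2 s) (B2 s)]} ->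
  (forall s x, A s -> D x -> drift_density s x =
    P1 s x * Apsi2 s x - P2 s x * Apsi1 s x + Q1 s x * B2 s x - Q2 s x * B1 s x) ->
  {ae mu, forall s, A s -> \int[mu]_(x in D) drift_density s x = 0}.
Proof.
move=> lap dE; move: lap; apply: aeS => s /[swap] As /(_ As)[l1 l2 l3 l4].
have inP P : path_coef P -> inU L (P s) by move=> pP; exact: path_coef_inU.
have v1 : inU L (Apsi1 s) by have [] := l1.
have v2 : inU L (Apsi2 s) by have [] := l2.
have v3 : inU L (B1 s) by have [] := l3.
have v4 : inU L (B2 s) by have [] := l4.
have i1 := inU_integrableM (inP _ pP1) v2; have i2 := inU_integrableM (inP _ pP2) v1.
have i3 := inU_integrableM (inP _ pQ1) v4; have i4 := inU_integrableM (inP _ pQ2) v3.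
transitivity (\int[mu]_(x in D) (P1 s x * Apsi2 s x - P2 s x * Apsi1 s x +
    Q1 s x * B2 s x - Q2 s x * B1 s x)).
  by apply: eq_Rintegral => x; rewrite inE => Dx; exact: dE.
have i12 : mu.-integrable D (EFin \o (fun x => P1 s x * Apsi2 s x - P2 s x * Apsi1 s x)).
  by rewrite (_ : _ \o _ = (fun x => (P1 s x * Apsi2 s x)%:E -
    (P2 s x * Apsi1 s x)%:E)%E)//; exact: integrableB.
have i123 : mu.-integrable D (EFin \o (fun x => P1 s x * Apsi2 s x -
    P2 s x * Apsi1 s x + Q1 s x * B2 s x)).
  rewrite (_ : _ \o _ = (fun x => (P1 s x * Apsi2 s x - P2 s x * Apsi1 s x)%:E +
    (Q1 s x * B2 s x)%:E)%E)//.
  exact: integrableD.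
rewrite RintegralB// RintegralD// RintegralB//.
by rewrite (dirichlet_laplacian_sym L0 l1 l2) (dirichlet_laplacian_sym L0 l3 l4); ring.
Qed.

End PathwiseDrift.

(** * Pointwise limits of sequences vanishing in measure, and drifts of random fields *)

Section MeasureLimit.
Context {R : realType} {d : measure_display} {Omega : measurableType d}.
Variables (Pr : probability Omega R) (L t0 T : R).
Hypothesis L0 : 0 < L.
Local Notation mu := (@lebesgue_measure R).
Local Notation D := (dom L).
Local Notation rfun := (Omega -> R -> R).
Local Notation mea := (@mea R d Omega L).
Local Notation AE2 := (@AE2 R d Omega Pr L).
Local Notation kap := (@kap R d Omega Pr L).

(** In the application [f] contains a pathwise time integral, whose joint measurability is not
    established. The upper limit of the sequence is measurable and coincides with [f] wherever the
    sequence converges. *)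
Lemma kap_pointwise_lim (f_ : nat -> rfun) f : (forall n, mea (f_ n)) ->
  AE2 (fun w x => f_ n w x @[n --> \oo] --> f w x) ->
  to0 (fun n => kap (f_ n)) -> AE2 (fun w x => f w x = 0).
Proof.
move=> mf cv k0.
pose g : rfun := fun w x => fine (limn_esup (fun n => (f_ n w x)%:E)).
have mg : mea g.
  apply: (measurableT_comp (@fine_measurable R setT measurableT)).
  by apply: measurable_fun_limn_esup => n; apply/measurable_EFinP; exact: mf.
have fg w x : f_ n w x @[n --> \oo] --> f w x -> g w x = f w x.
  move=> h; have h' : (fun n => (f_ n w x)%:E) @ \oo --> (f w x)%:E.
    by apply/fine_cvgP; split; [exact: nearW|exact: h].
  by rewrite /g limn_esup_lim; have /cvg_lim -> := cvg_esups h'.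
have : AE2 (fun w x => g w x = 0).
  apply: (kap_cvg L0 mf mg _ k0); move: cv; apply: AE2S => w x _ h.
  by rewrite fg.
have : AE2 (fun w x => g w x = 0 /\ f_ n w x @[n --> \oo] --> f w x) -> AE2 (fun w x => f w x = 0).
  by apply: AE2S => w x _ [<- /fg ->].
by move=> h1 h2; apply: h1; exact: AE2I.
Qed.

(** Drifts come with a spatial L^2 norm that is integrable in time; [Lpnorm_L1] turns this into
    integrability over space-time, path by path, as Fubini requires. *)
Lemma integrable_field_L1 t (b : @field R d Omega R) : t <= T ->
  integrable_field Pr L t0 T b ->
  {ae Pr, forall w, space_time_L1 L t0 t (fun s => b s w)}.
Proof.
move=> tT [mb]; apply: aeS => w fb.
have sub : `[t0, t]%classic `<=` (`[t0, T]%classic : set R).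
  by move=> s; rewrite /= !in_itv/= => /andP[-> st]; rewrite (le_trans st).
have mB : measurable_fun (`[t0, T]%classic `*` D)
    (fun p : (measurableTypeR R * measurableTypeR R)%type => b p.1 w p.2).
  apply: (measurable_comp (F := `[t0, T] `*` setT `*` D) (g :=
    fun p : (measurableTypeR R * measurableTypeR R)%type => ((p.1, w), p.2)) _ _ mb).
  - apply: measurableX; last exact: measurable_dom.
    by apply: measurableX => //; exact: measurable_itv.
  - by move=> _ [[s x] [/= As Dx] <-].
  apply: measurable_funTS; apply/measurable_fun_pairP; split => /=.
    by apply/measurable_fun_pairP; split => /=; [exact: measurable_fst|exact: measurable_cst].
  exact: measurable_snd.
have mD := measurable_dom L.
have mA u : measurable (`[t0, u]%classic : set (measurableTypeR R)) by exact: measurable_itv.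
have mB2 : measurable_fun (`[t0, T]%classic `*` D)
    (fun p : (measurableTypeR R * measurableTypeR R)%type => b p.1 w p.2 ^+ 2).
  exact: measurable_funX.
have mI := @measurable_rect_inner _ `[t0, T]%classic D (fun s => b s w) (mA T) mD mB.
split.
  by apply: measurable_funS mB => //; [exact: measurableX|move=> [s x] [/= /sub]].
apply: (@le_lt_trans _ _ (\int[mu]_(s in `[t0, T]) \int[mu]_(x in D) `|b s w x|%:E)%E).
  apply: ge0_subset_integral => //.
  by move=> s _; apply: integral_ge0 => x _; rewrite lee_fin.
have mN : measurable_fun `[t0, T]%classic (fun s => Lpnorm L 2 (b s w)).
  rewrite /Lpnorm; apply: (measurableT_comp (measurable_poweR _)).
  have := @measurable_rect_inner _ `[t0, T]%classic D (fun s x => b s w x ^+ 2) (mA T) mD mB2.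
  congr (measurable_fun _ _); apply/funext => s; apply: eq_integral => x _.
  by rewrite normrX.
have N0 s : (0 <= Lpnorm L 2 (b s w))%E by exact: poweR_ge0.
have L1 : 0 <= L + 1 by rewrite addr_ge0// ltW.
apply: (@le_lt_trans _ _
  (\int[mu]_(s in `[t0, T]) ((L + 1)%:E * Lpnorm L 2 (b s w) + L%:E))%E).
  apply: ge0_le_integral => //.
  - by move=> s _; apply: integral_ge0 => x _; rewrite lee_fin.
  - by apply: emeasurable_funD => //; exact: measurable_funeM.
  move=> s As; apply: Lpnorm_L1 => //.
  exact: (@measurable_rect_section _ `[t0, T]%classic D (fun s => b s w) (mA T) mD mB s As).
rewrite ge0_integralD//; last 3 first.
- by move=> s _; rewrite mule_ge0// lee_fin.
- exact: measurable_funeM.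
- by move=> s _; rewrite lee_fin ltW.
rewrite ge0_integralZl_EFin//.
apply: lte_add_pinfty; first by rewrite lte_mul_pinfty// lee_fin.
have -> : (\int[mu]_(s in `[t0, T]) L%:E = L%:E * mu `[t0, T]%classic)%E.
  exact: integral_cst.
rewrite lebesgue_measure_itv; case: ifP => _; rewrite ?mule0//.
by rewrite -EFinB -EFinM ltry.
Qed.

End MeasureLimit.

(** * Stratonovich sums *)

Section SumTools.
Context {R : realType} {d : measure_display} {Omega : measurableType d}.
Variables (Pr : probability Omega R) (L : R).
Hypothesis L0 : 0 < L.
Local Notation D := (dom L).
Local Notation rfun := (Omega -> R -> R).
Local Notation mea := (@mea R d Omega L).
Local Notation pos := (@pos R d Omega L).
Local Notation II := (@II R d Omega Pr L).
Local Notation AE2 := (@AE2 R d Omega Pr L).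
Local Notation kap := (@kap R d Omega Pr L).

Lemma mea_sumo n (F : 'I_n -> rfun) : (forall i, mea (F i)) ->
  mea (fun w x => \sum_(i < n) F i w x).
Proof. by move=> mF; apply: measurable_sum => i; exact: mF. Qed.

Lemma II_sum_le n (f g : nat -> rfun) : (forall i, (i < n)%N ->
    [/\ mea (f i), mea (g i), pos (f i), pos (g i) & (II (f i) <= II (g i))%E]) ->
  (II (fun w x => \sum_(i < n) f i w x)%R <= II (fun w x => \sum_(i < n) g i w x)%R)%E.
Proof.
elim: n => [|n IH] h.
  rewrite (_ : (fun w x => \sum_(i < 0) f i w x) =
    (fun w x => \sum_(i < 0) g i w x))//.
  by apply/funext => w; apply/funext => x; rewrite !big_ord0.
have recr (k : nat -> rfun) : (fun w x => \sum_(i < n.+1) k i w x) =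
    (fun w x => \sum_(i < n) k i w x + k n w x).
  by apply/funext => w; apply/funext => x; rewrite big_ord_recr.
have [mf mg f0 g0 fg] := h n (leqnn _).
have hn i (i_n : (i < n)%N) := h i (ltnW i_n : (i < n.+1)%N).
rewrite !recr II_D//; last 2 first.
- by apply: mea_sum => i /hn[].
- by move=> w x Dx; apply: sumr_ge0 => i _; have [_ _ + _ _] := hn _ (ltn_ord i); apply.
rewrite II_D//; last 2 first.
- by apply: mea_sum => i /hn[].
- by move=> w x Dx; apply: sumr_ge0 => i _; have [_ _ _ + _] := hn _ (ltn_ord i); apply.
by apply: leeD; [exact: IH|exact: fg].
Qed.

Lemma to0_sum n (X : nat -> nat -> rfun) :
  (forall i l, (i < n)%N -> mea (X i l)) ->
  (forall i, (i < n)%N -> to0 (fun l => kap (X i l))) ->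
  to0 (fun l => kap (fun w x => \sum_(i < n) X i l w x)).
Proof.
elim: n => [|n IH] mX hX e e0.
  exists 0%N => l _; apply: le_trans (ltW e0).
  have := @kap_sum _ _ _ Pr L L0 0 (fun i => X i l) (fun i i0 => mX i l i0).
  by rewrite big_ord0.
have e2 : 0 < e / 2 by lra.
have [i l i_n|i i_n|N1 H1] := IH _ _ _ e2; [by apply: mX; exact: ltnW|
  by apply: hX; exact: ltnW|].
have [N2 H2] := hX n (leqnn _) _ e2.
exists (maxn N1 N2) => l; rewrite geq_max => /andP[/H1 {}H1 /H2 {}H2].
have -> : (fun w x => \sum_(i < n.+1) X i l w x) =
    (fun w x => \sum_(i < n) X i l w x + X n l w x).
  by apply/funext => w; apply/funext => x; rewrite big_ord_recr.
have mS : mea (fun w x => \sum_(i < n) X i l w x).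
  by apply: (mea_sum (F := fun i => X i l)) => i i_n; apply: mX; exact: ltnW.
apply: (@le_trans _ _ (kap (fun w x => \sum_(i < n) X i l w x) + kap (X n l))).
  apply: kap_add => //; [apply: meaD => //; exact: mX|exact: mX|].
  by apply: AE2T => w x _; exact: ler_normD.
by lra.
Qed.

Lemma tight_const (f : rfun) : mea f -> tight Pr L (fun _ => f).
Proof.
move=> mf; apply: tight_bdd => //.
by apply: AE2T => w x _; exists `|f w x|.
Qed.

Lemma cvg0_of (u : nat -> R) : (forall e : R, 0 < e -> exists N, forall n,
  (N <= n)%N -> `|u n| <= e) -> u n @[n --> \oo] --> 0.
Proof.
move=> h; apply/cvgrPdist_le => e e0; have [N hN] := h e e0.
exists N => // n /= Nn; rewrite sub0r normrN; exact: hN.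
Qed.

Definition clip (M z : R) : R := Num.max (- M) (Num.min M z).

Lemma clip_id M z : `|z| <= M -> clip M z = z.
Proof.
rewrite ler_norml => /andP[h1 h2].
by rewrite /clip (min_idPr h2); apply/max_idPr.
Qed.

Lemma clip_le M z : 0 <= M -> `|clip M z| <= M.
Proof.
move=> M0; rewrite ler_norml /clip le_max lexx /= ge_max ge_min lexx /= andbT.
by lra.
Qed.

Lemma min_lip (c a b : R) : `|Num.min c a - Num.min c b| <= `|a - b|.
Proof.
have h1 : a - b <= `|a - b| := ler_norm _.
have h2 : b - a <= `|a - b| by rewrite distrC; exact: ler_norm.
by rewrite ler_norml; case: (leP c a); case: (leP c b) => *; apply/andP; split; lra.
Qed.

Lemma max_lip (c a b : R) : `|Num.max c a - Num.max c b| <= `|a - b|.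
Proof.
have h1 : a - b <= `|a - b| := ler_norm _.
have h2 : b - a <= `|a - b| by rewrite distrC; exact: ler_norm.
by rewrite ler_norml; case: (leP c a); case: (leP c b) => *; apply/andP; split; lra.
Qed.

Lemma clip_lip (M a b : R) : `|clip M a - clip M b| <= `|a - b|.
Proof. by apply: (le_trans (max_lip _ _ _)); exact: min_lip. Qed.

Lemma mea_clip M (f : rfun) : mea f -> mea (fun w x => clip M (f w x)).
Proof.
move=> mf; apply: mea_max; first exact: mea_const.
by apply: mea_min => //; exact: mea_const.
Qed.

End SumTools.

(** * Riemann sums on dyadic grids *)

Section RiemannSums.
Context {R : realType} {d : measure_display} {Omega : measurableType d}.
Variables (Pr : probability Omega R) (L r0 t0 t T : R).
Variables (F : R -> set (set Omega)) (W : @field R d Omega R) (q : R -> R).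
Local Notation mu := (@lebesgue_measure R).
Local Notation D := (dom L).
Local Notation rfun := (Omega -> R -> R).
Local Notation field := (@field R d Omega R).
Local Notation mea := (@mea R d Omega L).
Local Notation pos := (@pos R d Omega L).
Local Notation II := (@II R d Omega Pr L).
Local Notation AE2 := (@AE2 R d Omega Pr L).
Local Notation kap := (@kap R d Omega Pr L).
Local Notation tight := (@tight R d Omega Pr L).
Local Notation adp := (@adp R d Omega r0 T F).
Local Notation tau := (tau t0 t).
Hypothesis L0 : 0 < L.
Hypothesis r0t0 : r0 <= t0.
Hypothesis t0t : t0 < t.
Hypothesis tT : t <= T.
Hypothesis filtF : filtration r0 T F.
Hypothesis mq : measurable_fun D q.
Hypothesis iq : mu.-integrable D (EFin \o q).
Hypothesis q0 : forall x, 0 <= q x.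
Hypothesis mW : forall s, t0 <= s -> s <= t -> mea (W s).
(** The Ito isometry with [x] as a parameter, [q] standing for the pointwise variance. Together with
    measurability it is all that this section knows of the noise. *)
Hypothesis isoW : forall N (u : nat -> R) (H : nat -> rfun) (K : R),
  (forall j, (j < N)%N -> [/\ r0 <= u j, u j <= u j.+1 & u j.+1 <= T]) ->
  (forall j, (j < N)%N -> mea (H j)) ->
  (forall j x, (j < N)%N -> D x -> adp (u j) (H j ^~ x)) ->
  (forall j w x, (j < N)%N -> D x -> `|H j w x| <= K) ->
  (II (fun w x => (\sum_(j < N) H j w x * (W (u j.+1) w x - W (u j) w x)) ^+ 2)%R <=
   II (fun w x => 12 * (q x * \sum_(j < N) (u j.+1 - u j) * H j w x ^+ 2))%R)%E.
Implicit Types (Y Z J C S : field).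

Definition tmea Y := forall s, t0 <= s -> s <= t -> mea (Y s).

Definition tadp Y := forall s x, t0 <= s -> s <= t -> D x -> adp s (Y s ^~ x).

Definition tbnd Y := {ae Pr, forall w, exists B, forall s x,
  t0 <= s -> s <= t -> D x -> `|Y s w x| <= B}.

Definition tuc Y := {ae Pr, forall w, forall e : R, 0 < e -> exists2 dlt : R, 0 < dlt &
  forall s s' x, t0 <= s -> s <= t -> t0 <= s' -> s' <= t -> D x ->
    `|s - s'| <= dlt -> `|Y s w x - Y s' w x| <= e}.

Definition nice Y := [/\ tmea Y, tadp Y, tbnd Y & tuc Y].

Definition dl Y n i : rfun := fun w x => Y (tau n i.+1) w x - Y (tau n i) w x.

Definition mid Y n i : rfun := fun w x => (Y (tau n i.+1) w x + Y (tau n i) w x) / 2.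

Lemma tmea_tau Y n i : tmea Y -> (i <= 2 ^ n)%N -> mea (Y (tau n i)).
Proof. by move=> mY i_n; apply: mY; [exact: tau_ge|exact: tau_le]. Qed.

Lemma mea_dl Y n i : tmea Y -> (i < 2 ^ n)%N -> mea (dl Y n i).
Proof. by move=> mY i_n; apply: meaB; apply: tmea_tau => //; exact: ltnW. Qed.

Lemma mea_mid Y n i : tmea Y -> (i < 2 ^ n)%N -> mea (mid Y n i).
Proof.
move=> mY i_n; apply: meaM; last exact: mea_const.
by apply: meaD; apply: tmea_tau => //; exact: ltnW.
Qed.

Lemma blk n l i j : (i < 2 ^ n)%N -> (j < 2 ^ l)%N -> (i * 2 ^ l + j < 2 ^ (n + l))%N.
Proof.
move=> i_n jl; rewrite expnD.
apply: (@leq_trans (i.+1 * 2 ^ l)); last by rewrite leq_mul2r i_n orbT.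
by rewrite mulSn addnC ltn_add2r.
Qed.

Lemma low_le n l k : (k < 2 ^ (n + l))%N -> (k %/ 2 ^ l < 2 ^ n)%N.
Proof. by rewrite ltn_divLR ?expn_gt0// -expnD. Qed.

(** The left end of the coarse cell precedes the fine time, so the value taken there is already
    known. *)
Lemma tadp_low Y n l k x : tadp Y -> (k < 2 ^ (n + l))%N -> D x ->
  adp (tau (n + l) k) (Y (tau n (k %/ 2 ^ l)) ^~ x).
Proof.
move=> aY kn Dx; have kl := low_le kn.
apply: (adp_le filtF (s := tau n (k %/ 2 ^ l))).
- by apply: aY => //; [exact: tau_ge|apply: tau_le => //; exact: ltnW].
- exact: tau_low.
- by apply: le_trans tT; apply: tau_le => //; exact: ltnW.
Qed.

Lemma adp_clip s M (X : Omega -> R) : adp s X -> adp s (fun w => clip M (X w)).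
Proof.
move=> aX; have [rs [sT _]] := aX; apply: (adp_max filtF).
  exact: (adp_cst filtF).
by apply: (adp_min filtF) => //; exact: (adp_cst filtF).
Qed.

(** [isoW] with one cell and integrand 1 bounds the second moment of each increment at [x] by 12
    q(x) times the length of the cell. The lengths add up to t - t0, which gives an L^1 bound
    independent of the level. *)
Lemma tight_dlW2 : tight (fun n w x => \sum_(i < 2 ^ n) dl W n i w x ^+ 2).
Proof.
have m1 : mea (fun _ x => 12 * (q x * (t - t0))).
  apply: meaM; first exact: mea_const.
  by apply: meaM; [exact: (mea_cst mq)|exact: mea_const].
have fin : exists C : R, (II (fun _ x => 12 * (q x * (t - t0)))%R <= C%:E)%E.
  exists (fine (II (fun _ x => 12 * (q x * (t - t0))))).
  rewrite fineK// II_cst; last first.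
    by apply: measurable_funM => //; exact: measurable_funM.
  apply: integrable_fin_num; first exact: measurable_dom.
  rewrite (_ : (fun x => _) = (fun x => (12 * (t - t0))%:E * (q x)%:E)%E); last first.
    by apply/funext => x; rewrite -EFinM; congr EFin; ring.
  by apply: integrableZl => //; exact: measurable_dom.
have [C hC] := fin.
have mdl2 n i : (i < 2 ^ n)%N -> mea (fun w x => dl W n i w x ^+ 2).
  by move=> i_n; apply: meaX; apply: mea_dl.
apply: (@tight_L1 _ _ _ Pr L L0 _ C).
- by move=> n; apply: (mea_sum (F := fun i w x => dl W n i w x ^+ 2)); exact: mdl2.
move=> n; apply: le_trans hC.
have tn i : 0 <= tau n i.+1 - tau n i by rewrite subr_ge0 tau_mono.
apply: (@le_trans _ _ (II (fun w x => \sum_(i < 2 ^ n)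
    (12 * (q x * (tau n i.+1 - tau n i))))%R)); last first.
  apply: II_le => //.
  - apply: mea_sumo => i; apply: meaM; first exact: mea_const.
    by apply: meaM; [exact: (mea_cst mq)|exact: mea_const].
  - by move=> w x _; apply: sumr_ge0 => i _; rewrite !mulr_ge0.
  - by move=> w x _; rewrite !mulr_ge0// subr_ge0 ltW.
  apply: AE2T => w x _; rewrite -!mulr_sumr ler_pM2l// ler_wpM2l//.
  rewrite -(big_mkord xpredT (fun i => tau n i.+1 - tau n i)) telescope_sumr//.
  by rewrite tau_last// tau0.
have -> : (fun w x => `|\sum_(i < 2 ^ n) dl W n i w x ^+ 2|) =
    (fun w x => \sum_(i < 2 ^ n) dl W n i w x ^+ 2).
  apply/funext => w; apply/funext => x; rewrite ger0_norm//.
  by apply: sumr_ge0 => i _; exact: sqr_ge0.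
apply: (II_sum_le (f := fun i w x => dl W n i w x ^+ 2)
  (g := fun i w x => 12 * (q x * (tau n i.+1 - tau n i)))) => i i_n; split.
- exact: mdl2.
- apply: meaM; first exact: mea_const.
  by apply: meaM; [exact: (mea_cst mq)|exact: mea_const].
- by move=> w x _; exact: sqr_ge0.
- by move=> w x _; rewrite !mulr_ge0.
have rt k : r0 <= tau n k by exact: le_trans (tau_ge _ _ _).
have := @isoW 1 (fun j => tau n (i + j)) (fun _ _ _ => 1) 1.
rewrite (_ : (fun w x => (\sum_(j < 1) _) ^+ 2) = fun w x => dl W n i w x ^+ 2); last first.
  apply/funext => w; apply/funext => x.
  by rewrite big_ord_recl big_ord0 addr0 mul1r /= addn0 addn1.
rewrite (_ : (fun w x => 12 * (q x * \sum_(j < 1) _)) =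
    fun w x => 12 * (q x * (tau n i.+1 - tau n i))); last first.
  apply/funext => w; apply/funext => x.
  by rewrite big_ord_recl big_ord0 addr0 expr1n mulr1 /= addn0 addn1.
apply.
- move=> [|//] _; split=> //; first by rewrite tau_mono// addn0 addn1.
  by apply: le_trans tT; rewrite addn1 tau_le.
- by move=> j _; exact: mea_const.
- move=> [|//] x _ _; apply: (adp_cst filtF) => //.
  by apply: le_trans tT; rewrite addn0 tau_le// ltnW.
- by move=> j w x _ _; rewrite normr1.
Qed.

(** * Ito sums at two levels *)

Section Martingale.
Variables Y Z : field.
Hypothesis (nY : nice Y) (nZ : nice Z).

Let mY : tmea Y. Proof. by have [] := nY. Qed.
Let mZ : tmea Z. Proof. by have [] := nZ. Qed.

(** A measurable substitute for the supremum of the paths: where it is at most M, truncation at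
    level M changes no value on the grid. *)
Definition knotmax n : rfun := fun w x =>
  \big[Num.max/0]_(i < (2 ^ n).+1) (`|Y (tau n i) w x| + `|Z (tau n i) w x|).

Lemma mea_knotmax n : mea (knotmax n).
Proof.
apply: (mea_bigmax (F := fun i w x => `|Y (tau n i) w x| + `|Z (tau n i) w x|)).
move=> i i_n; apply: meaD; apply: mea_norm; exact: tmea_tau.
Qed.

Lemma knotmax_ge n i w x : (i <= 2 ^ n)%N ->
  `|Y (tau n i) w x| <= knotmax n w x /\ `|Z (tau n i) w x| <= knotmax n w x.
Proof.
move=> i_n; rewrite -ltnS in i_n.
have h := le_bigmax 0 (fun i : 'I_(2 ^ n).+1 =>
  `|Y (tau n i) w x| + `|Z (tau n i) w x|) (Ordinal i_n).
have := normr_ge0 (Y (tau n i) w x); have := normr_ge0 (Z (tau n i) w x).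
by split; (apply: le_trans h => /=; lra).
Qed.

Lemma knotmax_ge0 n w x : 0 <= knotmax n w x.
Proof. by have [h _] := @knotmax_ge n 0 w x isT; exact: le_trans h. Qed.

Lemma tight_knotmax : tight knotmax.
Proof.
apply: tight_bdd => // [n|]; first exact: mea_knotmax.
have [_ _ bY _] := nY; have [_ _ bZ _] := nZ.
move: bY bZ; apply: aeS2 => w [B1 h1] [B2 h2].
apply: aeW => x Dx; exists (`|B1| + `|B2|) => n.
rewrite ger0_norm ?knotmax_ge0//; apply: bigmax_le; first exact: addr_ge0.
move=> i _; have i_n : (i <= 2 ^ n)%N by rewrite -ltnS.
apply: lerD; apply: le_trans (ler_norm _).
  by apply: h1 => //; [exact: tau_ge|exact: tau_le].
by apply: h2 => //; [exact: tau_ge|exact: tau_le].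
Qed.

(** The difference between the Ito sums of Z at levels n + l and n, each coarse cell being weighted
    by the value of Y at its left end. *)
Definition gterm n l : rfun := fun w x => \sum_(k < 2 ^ (n + l))
  Y (tau n (k %/ 2 ^ l)) w x *
  (Z (tau (n + l) k) w x - Z (tau n (k %/ 2 ^ l)) w x) * dl W (n + l) k w x.

(** Truncation makes the integrand bounded, as [isoW] requires, and preserves adaptedness. *)
Definition Hclip M n l k : rfun := fun w x => clip M (Y (tau n (k %/ 2 ^ l)) w x) *
  (clip M (Z (tau (n + l) k) w x) - clip M (Z (tau n (k %/ 2 ^ l)) w x)).

Lemma mea_Hclip M n l k : (k < 2 ^ (n + l))%N -> mea (Hclip M n l k).
Proof.
move=> kn; have kl := ltnW (low_le kn).
by apply: meaM; [|apply: meaB]; apply: mea_clip; apply: tmea_tau => //; exact: ltnW.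
Qed.

Lemma adp_Hclip M n l k x : (k < 2 ^ (n + l))%N -> D x ->
  adp (tau (n + l) k) (Hclip M n l k ^~ x).
Proof.
move=> kn Dx; have kl := ltnW (low_le kn).
have [_ aY _ _] := nY; have [_ aZ _ _] := nZ.
apply: (adpM filtF); first by apply: adp_clip; exact: tadp_low.
apply: (adpB filtF); apply: adp_clip; last exact: tadp_low.
by apply: aZ => //; [exact: tau_ge|apply: tau_le => //; exact: ltnW].
Qed.

Lemma Hclip_le M n l k w x : 0 <= M -> `|Hclip M n l k w x| <= M * (M + M).
Proof.
move=> M0; rewrite normrM; apply: ler_pM => //; first exact: clip_le.
by apply: (le_trans (ler_normB _ _)); apply: lerD; exact: clip_le.
Qed.

Definition Hbr M n l : rfun := fun w x => 12 * (q x * \sum_(k < 2 ^ (n + l))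
  (tau (n + l) k.+1 - tau (n + l) k) * Hclip M n l k w x ^+ 2).

(** The increments of Z within a coarse cell tend to 0 on each path, but at a rate depending on the
    path. Dominated convergence along sequences (n_k, l_k) yields a bound uniform in [l], truncation
    providing the dominating function. *)
Lemma Hbr_small M (e : R) : 0 <= M -> 0 < e -> exists N, forall n l, (N <= n)%N ->
  (II (Hbr M n l) <= e%:E)%E.
Proof.
move=> M0; apply: (unif_of_seq (P := fun e n l => (II (Hbr M n l) <= e%:E)%E)).
move=> n_ l_ hn {}e e0.
have tn m k : 0 <= tau m k.+1 - tau m k by rewrite subr_ge0 tau_mono.
have sumtau m : \sum_(k < 2 ^ m) (tau m k.+1 - tau m k) = t - t0.
  rewrite -(big_mkord xpredT (fun i => tau m i.+1 - tau m i)) telescope_sumr//.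
  by rewrite tau_last// tau0.
have bound m l w x c : (forall k, (k < 2 ^ (m + l))%N -> `|Hclip M m l k w x| <= c) ->
    \sum_(k < 2 ^ (m + l)) (tau (m + l) k.+1 - tau (m + l) k) *
      Hclip M m l k w x ^+ 2 <= (t - t0) * c ^+ 2.
  move=> hc; rewrite -(sumtau (m + l)%N) mulr_suml; apply: ler_sum => k _.
  apply: ler_wpM2l => //; rewrite -real_normK ?num_real//.
  rewrite lerXn2r ?nnegrE//; first by apply: le_trans (hc _ (ltn_ord k)).
  exact: hc.
have pos0 m l w x : 0 <= \sum_(k < 2 ^ (m + l)) (tau (m + l) k.+1 - tau (m + l) k) *
      Hclip M m l k w x ^+ 2.
  by apply: sumr_ge0 => k _; rewrite mulr_ge0// sqr_ge0.
pose c := M * (M + M); pose h x := 12 * (q x * ((t - t0) * c ^+ 2)).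
apply: (@II_dct _ _ _ Pr L (fun k => Hbr M (n_ k) (l_ k)) h) => //.
- move=> k; apply: meaM; first exact: mea_const.
  apply: meaM; first exact: (mea_cst mq).
  apply: mea_sumo => i; apply: meaM; first exact: mea_const.
  by apply: meaX; exact: mea_Hclip.
- by move=> k w x _; rewrite !mulr_ge0.
- rewrite (_ : EFin \o h = (fun x => (12 * ((t - t0) * c ^+ 2))%:E * (q x)%:E)%E); last first.
    by apply/funext => x; rewrite /h /= -EFinM; congr EFin; ring.
  by apply: integrableZl => //; exact: measurable_dom.
- move=> k w x _; rewrite /Hbr /h ler_pM2l// ler_wpM2l//.
  by apply: bound => i _; exact: Hclip_le.
have [_ _ _ ucZ] := nZ.
move: ucZ; apply: aeS => w hw; apply: aeW => x Dx.
apply: cvg0_of => e' e'0.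
pose b := 12 * (q x * ((t - t0) * M ^+ 2)).
have tt : 0 <= t - t0 by rewrite subr_ge0 ltW.
have b0 : 0 <= b by rewrite /b !mulr_ge0// sqr_ge0.
(* Capped at 1 so that its square is at most itself. *)
pose ee := Num.min 1 (e' / (b + 1)).
have ee0 : 0 < ee by rewrite lt_min ltr01 divr_gt0// ltr_wpDl.
have ee1 : ee <= 1 by rewrite ge_min lexx.
have eeb : b * ee <= e'.
  have : ee <= e' / (b + 1) by rewrite ge_min lexx orbT.
  rewrite ler_pdivlMr; last by lra.
  by nra.
have [dlt dlt0 hdl] := hw _ ee0.
have [N hN] := step_cvg0 t0t dlt0.
exists N => k Nk; rewrite ger0_norm; last by rewrite /Hbr !mulr_ge0.
apply: le_trans eeb.
have : \sum_(i < 2 ^ (n_ k + l_ k)) (tau (n_ k + l_ k) i.+1 - tau (n_ k + l_ k) i) *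
      Hclip M (n_ k) (l_ k) i w x ^+ 2 <= (t - t0) * (M * ee) ^+ 2.
  apply: bound => i i_n; rewrite normrM; apply: ler_pM => //; first exact: clip_le.
  apply: (le_trans (clip_lip _ _ _)).
  have low := tau_low t0t (n_ k) (l_ k) i.
  apply: hdl => //.
  - exact: tau_ge.
  - by apply: tau_le => //; exact: ltnW.
  - exact: tau_ge.
  - by apply: tau_le => //; apply: ltnW; exact: low_le.
  rewrite ger0_norm ?subr_ge0//; apply: (le_trans (tau_low_near t0t _ _ _)).
  apply: hN; exact: leq_trans (hn k).
rewrite /Hbr /b => h1.
rewrite -!mulrA ler_pM2l// ler_wpM2l//; apply: (le_trans h1).
rewrite ler_wpM2l// exprMn expr2 -!mulrA; do 2!(apply: ler_wpM2l => //).
by rewrite expr2 ler_piMl// ltW.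
Qed.

Lemma mea_gterm n l : mea (gterm n l).
Proof.
apply: mea_sumo => k; have kl := ltnW (low_le (ltn_ord k)).
apply: meaM; last exact: mea_dl.
by apply: meaM; [|apply: meaB]; apply: tmea_tau => //; exact: ltnW.
Qed.

(* The integrand is truncated to apply the isometry, the uniform continuity of Z
   making the right-hand side small; tightness removes the truncation. *)
Lemma gterm_small (e : R) : 0 < e -> exists N, forall n l, (N <= n)%N ->
  kap (gterm n l) <= e.
Proof.
move=> e0; have e2 : 0 < e / 2 by lra.
have [M M1 [N1 h1]] := tight_knotmax e2.
have M0 : 0 <= M by lra.
have [a a0 ha] := kap_L2 Pr L0 e2.
have [N2 h2] := Hbr_small M0 a0.
exists (maxn N1 N2) => n l; rewrite geq_max => /andP[n1 n2].
pose gM : rfun := fun w x => \sum_(k < 2 ^ (n + l)) Hclip M n l k w x *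
  (W (tau (n + l) k.+1) w x - W (tau (n + l) k) w x).
have mgM : mea gM.
  apply: mea_sumo => k; apply: meaM; first exact: mea_Hclip.
  exact: (mea_dl mW (ltn_ord k)).
have kM : kap gM <= e / 2.
  apply: ha => //; apply: le_trans (h2 n l n2).
  apply: (isoW (K := M * (M + M))).
  - move=> j jn; split.
    + exact: le_trans (tau_ge _ _ _).
    + exact: tau_mono.
    + by apply: le_trans tT; exact: tau_le.
  - by move=> j jn; exact: mea_Hclip.
  - by move=> j x jn Dx; exact: adp_Hclip.
  - by move=> j w x jn _; exact: Hclip_le.
have mN : mea (fun w x => knotmax (n + l) w x / M).
  by apply: meaM; [exact: mea_knotmax|exact: mea_const].
have kN := h1 (n + l)%N (leq_trans n1 (leq_addr _ _)).
apply: (@le_trans _ _ (kap gM + kap (fun w x => knotmax (n + l) w x / M))); last by lra.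
apply: kap_le2 => //; first exact: mea_gterm.
(* Where [knotmax] is at most M the truncation is inactive; elsewhere the second term already equals
   1. *)
apply: AE2T => w x _; have [NM|MN] := leP (knotmax (n + l) w x) M.
  have -> : gterm n l w x = gM w x.
    apply: eq_bigr => k _; rewrite /Hclip /dl.
    have kn := ltnW (ltn_ord k); have kl := ltnW (low_le (ltn_ord k)).
    (* The coarse point is viewed as a point of level n + l, so that [knotmax] of that level
       controls it too. *)
    have kl' : ((k %/ 2 ^ l) * 2 ^ l <= 2 ^ (n + l))%N.
      by apply: leq_trans (leq_divM _ _) kn.
    have [_ b1] := knotmax_ge w x kn.
    have := knotmax_ge w x kl'; rewrite tauM// => -[b2 b3].
    by rewrite !clip_id//; apply: (le_trans _ NM).
  by rewrite lerDl min1_ge0.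
apply: (le_trans (min1_le1 _)).
suff -> : min1 (knotmax (n + l) w x / M) = 1 by rewrite lerDr min1_ge0.
rewrite /min1; apply/min_idPl; rewrite ger0_norm; last first.
  by rewrite divr_ge0// knotmax_ge0.
by rewrite ler_pdivlMr ?mul1r ?ltW//; lra.
Qed.

End Martingale.

Let step_ge0 m k : 0 <= tau m k.+1 - tau m k.
Proof. by rewrite subr_ge0 tau_mono. Qed.

Lemma nice_cst (c : R) : nice (fun _ _ _ => c).
Proof.
split.
- by move=> s _ _; exact: mea_const.
- move=> s x t0s st _; apply: (adp_cst filtF); first exact: le_trans t0s.
  exact: le_trans tT.
- by apply: aeW => w; exists `|c|.
- apply: aeW => w e e0; exists 1 => // s s' x _ _ _ _ _ _.
  by rewrite subrr normr0 ltW.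
Qed.

(* The error of the one-point approximation of the Ito integral over a coarse
   cell, seen at the finer level n + l. *)
Definition rho Z n l i : rfun := fun w x => \sum_(j < 2 ^ l)
  (Z (tau (n + l) (i * 2 ^ l + j)) w x - Z (tau n i) w x) *
  dl W (n + l) (i * 2 ^ l + j) w x.

Lemma mea_rho Z n l i : tmea Z -> (i < 2 ^ n)%N -> mea (rho Z n l i).
Proof.
move=> mZ i_n; apply: mea_sumo => j; have ij := blk i_n (ltn_ord j).
apply: meaM; last exact: mea_dl.
by apply: meaB; apply: tmea_tau => //; exact: ltnW.
Qed.

Lemma div_blk i j l : (j < 2 ^ l)%N -> ((i * 2 ^ l + j) %/ 2 ^ l = i)%N.
Proof. by move=> jl; rewrite divnMDl ?expn_gt0// divn_small// addn0. Qed.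

Lemma gterm_rho Y Z n l w x :
  \sum_(i < 2 ^ n) Y (tau n i) w x * rho Z n l i w x = gterm Y Z n l w x.
Proof.
rewrite /gterm expnD -(sum_blocks _ _ (fun k => Y (tau n (k %/ 2 ^ l)) w x *
  (Z (tau (n + l) k) w x - Z (tau n (k %/ 2 ^ l)) w x) * dl W (n + l) k w x)).
apply: eq_bigr => i _; rewrite mulr_sumr; apply: eq_bigr => j _.
by rewrite div_blk// mulrA.
Qed.

(** The isometry is applied on every coarse cell separately, with 1 in the role of Y. The right-hand
    sides add up to [Hbr one Z M n l], which is small uniformly in [l]. *)
Lemma rho2_small Z (e : R) : nice Z -> 0 < e -> exists N, forall n l, (N <= n)%N ->
  kap (fun w x => \sum_(i < 2 ^ n) rho Z n l i w x ^+ 2) <= e.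
Proof.
move=> nZ e0; have e2 : 0 < e / 2 by lra.
pose one : field := fun _ _ _ => 1.
have n1 : nice one by exact: nice_cst.
have [mZ _ _ _] := nZ.
have [M M1 [N1 h1]] := tight_knotmax n1 nZ e2.
have M0 : 0 <= M by lra.
have [N2 h2] := Hbr_small n1 nZ M0 e2.
exists (maxn N1 N2) => n l; rewrite geq_max => /andP[nN1 nN2].
pose rM i : rfun := fun w x => \sum_(j < 2 ^ l)
  Hclip one Z M n l (i * 2 ^ l + j) w x *
  (W (tau (n + l) (i * 2 ^ l + j).+1) w x - W (tau (n + l) (i * 2 ^ l + j)) w x).
have mrM i : (i < 2 ^ n)%N -> mea (rM i).
  move=> i_n; apply: mea_sumo => j; have ij := blk i_n (ltn_ord j).
  by apply: meaM; [exact: mea_Hclip|exact: (mea_dl mW ij)].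
have mrM2 i : (i < 2 ^ n)%N -> mea (fun w x => rM i w x ^+ 2).
  by move=> i_n; apply: meaX; exact: mrM.
have kM : kap (fun w x => \sum_(i < 2 ^ n) rM i w x ^+ 2) <= e / 2.
  apply: kap_L1 => //; first by apply: mea_sumo => i; exact: mrM2.
  have -> : (fun w x => `|\sum_(i < 2 ^ n) rM i w x ^+ 2|) =
      (fun w x => \sum_(i < 2 ^ n) rM i w x ^+ 2).
    apply/funext => w; apply/funext => x; rewrite ger0_norm//.
    by apply: sumr_ge0 => i _; exact: sqr_ge0.
  apply: le_trans (h2 n l nN2).
  pose g i : rfun := fun w x => 12 * (q x * \sum_(j < 2 ^ l)
    (tau (n + l) (i * 2 ^ l + j).+1 - tau (n + l) (i * 2 ^ l + j)) *
    Hclip one Z M n l (i * 2 ^ l + j) w x ^+ 2).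
  have -> : Hbr one Z M n l = fun w x => \sum_(i < 2 ^ n) g i w x.
    apply/funext => w; apply/funext => x.
    rewrite /Hbr /g -!mulr_sumr expnD -(sum_blocks _ _ (fun k =>
      (tau (n + l) k.+1 - tau (n + l) k) * Hclip one Z M n l k w x ^+ 2)).
    by [].
  apply: (II_sum_le (f := fun i w x => rM i w x ^+ 2) (g := g)) => i i_n; split.
  - exact: mrM2.
  - apply: meaM; first exact: mea_const.
    apply: meaM; first exact: (mea_cst mq).
    apply: mea_sumo => j; have ij := blk i_n (ltn_ord j).
    by apply: meaM; [exact: mea_const|apply: meaX; exact: mea_Hclip].
  - by move=> w x _; exact: sqr_ge0.
  - move=> w x _; rewrite !mulr_ge0//; apply: sumr_ge0 => j _.
    by rewrite mulr_ge0// sqr_ge0.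
  rewrite /rM /g.
  have := @isoW (2 ^ l) (fun j => tau (n + l) (i * 2 ^ l + j))
    (fun j => Hclip one Z M n l (i * 2 ^ l + j)) (M * (M + M)).
  rewrite (_ : (fun w x => (\sum_(j < 2 ^ l) _) ^+ 2) = fun w x => rM i w x ^+ 2); last first.
    apply/funext => w; apply/funext => x; congr (_ ^+ 2).
    by apply: eq_bigr => j _; rewrite addnS.
  rewrite (_ : (fun w x => 12 * (q x * \sum_(j < 2 ^ l) _)) = g i); last first.
    apply/funext => w; apply/funext => x; congr (_ * (_ * _)).
    by apply: eq_bigr => j _; rewrite addnS.
  apply.
  - move=> j jl; have ij := blk i_n jl; split.
    + exact: le_trans (tau_ge _ _ _).
    + by apply: tau_mono => //; rewrite leq_add2l.
    + by apply: le_trans tT; rewrite addnS; exact: tau_le.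
  - by move=> j jl; apply: mea_Hclip => //; exact: blk.
  - by move=> j x jl Dx; apply: adp_Hclip => //; exact: blk.
  - by move=> j w x jl _; exact: Hclip_le.
have mN : mea (fun w x => knotmax one Z (n + l) w x / M).
  by apply: meaM; [exact: mea_knotmax|exact: mea_const].
have kN := h1 (n + l)%N (leq_trans nN1 (leq_addr _ _)).
apply: (@le_trans _ _ (kap (fun w x => \sum_(i < 2 ^ n) rM i w x ^+ 2) +
  kap (fun w x => knotmax one Z (n + l) w x / M))); last by lra.
have mr2 : mea (fun w x => \sum_(i < 2 ^ n) rho Z n l i w x ^+ 2).
  by apply: mea_sumo => i; apply: meaX; exact: mea_rho.
apply: kap_le2 => //; first by apply: mea_sumo => i; exact: mrM2.
apply: AE2T => w x _; have [NM|MN] := leP (knotmax one Z (n + l) w x) M.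
  have -> : \sum_(i < 2 ^ n) rho Z n l i w x ^+ 2 = \sum_(i < 2 ^ n) rM i w x ^+ 2.
    apply: eq_bigr => i _; congr (_ ^+ 2); apply: eq_bigr => j _.
    have ij := blk (ltn_ord i) (ltn_ord j).
    have ij' : (i * 2 ^ l <= 2 ^ (n + l))%N.
      by apply: leq_trans (ltnW ij); exact: leq_addr.
    have [_ b1] := knotmax_ge one Z w x (ltnW ij).
    have := knotmax_ge one Z w x ij'; rewrite tauM// => -[_ b3].
    rewrite /Hclip div_blk// clip_id; last by rewrite normr1.
    by rewrite mul1r !clip_id//; apply: (le_trans _ NM).
  by rewrite lerDl min1_ge0.
apply: (le_trans (min1_le1 _)).
suff -> : min1 (knotmax one Z (n + l) w x / M) = 1 by rewrite lerDr min1_ge0.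
rewrite /min1; apply/min_idPl; rewrite ger0_norm; last first.
  by rewrite divr_ge0// knotmax_ge0.
by rewrite ler_pdivlMr ?mul1r ?ltW//; lra.
Qed.

(** The limit over all partitions is kept only along refinements of a dyadic grid: [i * 2 ^ l] cells
    of level [n + l] fill the interval from t0 to [tau n i]. *)
Definition ito Z J := tmea J /\ forall n i, (i <= 2 ^ n)%N ->
  to0 (fun l => kap (fun w x => \sum_(j < i * 2 ^ l)
    Z (tau (n + l) j) w x * dl W (n + l) j w x - J (tau n i) w x)).

(* Of the bracket only its values as limits along the dyadic grids are used,
   together with a bound on its increments over those grids. *)
Definition brk Z C := [/\ tmea C, forall n i, (i <= 2 ^ n)%N ->
  to0 (fun l => kap (fun w x => \sum_(j < i * 2 ^ l)
    dl Z (n + l) j w x * dl W (n + l) j w x - C (tau n i) w x)) &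
  AE2 (fun w x => exists B, forall n, \sum_(i < 2 ^ n) `|dl C n i w x| <= B)].

Lemma sum_blockS n B (f : nat -> R) : \sum_(k < n.+1 * B) f k =
  \sum_(k < n * B) f k + \sum_(j < B) f (n * B + j)%N.
Proof. by rewrite -!sum_blocks big_ord_recr. Qed.

(** Subtracts the limits at two consecutive coarse points to localise the convergence to the cell
    between them. *)
Lemma block_cvg (f : nat -> nat -> rfun) J n i : tmea J -> (i < 2 ^ n)%N ->
  (forall m j, (j < 2 ^ m)%N -> mea (f m j)) ->
  (forall i, (i <= 2 ^ n)%N -> to0 (fun l => kap (fun w x =>
     \sum_(j < i * 2 ^ l) f (n + l)%N j w x - J (tau n i) w x))) ->
  to0 (fun l => kap (fun w x =>
     \sum_(j < 2 ^ l) f (n + l)%N (i * 2 ^ l + j)%N w x - dl J n i w x)).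
Proof.
move=> mJ i_n mf h.
have ms k l : (k <= 2 ^ n)%N ->
    mea (fun w x => \sum_(j < k * 2 ^ l) f (n + l)%N j w x - J (tau n k) w x).
  move=> kn; apply: meaB; last exact: tmea_tau.
  apply: mea_sumo => j; apply: mf; apply: leq_trans (ltn_ord j) _.
  by rewrite expnD leq_mul2r kn orbT.
apply: (@to0D _ _ _ Pr L L0 _
  (fun l w x => \sum_(j < i.+1 * 2 ^ l) f (n + l)%N j w x - J (tau n i.+1) w x)
  (fun l w x => \sum_(j < i * 2 ^ l) f (n + l)%N j w x - J (tau n i) w x)).
- move=> l; apply: meaB; last exact: mea_dl.
  by apply: mea_sumo => j; apply: mf; exact: blk.
- by move=> l; apply: ms.
- by move=> l; apply: ms; exact: ltnW.
- apply: AE2T => w x _ l.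
  rewrite [X in `|X|](_ : _ =
    (\sum_(j < i.+1 * 2 ^ l) f (n + l)%N j w x - J (tau n i.+1) w x) -
    (\sum_(j < i * 2 ^ l) f (n + l)%N j w x - J (tau n i) w x)).
    exact: ler_normB.
  rewrite (sum_blockS i (2 ^ l) (fun j => f (n + l)%N j w x)) /dl; ring.
- exact: h.
- by apply: h; exact: ltnW.
Qed.

(** The exact counterpart of [rho], which converges to it as the cell is refined ([rho_cvg]). *)
Definition rerr Z J n i : rfun := fun w x =>
  dl J n i w x - Z (tau n i) w x * dl W n i w x.

Lemma mea_rerr Z J n i : tmea Z -> tmea J -> (i < 2 ^ n)%N -> mea (rerr Z J n i).
Proof.
move=> mZ mJ i_n; apply: meaB; first exact: mea_dl.
by apply: meaM; [apply: tmea_tau => //; exact: ltnW|exact: mea_dl].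
Qed.

Lemma sum_dl Y n l i w x :
  \sum_(j < 2 ^ l) dl Y (n + l) (i * 2 ^ l + j) w x = dl Y n i w x.
Proof.
rewrite /dl; under eq_bigr do rewrite -addnS.
rewrite -(big_mkord xpredT (fun j => Y (tau (n + l) (i * 2 ^ l + j.+1)) w x -
   Y (tau (n + l) (i * 2 ^ l + j)) w x)).
rewrite (telescope_sumr (fun j => Y (tau (n + l) (i * 2 ^ l + j)) w x))//.
by rewrite addn0 [(i * 2 ^ l + 2 ^ l)%N]addnC -mulSn !tauM.
Qed.

Lemma rho_cvg Z J n i : tmea Z -> ito Z J -> (i < 2 ^ n)%N ->
  to0 (fun l => kap (fun w x => rho Z n l i w x - rerr Z J n i w x)).
Proof.
move=> mZ [mJ hJ] i_n.
have h := @block_cvg (fun m j w x => Z (tau m j) w x * dl W m j w x) J n i mJ i_n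
  (fun m j jm => meaM (tmea_tau mZ (ltnW jm)) (mea_dl mW jm)) (fun k => hJ n k).
move=> e e0; have [N hN] := h e e0; exists N => l Nl.
rewrite (_ : (fun w x => _) = (fun w x => \sum_(j < 2 ^ l)
  Z (tau (n + l) (i * 2 ^ l + j)) w x * dl W (n + l) (i * 2 ^ l + j) w x -
  dl J n i w x)); first exact: hN.
apply/funext => w; apply/funext => x; rewrite /rho /rerr.
under eq_bigr do rewrite mulrBl.
by rewrite sumrB -mulr_sumr sum_dl; ring.
Qed.

(** At a fixed level n, [rerr] is replaced by [rho] at a sufficiently fine level n + N2. As N2
    depends on n without control, [gterm_small] has to be uniform in [l]. *)
Lemma sum_rerr_to0 Y Z J : nice Y -> nice Z -> ito Z J ->
  to0 (fun n => kap (fun w x => \sum_(i < 2 ^ n) Y (tau n i) w x * rerr Z J n i w x)).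
Proof.
move=> nY nZ iJ e e0; have e2 : 0 < e / 2 by lra.
have [mY _ _ _] := nY; have [mZ _ _ _] := nZ; have [mJ _] := iJ.
have [N hN] := gterm_small nY nZ e2; exists N => n Nn.
have mdif i l : (i < 2 ^ n)%N -> mea (fun w x => rho Z n l i w x - rerr Z J n i w x).
  by move=> i_n; apply: meaB; [exact: mea_rho|exact: mea_rerr].
have mYi i : (i < 2 ^ n)%N -> mea (Y (tau n i)).
  by move=> i_n; apply: tmea_tau => //; exact: ltnW.
have [||N2 h2] := @to0_sum _ _ _ Pr L L0 (2 ^ n)
    (fun i l w x => Y (tau n i) w x * (rho Z n l i w x - rerr Z J n i w x)) _ _ _ e2.
- by move=> i l i_n; apply: meaM; [exact: mYi|exact: mdif].
- move=> i i_n; apply: (@to0M _ _ _ Pr L L0 _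
    (fun l w x => rho Z n l i w x - rerr Z J n i w x) (fun l => Y (tau n i))).
  + by move=> l; apply: meaM; [exact: mYi|exact: mdif].
  + by move=> l; exact: mdif.
  + by move=> l; exact: mYi.
  + by apply: AE2T => w x _ l; rewrite mulrC.
  + exact: rho_cvg.
  + by apply: tight_const => //; exact: mYi.
have {}h2 := h2 N2 (leqnn _); have {}hN := hN n N2 Nn.
have mS : mea (fun w x => \sum_(i < 2 ^ n)
    Y (tau n i) w x * (rho Z n N2 i w x - rerr Z J n i w x)).
  by apply: mea_sumo => i; apply: meaM; [exact: mYi|exact: mdif].
apply: (@le_trans _ _ (kap (fun w x => \sum_(i < 2 ^ n)
    Y (tau n i) w x * (rho Z n N2 i w x - rerr Z J n i w x)) +
    kap (gterm Y Z n N2))); last by lra.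
apply: kap_add => //; last first.
- apply: AE2T => w x _; rewrite -gterm_rho addrC.
  rewrite (_ : \sum_(i < 2 ^ n) Y (tau n i) w x * rerr Z J n i w x =
    \sum_(i < 2 ^ n) Y (tau n i) w x * rho Z n N2 i w x -
    \sum_(i < 2 ^ n) Y (tau n i) w x * (rho Z n N2 i w x - rerr Z J n i w x)).
    exact: ler_normB.
  by rewrite -sumrB; apply: eq_bigr => i _; ring.
- exact: mea_gterm.
- by apply: mea_sumo => i; apply: meaM; [exact: mYi|exact: mea_rerr].
Qed.

(** The same comparison for squares, through r^2 <= 2 (rho - r)^2 + 2 rho^2. Doubling a function at
    most doubles its [kap], so four terms of size e / 4 arise. *)
Lemma sum_rerr2_to0 Z J : nice Z -> ito Z J ->
  to0 (fun n => kap (fun w x => \sum_(i < 2 ^ n) rerr Z J n i w x ^+ 2)).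
Proof.
move=> nZ iJ e e0; have e4 : 0 < e / 4 by lra.
have [mZ _ _ _] := nZ; have [mJ _] := iJ.
have [N hN] := rho2_small nZ e4; exists N => n Nn.
have mdif i l : (i < 2 ^ n)%N -> mea (fun w x => rho Z n l i w x - rerr Z J n i w x).
  by move=> i_n; apply: meaB; [exact: mea_rho|exact: mea_rerr].
have [||N2 h2] := @to0_sum _ _ _ Pr L L0 (2 ^ n)
    (fun i l w x => (rho Z n l i w x - rerr Z J n i w x) ^+ 2) _ _ _ e4.
- by move=> i l i_n; apply: meaX; exact: mdif.
- move=> i i_n; have cv := rho_cvg mZ iJ i_n; apply: (@to0M _ _ _ Pr L L0 _
    (fun l w x => rho Z n l i w x - rerr Z J n i w x)
    (fun l w x => rho Z n l i w x - rerr Z J n i w x)) => //.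
  + by move=> l; apply: meaX; exact: mdif.
  + by move=> l; exact: mdif.
  + by move=> l; exact: mdif.
  + by apply: AE2T => w x _ l; rewrite expr2.
  + exact: tight_to0.
have {}h2 := h2 N2 (leqnn _); have {}hN := hN n N2 Nn.
have mS : mea (fun w x => \sum_(i < 2 ^ n)
    (rho Z n N2 i w x - rerr Z J n i w x) ^+ 2).
  by apply: mea_sumo => i; apply: meaX; exact: mdif.
have mr : mea (fun w x => \sum_(i < 2 ^ n) rho Z n N2 i w x ^+ 2).
  by apply: mea_sumo => i; apply: meaX; exact: mea_rho.
have dbl (f : rfun) : mea f -> kap (fun w x => 2 * f w x) <= kap f + kap f.
  move=> mf; apply: kap_add => //; first by apply: meaM => //; exact: mea_const.
  by apply: AE2T => w x _; rewrite normrM (ger0_norm (ler0n R 2)); lra.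
have d1 := dbl _ mS; have d2 := dbl _ mr.
apply: (@le_trans _ _ (kap (fun w x => 2 * \sum_(i < 2 ^ n)
    (rho Z n N2 i w x - rerr Z J n i w x) ^+ 2) +
    kap (fun w x => 2 * \sum_(i < 2 ^ n) rho Z n N2 i w x ^+ 2))); last first.
  move: d1 d2 h2 hN; move: (kap _) (kap _) (kap _) (kap _) => *; lra.
apply: kap_add => //.
- by apply: mea_sumo => i; apply: meaX; exact: mea_rerr.
- by apply: meaM => //; exact: mea_const.
- by apply: meaM => //; exact: mea_const.
apply: AE2T => w x _; rewrite !ger0_norm; last 3 first.
- by rewrite mulr_ge0//; apply: sumr_ge0 => i _; exact: sqr_ge0.
- by rewrite mulr_ge0//; apply: sumr_ge0 => i _; exact: sqr_ge0.
- by apply: sumr_ge0 => i _; exact: sqr_ge0.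
rewrite !mulr_sumr -big_split; apply: ler_sum => i _ /=.
move: (rho _ _ _ _ _ _) (rerr _ _ _ _ _ _) => a b.
(* 2 (a - b)^2 + 2 a^2 - b^2 is the square of 2a - b. *)
by have := sqr_ge0 (a + a - b); nra.
Qed.

(** * Brackets and Stratonovich errors *)

Section Bracket.
Variables (Y Z J C S : field).
Hypothesis (nY : nice Y) (nZ : nice Z) (iJ : ito Z J) (bC : brk Z C).
Hypothesis defS : forall s w x, S s w x = J s w x + 2^-1 * C s w x.

Let mY : tmea Y. Proof. by have [] := nY. Qed.
Let mZ : tmea Z. Proof. by have [] := nZ. Qed.
Let mJ : tmea J. Proof. by have [] := iJ. Qed.
Let mC : tmea C. Proof. by have [] := bC. Qed.

Let m_sum (f : nat -> nat -> rfun) : (forall n i, (i < 2 ^ n)%N -> mea (f n i)) ->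
  forall n, mea (fun w x => \sum_(i < 2 ^ n) f n i w x).
Proof. by move=> mf n; apply: mea_sumo => i; exact: mf. Qed.

Let m_sqr (f : nat -> nat -> rfun) : (forall n i, (i < 2 ^ n)%N -> mea (f n i)) ->
  forall n, mea (fun w x => \sum_(i < 2 ^ n) f n i w x ^+ 2).
Proof.
move=> mf; apply: (m_sum (f := fun n i w x => f n i w x ^+ 2)) => n i i_n.
by apply: meaX; exact: mf.
Qed.

Lemma tmea_strat : tmea S.
Proof.
move=> s t0s st; rewrite (_ : S s = fun w x => J s w x + 2^-1 * C s w x).
  apply: meaD; first exact: mJ.
  by apply: meaM; [exact: mea_const|exact: mC].
by apply/funext => w; apply/funext => x.
Qed.

Let tmS : tmea S := tmea_strat.

(** dS = r + Z_i dW + dC / 2, with r the error [rerr]. The squares of r sum to something tending to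
    0, those of Z_i dW are at most [knotmax] squared times the quadratic variation of W, and those
    of dC are bounded by the squared variation of C. *)
Lemma tight_dlS2 : tight (fun n w x => \sum_(i < 2 ^ n) dl S n i w x ^+ 2).
Proof.
have mr n i : (i < 2 ^ n)%N -> mea (rerr Z J n i) by move=> ?; exact: mea_rerr.
have mzw n i : (i < 2 ^ n)%N -> mea (fun w x => Z (tau n i) w x * dl W n i w x).
  by move=> ?; apply: meaM; [apply: tmea_tau => //; exact: ltnW|exact: mea_dl].
have mdW n i : (i < 2 ^ n)%N -> mea (dl W n i) by move=> ?; exact: mea_dl.
have mdC n i : (i < 2 ^ n)%N -> mea (dl C n i) by move=> ?; exact: mea_dl.
have mk n : mea (fun w x => 4 * knotmax Z Z n w x ^+ 2).
  by apply: meaM; [exact: mea_const|apply: meaX; exact: mea_knotmax].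
have tk : tight (fun n w x => 4 * knotmax Z Z n w x ^+ 2).
  have mk1 n : mea (fun w x => 4 * knotmax Z Z n w x).
    by apply: meaM; [exact: mea_const|exact: mea_knotmax].
  apply: (@tightM _ _ _ Pr L L0 _ (fun n w x => 4 * knotmax Z Z n w x)
    (knotmax Z Z)) => //.
  - exact: mea_knotmax.
  - by apply: AE2T => w x _ n; rewrite expr2 mulrA.
  - apply: (@tightM _ _ _ Pr L L0 _ (fun n w x => 4) (knotmax Z Z)) => //.
    + by move=> n; exact: mea_const.
    + exact: mea_knotmax.
    + by apply: AE2T => w x _ n.
    + by apply: tight_const => //; exact: mea_const.
    + exact: tight_knotmax.
  - exact: tight_knotmax.
have t1 : tight (fun n w x => 4 * knotmax Z Z n w x ^+ 2 *
    \sum_(i < 2 ^ n) dl W n i w x ^+ 2).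
  apply: (@tightM _ _ _ Pr L L0 _ (fun n w x => 4 * knotmax Z Z n w x ^+ 2)
    (fun n w x => \sum_(i < 2 ^ n) dl W n i w x ^+ 2)) => //.
  - by move=> n; apply: meaM => //; exact: (m_sqr mdW).
  - exact: (m_sqr mdW).
  - by apply: AE2T => w x _ n.
  - exact: tight_dlW2.
have t2 : tight (fun n w x => 4 * \sum_(i < 2 ^ n) rerr Z J n i w x ^+ 2).
  apply: (@tightM _ _ _ Pr L L0 _ (fun n w x => 4)
    (fun n w x => \sum_(i < 2 ^ n) rerr Z J n i w x ^+ 2)).
  - by move=> n; apply: meaM; [exact: mea_const|exact: (m_sqr mr)].
  - by move=> n; exact: mea_const.
  - exact: (m_sqr mr).
  - by apply: AE2T => w x _ n.
  - by apply: tight_const => //; exact: mea_const.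
  - by apply: tight_to0; exact: sum_rerr2_to0.
have t3 : tight (fun n w x => \sum_(i < 2 ^ n) dl C n i w x ^+ 2).
  apply: tight_bdd => //; first exact: (m_sqr mdC).
  have [_ _] := bC; apply: AE2S => w x _ [B hB]; exists (B ^+ 2) => n.
  rewrite ger0_norm; last by apply: sumr_ge0 => i _; exact: sqr_ge0.
  have sB : 0 <= \sum_(i < 2 ^ n) `|dl C n i w x| by exact: sumr_ge0.
  apply: (@le_trans _ _ ((\sum_(i < 2 ^ n) `|dl C n i w x|) ^+ 2)); last first.
    rewrite lerXn2r ?nnegrE//; exact: le_trans (hB n).
  rewrite [leRHS]expr2 mulr_sumr; apply: ler_sum => i _.
  rewrite -real_normK ?num_real// expr2 ler_wpM2r//.
  by rewrite (bigD1 i)//= lerDl; exact: sumr_ge0.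
have t12 : tight (fun n w x => 4 * \sum_(i < 2 ^ n) rerr Z J n i w x ^+ 2 +
    4 * knotmax Z Z n w x ^+ 2 * \sum_(i < 2 ^ n) dl W n i w x ^+ 2).
  apply: (tight_le2 L0 _ _ _ _ t2 t1) => [n|n|n|].
  - apply: meaD; first by apply: meaM; [exact: mea_const|exact: (m_sqr mr)].
    by apply: meaM => //; exact: (m_sqr mdW).
  - by apply: meaM; [exact: mea_const|exact: (m_sqr mr)].
  - by apply: meaM => //; exact: (m_sqr mdW).
  - by apply: AE2T => w x _ n; exact: ler_normD.
apply: (tight_le2 L0 _ _ _ _ t12 t3) => [n|n|n|].
- by apply: m_sqr => {}n i i_n; exact: mea_dl.
- apply: meaD; first by apply: meaM; [exact: mea_const|exact: (m_sqr mr)].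
  by apply: meaM => //; exact: (m_sqr mdW).
- exact: (m_sqr mdC).
apply: AE2T => w x _ n; rewrite !ger0_norm; last 3 first.
- by apply: sumr_ge0 => i _; exact: sqr_ge0.
- have s1 : 0 <= \sum_(i < 2 ^ n) rerr Z J n i w x ^+ 2.
    by apply: sumr_ge0 => i _; exact: sqr_ge0.
  have s2 : 0 <= \sum_(i < 2 ^ n) dl W n i w x ^+ 2.
    by apply: sumr_ge0 => i _; exact: sqr_ge0.
  by rewrite addr_ge0// mulr_ge0// mulr_ge0// sqr_ge0.
- by apply: sumr_ge0 => i _; exact: sqr_ge0.
rewrite !mulr_sumr -!big_split; apply: ler_sum => i _ /=.
have [_] := knotmax_ge Z Z w x (ltnW (ltn_ord i)).
have k0 := knotmax_ge0 Z Z n w x.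
have : dl S n i w x = rerr Z J n i w x + Z (tau n i) w x * dl W n i w x +
    2^-1 * dl C n i w x.
  by rewrite /rerr /dl !defS; ring.
move=> ->; move: (rerr _ _ _ _ _ _) (Z _ _ _) (dl W _ _ _ _) (dl C _ _ _ _) k0.
move: (knotmax _ _ _ _ _) => k r z v c k0 zk.
have zk2 : z ^+ 2 <= k ^+ 2.
  by rewrite -real_normK ?num_real// lerXn2r ?nnegrE.
have zv : (z * v) ^+ 2 <= k ^+ 2 * v ^+ 2 by rewrite exprMn ler_wpM2r// sqr_ge0.
rewrite -mulrA; move: (k ^+ 2 * v ^+ 2) zv => kv zv.
(* (r + zv + c/2)^2 <= 2 (r + zv)^2 + c^2 / 2 <= 4 r^2 + 4 (zv)^2 + c^2. *)
have := sqr_ge0 (r - z * v); have := sqr_ge0 (r + z * v - 2^-1 * c).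
by have := sqr_ge0 c; nra.
Qed.

Definition kerr n i : rfun := fun w x =>
  dl C n i w x - dl Z n i w x * dl W n i w x.

Lemma mea_kerr n i : (i < 2 ^ n)%N -> mea (kerr n i).
Proof. by move=> i_n; apply: meaB; [|apply: meaM]; exact: mea_dl. Qed.

Hypothesis tZ : tight (fun n w x => \sum_(i < 2 ^ n) dl Z n i w x ^+ 2).

(** |k| <= |dC| + dZ^2 + dW^2, and each of the three sums is tight. *)
Lemma tight_kerr : tight (fun n w x => \sum_(i < 2 ^ n) `|kerr n i w x|).
Proof.
have mdZ n i : (i < 2 ^ n)%N -> mea (dl Z n i) by move=> ?; exact: mea_dl.
have mdW n i : (i < 2 ^ n)%N -> mea (dl W n i) by move=> ?; exact: mea_dl.
have mC1 n : mea (fun w x => \sum_(i < 2 ^ n) `|dl C n i w x|).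
  apply: (m_sum (f := fun n i w x => `|dl C n i w x|)) => {}n i i_n.
  by apply: mea_norm; exact: mea_dl.
have t1 : tight (fun n w x => \sum_(i < 2 ^ n) `|dl C n i w x|).
  apply: tight_bdd => //.
  have [_ _] := bC; apply: AE2S => w x _ [B hB]; exists B => n.
  by rewrite ger0_norm// sumr_ge0.
have t2 : tight (fun n w x => \sum_(i < 2 ^ n) dl Z n i w x ^+ 2 +
    \sum_(i < 2 ^ n) dl W n i w x ^+ 2).
  apply: (tight_le2 L0 _ _ _ _ tZ tight_dlW2) => [n|n|n|].
  - by apply: meaD; [exact: (m_sqr mdZ)|exact: (m_sqr mdW)].
  - exact: (m_sqr mdZ).
  - exact: (m_sqr mdW).
  - by apply: AE2T => w x _ n; exact: ler_normD.
apply: (tight_le2 L0 _ _ _ _ t1 t2) => [n|n|n|].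
- apply: (m_sum (f := fun n i w x => `|kerr n i w x|)) => {}n i i_n.
  by apply: mea_norm; exact: mea_kerr.
- exact: mC1.
- by apply: meaD; [exact: (m_sqr mdZ)|exact: (m_sqr mdW)].
apply: AE2T => w x _ n; rewrite -!big_split !ger0_norm; last 3 first.
- by apply: sumr_ge0 => i _; rewrite addr_ge0// sqr_ge0.
- exact: sumr_ge0.
- exact: sumr_ge0.
rewrite -big_split; apply: ler_sum => i _ /=.
apply: (le_trans (ler_normB _ _)); rewrite lerD2l.
move: (dl Z _ _ _ _) (dl W _ _ _ _) => a b.
have := sqr_ge0 (a + b); have := sqr_ge0 (a - b); have := sqr_ge0 a; have := sqr_ge0 b.
by rewrite ler_norml => *; apply/andP; split; nra.
Qed.

(** The error committed when Y is frozen at the left ends of the coarse cells, in the worst fine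
    cell. *)
Definition osc n l : rfun := fun w x => \big[Num.max/0]_(k < 2 ^ (n + l))
  `|mid Y (n + l) k w x - Y (tau n (k %/ 2 ^ l)) w x|.

Lemma mea_osc n l : mea (osc n l).
Proof.
apply: (mea_bigmax (F := fun k w x =>
  `|mid Y (n + l) k w x - Y (tau n (k %/ 2 ^ l)) w x|)) => k kn.
apply: mea_norm; apply: meaB; first exact: mea_mid.
by apply: tmea_tau => //; apply: ltnW; exact: low_le.
Qed.

(** On each path the bound depends only on the coarse mesh; since the modulus of continuity is
    random, uniformity in [l] is again reached through sequences. *)
Lemma osc_small (e : R) : 0 < e -> exists N, forall n l, (N <= n)%N ->
  kap (osc n l) <= e.
Proof.
apply: (unif_of_seq (P := fun e n l => kap (osc n l) <= e)) => n_ l_ hn {}e e0.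
apply: (kap_dct L0 (f_ := fun k => osc (n_ k) (l_ k))) => // [k|]; first exact: mea_osc.
have [_ _ _ ucY] := nY; move: ucY; apply: aeS => w hw; apply: aeW => x Dx.
apply: cvg0_of => e' e'0; have [dlt dlt0 hdl] := hw _ e'0.
have [N hN] := step_cvg0 t0t dlt0; exists N => k Nk.
have osc0 : 0 <= osc (n_ k) (l_ k) w x by exact: bigmax_ge_id.
rewrite ger0_norm//; apply: bigmax_le; first exact: ltW.
move=> i _; set n := n_ k; set l := l_ k.
(* [j] is either end of the fine cell [i]; both ends lie in the same closed coarse cell. *)
have near j : (i <= j <= i.+1)%N ->
    `|Y (tau (n + l) j) w x - Y (tau n (i %/ 2 ^ l)) w x| <= e'.
  move=> /andP[ij ji]; have i_n := ltn_ord i.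
  have low : tau n (i %/ 2 ^ l) <= tau (n + l) j.
    by apply: (le_trans (tau_low t0t _ _ _)); apply: tau_mono.
  apply: hdl => //.
  - exact: tau_ge.
  - by apply: tau_le => //; exact: leq_trans i_n.
  - exact: tau_ge.
  - by apply: tau_le => //; apply: ltnW; exact: low_le.
  rewrite ger0_norm ?subr_ge0//.
  apply: (@le_trans _ _ ((t - t0) / (2 ^ n)%:R)); last first.
    by apply: hN; exact: leq_trans (hn k).
  have : tau (n + l) j <= tau (n + l) ((i %/ 2 ^ l).+1 * 2 ^ l).
    apply: tau_mono => //; apply: (leq_trans ji).
    by rewrite ltn_ceil// expn_gt0.
  by rewrite tauM// -(tau_step t0 t n (i %/ 2 ^ l)) lerD2r.
have h1 := near i; have h2 := near i.+1.
have {}h1 : `|Y (tau (n + l) i) w x - Y (tau n (i %/ 2 ^ l)) w x| <= e'.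
  by apply: h1; rewrite leqnn leqnSn.
have {}h2 : `|Y (tau (n + l) i.+1) w x - Y (tau n (i %/ 2 ^ l)) w x| <= e'.
  by apply: h2; rewrite leqnn leqnSn.
rewrite /mid; move: h1 h2; rewrite !ler_norml => /andP[? ?] /andP[? ?].
by apply/andP; split; lra.
Qed.

(** Within a coarse cell the increments of C telescope, so what is left is the error in the
    definition of the bracket over that cell. *)
Lemma kerr_cvg n i : (i < 2 ^ n)%N ->
  to0 (fun l => kap (fun w x => \sum_(j < 2 ^ l) kerr (n + l) (i * 2 ^ l + j) w x)).
Proof.
move=> i_n; have [_ hC _] := bC.
have h := @block_cvg (fun m j w x => dl Z m j w x * dl W m j w x) C n i mC i_n
  (fun m j jm => meaM (mea_dl mZ jm) (mea_dl mW jm)) (fun k => hC n k).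
move=> e e0; have [N hN] := h e e0; exists N => l Nl.
apply: le_trans (hN l Nl); apply: kap_le => //.
- by apply: mea_sumo => j; apply: mea_kerr; exact: blk.
- apply: meaB; last exact: mea_dl.
  by apply: mea_sumo => j; apply: meaM; apply: mea_dl => //; exact: blk.
apply: AE2T => w x _; rewrite /kerr sumrB sum_dl.
by rewrite distrC.
Qed.

(* Freezing Y on the cells of a fixed coarse grid leaves increments of C minus
   the sums of dZ dW over these cells, which tend to 0; the error is at most the
   oscillation of Y times the tight quantity \sum |k_i|. *)
Lemma sum_kerr_to0 :
  to0 (fun n => kap (fun w x => \sum_(i < 2 ^ n) mid Y n i w x * kerr n i w x)).
Proof.
move=> e e0; have e4 : 0 < e / 4 by lra.
have [A A1 [N1 h1]] := tight_kerr e4; have A0 : 0 < A by lra.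
have eA : 0 < e / 4 / A by rewrite divr_gt0.
(* Order of choice: A controls the sum of |k_i| in measure, then the coarse level K makes the
   oscillation of Y small compared with 1 / A for every refinement, and only then does l grow. K >=
   N1 keeps all levels K + l within the range of the tightness bound. *)
have [K0 hK0] := osc_small eA; set K := maxn K0 N1.
have mYi i : (i < 2 ^ K)%N -> mea (Y (tau K i)).
  by move=> i_n; apply: tmea_tau => //; exact: ltnW.
have mki i l : (i < 2 ^ K)%N ->
    mea (fun w x => \sum_(j < 2 ^ l) kerr (K + l) (i * 2 ^ l + j) w x).
  by move=> i_n; apply: mea_sumo => j; apply: mea_kerr; exact: blk.
have [||N2 h2] := @to0_sum _ _ _ Pr L L0 (2 ^ K) (fun i l w x => Y (tau K i) w x *
    \sum_(j < 2 ^ l) kerr (K + l) (i * 2 ^ l + j) w x) _ _ _ e4.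
- by move=> i l i_n; apply: meaM; [exact: mYi|exact: mki].
- move=> i i_n; apply: (@to0M _ _ _ Pr L L0 _
    (fun l w x => \sum_(j < 2 ^ l) kerr (K + l) (i * 2 ^ l + j) w x)
    (fun l => Y (tau K i))).
  + by move=> l; apply: meaM; [exact: mYi|exact: mki].
  + by move=> l; exact: mki.
  + by move=> l; exact: mYi.
  + by apply: AE2T => w x _ l; rewrite mulrC.
  + exact: kerr_cvg.
  + by apply: tight_const => //; exact: mYi.
exists (K + N2)%N => n Kn; set l := (n - K)%N.
have nE : n = (K + l)%N by rewrite subnKC//; apply: leq_trans Kn; exact: leq_addr.
have Nl : (N2 <= l)%N by rewrite leq_subRL ?(leq_trans _ Kn)// leq_addr.
rewrite nE; have {}h2 := h2 l Nl.
have K0K : (K0 <= K)%N by rewrite leq_maxl.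
have {}hK0 := hK0 K l K0K.
have {}h1 : kap (fun w x => (\sum_(i < 2 ^ (K + l)) `|kerr (K + l) i w x|) / A) <= e / 4.
  by apply: h1; apply: leq_trans (leq_addr _ _); exact: leq_maxr.
pose X1 : rfun := fun w x => \sum_(k < 2 ^ (K + l))
  (mid Y (K + l) k w x - Y (tau K (k %/ 2 ^ l)) w x) * kerr (K + l) k w x.
have mX1 : mea X1.
  apply: mea_sumo => k; apply: meaM; last exact: mea_kerr.
  apply: meaB; first exact: mea_mid.
  by apply: tmea_tau => //; apply: ltnW; exact: low_le.
have mT : mea (fun w x => \sum_(i < 2 ^ (K + l)) `|kerr (K + l) i w x|).
  by apply: mea_sumo => i; apply: mea_norm; exact: mea_kerr.
have k1 : kap X1 <= e / 2.
  apply: (@le_trans _ _ (A * kap (osc K l) +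
      kap (fun w x => (\sum_(i < 2 ^ (K + l)) `|kerr (K + l) i w x|) / A))).
    apply: kap_mul => //; first exact: mea_osc.
    apply: AE2T => w x _; apply: (le_trans (ler_norm_sum _ _ _)).
    have osc0 : 0 <= osc K l w x by exact: bigmax_ge_id.
    rewrite normrM (ger0_norm osc0) ger0_norm ?sumr_ge0// mulr_sumr.
    apply: ler_sum => k _; rewrite normrM; apply: ler_wpM2r => //.
    exact: (le_bigmax 0 (fun k : 'I_(2 ^ (K + l)) =>
      `|mid Y (K + l) k w x - Y (tau K (k %/ 2 ^ l)) w x|) k).
  have : A * kap (osc K l) <= e / 4.
    apply: (@le_trans _ _ (A * (e / 4 / A))); first by rewrite ler_pM2l.
    by rewrite mulrC divfK// gt_eqF.
  by lra.
apply: (@le_trans _ _ (kap X1 + kap (fun w x => \sum_(i < 2 ^ K) Y (tau K i) w x *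
    \sum_(j < 2 ^ l) kerr (K + l) (i * 2 ^ l + j) w x))); last by lra.
apply: kap_add => //.
- by apply: mea_sumo => i; apply: meaM; [exact: mea_mid|exact: mea_kerr].
- by apply: mea_sumo => i; apply: meaM; [exact: mYi|exact: mki].
apply: AE2T => w x _.
have -> : \sum_(i < 2 ^ K) Y (tau K i) w x *
    \sum_(j < 2 ^ l) kerr (K + l) (i * 2 ^ l + j) w x =
    \sum_(k < 2 ^ (K + l)) Y (tau K (k %/ 2 ^ l)) w x * kerr (K + l) k w x.
  rewrite expnD -(sum_blocks _ _ (fun k =>
    Y (tau K (k %/ 2 ^ l)) w x * kerr (K + l) k w x)).
  apply: eq_bigr => i _; rewrite mulr_sumr; apply: eq_bigr => j _.
  by rewrite div_blk.
rewrite (_ : \sum_(i < 2 ^ (K + l)) _ = X1 w x +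
    \sum_(k < 2 ^ (K + l)) Y (tau K (k %/ 2 ^ l)) w x * kerr (K + l) k w x).
  exact: ler_normD.
by rewrite /X1 -big_split; apply: eq_bigr => k _ /=; ring.
Qed.

(** The bound is required for every K >= 1, so that K can be fixed by the tightness of [A] before
    [B] is let tend to 0. *)
Lemma to0_amgm (X A B : nat -> rfun) : (forall n, mea (X n)) ->
  (forall n, mea (A n)) -> (forall n, mea (B n)) ->
  (forall n w x K, 1 <= K -> `|X n w x| <= `|A n w x / K| + `|B n w x * K|) ->
  tight A -> to0 (fun n => kap (B n)) -> to0 (fun n => kap (X n)).
Proof.
move=> mX mA mB XAB tA tB e e0; have e2 : 0 < e / 2 by lra.
have [K K1 [N1 h1]] := tA _ e2.
have mK : mea (fun _ _ => K) by exact: mea_const.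
have mBK n : mea (fun w x => B n w x * K) by exact: meaM.
have [N2 h2] := @to0M _ _ _ Pr L L0 (fun n w x => B n w x * K) B (fun _ _ _ => K)
  mBK mB (fun _ => mK) (AE2T Pr (fun w x _ n => lexx _)) tB
  (tight_const Pr L0 mK) _ e2.
exists (maxn N1 N2) => n; rewrite geq_max => /andP[/h1 {}h1 /h2 {}h2].
apply: (@le_trans _ _ (kap (fun w x => A n w x / K) + kap (fun w x => B n w x * K)));
  last by lra.
apply: kap_add => //; first by apply: meaM => //; exact: mea_const.
by apply: AE2T => w x _; exact: XAB.
Qed.

Hypothesis tY : tight (fun n w x => \sum_(i < 2 ^ n) dl Y n i w x ^+ 2).

(* With r = dJ - Z_i dW and k = dC - dZ dW, the error dS - mid Z dW is r + k/2,
   so that the sum is \sum Y_i r_i + \sum (dY_i r_i + mid Y_i k_i) / 2. The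
   middle sum is handled by AM-GM, \sum r_i^2 tending to 0. *)
Lemma strat_err_to0 : to0 (fun n => kap (fun w x =>
  \sum_(i < 2 ^ n) mid Y n i w x * (dl S n i w x - mid Z n i w x * dl W n i w x))).
Proof.
have mdY n i : (i < 2 ^ n)%N -> mea (dl Y n i) by move=> ?; exact: mea_dl.
have mr n i : (i < 2 ^ n)%N -> mea (rerr Z J n i) by move=> ?; exact: mea_rerr.
have m1 n : mea (fun w x => \sum_(i < 2 ^ n) Y (tau n i) w x * rerr Z J n i w x).
  apply: (m_sum (f := fun n i w x => Y (tau n i) w x * rerr Z J n i w x)) => {}n i i_n.
  by apply: meaM; [apply: tmea_tau => //; exact: ltnW|exact: mr].
have m2 n : mea (fun w x => \sum_(i < 2 ^ n) dl Y n i w x * rerr Z J n i w x).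
  apply: (m_sum (f := fun n i w x => dl Y n i w x * rerr Z J n i w x)) => {}n i i_n.
  by apply: meaM; [exact: mdY|exact: mr].
have m3 n : mea (fun w x => \sum_(i < 2 ^ n) mid Y n i w x * kerr n i w x).
  apply: (m_sum (f := fun n i w x => mid Y n i w x * kerr n i w x)) => {}n i i_n.
  by apply: meaM; [exact: mea_mid|exact: mea_kerr].
have h2 : to0 (fun n => kap (fun w x =>
    \sum_(i < 2 ^ n) dl Y n i w x * rerr Z J n i w x)).
  apply: (to0_amgm m2 (m_sqr mdY) (m_sqr mr)) => //; last exact: sum_rerr2_to0.
  move=> n w x K K1; have K0 : 0 < K by lra.
  have sA : 0 <= \sum_(i < 2 ^ n) dl Y n i w x ^+ 2.
    by apply: sumr_ge0 => i _; exact: sqr_ge0.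
  have sB : 0 <= \sum_(i < 2 ^ n) rerr Z J n i w x ^+ 2.
    by apply: sumr_ge0 => i _; exact: sqr_ge0.
  rewrite (ger0_norm (divr_ge0 sA (ltW K0))) (ger0_norm (mulr_ge0 sB (ltW K0))).
  rewrite !mulr_suml -big_split; apply: (le_trans (ler_norm_sum _ _ _)).
  apply: ler_sum => i _ /=; move: (dl Y _ _ _ _) (rerr _ _ _ _ _ _) => a b.
  have -> : a * b = a * (b * K) / K by field; rewrite gt_eqF.
  have -> : a ^+ 2 / K + b ^+ 2 * K = (a ^+ 2 + (b * K) ^+ 2) / K.
    by field; rewrite gt_eqF.
  rewrite normrM (gtr0_norm (_ : 0 < K^-1)) ?invr_gt0// ler_pM2r ?invr_gt0//.
  move: (b * K) => c; have := sqr_ge0 (a + c); have := sqr_ge0 (a - c).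
  have := sqr_ge0 a; have := sqr_ge0 c.
  by rewrite ler_norml => *; apply/andP; split; nra.
apply: (@to0D _ _ _ Pr L L0 _ (fun n w x =>
    \sum_(i < 2 ^ n) Y (tau n i) w x * rerr Z J n i w x)
  (fun n w x => \sum_(i < 2 ^ n) dl Y n i w x * rerr Z J n i w x +
    \sum_(i < 2 ^ n) mid Y n i w x * kerr n i w x)) => //.
- move=> n; apply: mea_sumo => i; apply: meaM; first exact: mea_mid.
  apply: meaB; first exact: mea_dl.
  by apply: meaM; [exact: mea_mid|exact: mea_dl].
- by move=> n; apply: meaD; [exact: m2|exact: m3].
- apply: AE2T => w x _ n; set s1 := \sum_(i < _) _ * rerr _ _ _ _ _ _.
  set s2 := \sum_(i < _) _ * rerr _ _ _ _ _ _; set s3 := \sum_(i < _) _ * kerr _ _ _ _.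
  rewrite [X in `|X|](_ : _ = s1 + 2^-1 * (s2 + s3)); last first.
    rewrite /s1 /s2 /s3 -big_split mulr_sumr -big_split; apply: eq_bigr => i _ /=.
    by rewrite /mid /rerr /kerr /dl !defS; field.
  apply: (le_trans (ler_normD _ _)); rewrite lerD2l normrM gtr0_norm ?invr_gt0//.
  by have := normr_ge0 (s2 + s3); lra.
- exact: sum_rerr_to0.
apply: (@to0D _ _ _ Pr L L0 _ (fun n w x =>
    \sum_(i < 2 ^ n) dl Y n i w x * rerr Z J n i w x)
  (fun n w x => \sum_(i < 2 ^ n) mid Y n i w x * kerr n i w x)) => //.
- by move=> n; apply: meaD; [exact: m2|exact: m3].
- by apply: AE2T => w x _ n; exact: ler_normD.
exact: sum_kerr_to0.
Qed.

End Bracket.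

(** * Conservation of the symplectic form *)

Lemma nice_scale (c : R) Y : nice Y -> nice (fun s w x => c * Y s w x).
Proof.
move=> [mY aY bY uY]; split.
- by move=> s *; apply: meaM; [exact: mea_const|exact: mY].
- move=> s x t0s st Dx; apply: (adpM filtF); last exact: aY.
  by apply: (adp_cst filtF); [exact: le_trans t0s|exact: le_trans tT].
- move: bY; apply: aeS => w [B hB]; exists (`|c| * B) => s x *.
  by rewrite normrM ler_wpM2l// hB.
move: uY; apply: aeS => w hw e e0.
have c1 : 0 < `|c| + 1 by rewrite ltr_wpDl.
have [dlt dlt0 hd] := hw (e / (`|c| + 1)) (divr_gt0 e0 c1).
exists dlt => // s s' x h1 h2 h3 h4 Dx ss.
have := hd s s' x h1 h2 h3 h4 Dx ss.
rewrite ler_pdivlMr// -mulrBr normrM => h; apply: le_trans h.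
by rewrite mulrC ler_wpM2l// lerDl.
Qed.

Lemma nice_path Y : nice Y -> {ae Pr, forall w, path_coef L t0 t (fun s => Y s w)}.
Proof.
move=> [mY _ bY uY]; move: bY uY; apply: aeS2 => w [B hB] hw; split.
- by move=> s; rewrite /= in_itv/= => /andP[t0s st]; apply: mea_sec; exact: mY.
- exists B => s x; rewrite /= in_itv/= => /andP[t0s st] Dx; exact: hB.
move=> e /hw[dlt dlt0 hd]; exists dlt => // s s' x.
rewrite /= !in_itv/= => /andP[? ?] /andP[? ?] Dx ss; exact: hd.
Qed.

(* The real and imaginary parts of the linearized equation, with c = -1, Y = Q,
   X = eps P and with c = 1, Y = P, X = eps Q respectively; b is the drift. *)
Definition half_equation (c : R) X Y b S := exists J C : field,
  [/\ ito X J, brk X C, forall s w x, S s w x = J s w x + 2^-1 * C s w x,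
    {ae Pr, forall w, space_time_L1 L t0 t (fun s => b s w)} &
    AE2 (fun w x => forall n i, (i < 2 ^ n)%N ->
      c * dl Y n i w x + drift_incr t0 t (fun s => b s w) n i x = dl S n i w x)].

Lemma half_equation_tmea c X Y b S : half_equation c X Y b S -> tmea S.
Proof. by move=> [J [C [iJ bC defS _ _]]]; exact: (tmea_strat iJ bC defS). Qed.

(** The equation reads c dY = dS - v with v the drift increment, whence dY^2 <= 2 dS^2 + 2 v^2 as
    c^2 = 1. The sum of dS^2 is tight by [tight_dlS2], that of v^2 is bounded on each path by
    [drift_sqr]. *)
Lemma tight_half_equation c X Y b S : c ^+ 2 = 1 -> nice X -> tmea Y ->
  half_equation c X Y b S ->
  tight (fun n w x => \sum_(i < 2 ^ n) dl Y n i w x ^+ 2).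
Proof.
move=> c1 nX mY hS; have mS := half_equation_tmea hS.
have [J [C [iJ bC defS ib eqS]]] := hS.
have tS := tight_dlS2 nX iJ bC defS.
have m2 (Z : field) : tmea Z -> forall n, mea (fun w x => \sum_(i < 2 ^ n) dl Z n i w x ^+ 2).
  by move=> mZ n; apply: mea_sumo => i; apply: meaX; exact: mea_dl.
have mS2 n : mea (fun w x => 2 * \sum_(i < 2 ^ n) dl S n i w x ^+ 2).
  by apply: meaM; [exact: mea_const|exact: m2].
have tS2 : tight (fun n w x => 2 * \sum_(i < 2 ^ n) dl S n i w x ^+ 2).
  apply: (@tightM _ _ _ Pr L L0 _ (fun n w x => 2)
    (fun n w x => \sum_(i < 2 ^ n) dl S n i w x ^+ 2)) => //.
  - by move=> n; exact: mea_const.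
  - exact: m2.
  - by apply: AE2T => w x _ n.
  - by apply: tight_const => //; exact: mea_const.
(* Stands for the drift contribution: built from Y and S alone, it is measurable in (w, x), and the
   equation bounds it path by path. *)
pose V n : rfun := fun w x => Num.max 0 (\sum_(i < 2 ^ n) dl Y n i w x ^+ 2 -
    2 * \sum_(i < 2 ^ n) dl S n i w x ^+ 2).
have mV n : mea (V n).
  by apply: mea_max; [exact: mea_const|apply: meaB => //; exact: m2].
apply: (tight_le2 L0 _ _ _ _ tS2 (Z := V)) => //.
- exact: m2.
- apply: AE2T => w x _ n; rewrite !ger0_norm; last 3 first.
  + by rewrite /V le_max lexx.
  + by rewrite mulr_ge0// sumr_ge0// => i _; exact: sqr_ge0.
  + by rewrite sumr_ge0// => i _; exact: sqr_ge0.
  by rewrite -lerBlDl /V le_max lexx orbT.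
apply: tight_bdd => //.
have isec : AE2 (fun w x => mu.-integrable `[t0, t] (EFin \o (fun s => b s w x))).
  by move: ib; apply: aeS => w; exact: drift_section.
move: (AE2I isec eqS); apply: AE2S => w x Dx [ibx eqx].
exists (2 * (\int[mu]_(s in `[t0, t]) `|b s w x|) ^+ 2) => n.
have := drift_sqr t0t n ibx => le.
rewrite ger0_norm /V ?le_max ?lexx// ge_max mulr_ge0 ?sqr_ge0//= lerBlDr.
apply: (le_trans _ (lerD (ler_wpM2l (ler0n R 2) le) (lexx _))).
rewrite !mulr_sumr -big_split; apply: ler_sum => i _ /=.
have := eqx n i (ltn_ord i); rewrite /drift_incr.
move: (dl Y _ _ _ _) (dl S _ _ _ _) (_ - _) => y s v e.
have -> : y ^+ 2 = (c * y) ^+ 2 by rewrite exprMn c1 mul1r.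
have -> : c * y = s - v by rewrite -e addrK.
by have := sqr_ge0 (s + v); nra.
Qed.

Section Conservation.
Variables (eps : R) (P1 Q1 P2 Q2 a1 c1 a2 c2 SP1 SQ1 SP2 SQ2 : field).
Let scaled X : field := fun s w x => eps * X s w x.
Hypothesis (nP1 : nice P1) (nQ1 : nice Q1) (nP2 : nice P2) (nQ2 : nice Q2).
Hypothesis hP1 : half_equation (-1) (scaled P1) Q1 a1 SP1.
Hypothesis hQ1 : half_equation 1 (scaled Q1) P1 c1 SQ1.
Hypothesis hP2 : half_equation (-1) (scaled P2) Q2 a2 SP2.
Hypothesis hQ2 : half_equation 1 (scaled Q2) P2 c2 SQ2.
Hypothesis zero : {ae Pr, forall w, {ae mu, forall s, s \in `[t0, t] ->
  \int[mu]_(x in D) drift_density (fun s => P1 s w) (fun s => Q1 s w)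
    (fun s => P2 s w) (fun s => Q2 s w) (fun s => a1 s w) (fun s => c1 s w)
    (fun s => a2 s w) (fun s => c2 s w) s x = 0}}.

Definition strat_err Y X S n : rfun := fun w x => \sum_(i < 2 ^ n)
  mid Y n i w x * (dl S n i w x - mid (scaled X) n i w x * dl W n i w x).

Let tight_scaled X : tmea X -> tight (fun n w x => \sum_(i < 2 ^ n) dl X n i w x ^+ 2) ->
  tight (fun n w x => \sum_(i < 2 ^ n) dl (scaled X) n i w x ^+ 2).
Proof.
move=> mX tX; have msX : tmea (scaled X).
  by move=> s *; apply: meaM; [exact: mea_const|exact: mX].
apply: (@tightM _ _ _ Pr L L0 _ (fun n w x => eps ^+ 2)
  (fun n w x => \sum_(i < 2 ^ n) dl X n i w x ^+ 2)) => //.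
- by move=> n; apply: mea_sumo => i; apply: meaX; exact: mea_dl.
- by move=> n; exact: mea_const.
- by move=> n; apply: mea_sumo => i; apply: meaX; exact: mea_dl.
- apply: AE2T => w x _ n; rewrite mulr_sumr le_eqVlt; apply/orP; left.
  apply/eqP; congr `|_|; apply: eq_bigr => i _.
  by rewrite /dl /scaled -mulrBr exprMn.
- by apply: tight_const => //; exact: mea_const.
Qed.

Let strat_err_small c Y X Z b S : nice Y -> nice X ->
  half_equation c (scaled X) Z b S ->
  tight (fun n w x => \sum_(i < 2 ^ n) dl Y n i w x ^+ 2) ->
  tight (fun n w x => \sum_(i < 2 ^ n) dl X n i w x ^+ 2) ->
  to0 (fun n => kap (strat_err Y X S n)).
Proof.
move=> nY nX [J [C [iJ bC defS _ _]]] tY tX.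
apply: (strat_err_to0 nY (nice_scale eps nX) iJ bC defS) => //.
by apply: tight_scaled => //; have [] := nX.
Qed.

Let mea_err Y X S n : tmea Y -> tmea X -> tmea S -> mea (strat_err Y X S n).
Proof.
move=> mY mX mS; apply: mea_sumo => i; apply: meaM; first exact: mea_mid.
apply: meaB; first exact: mea_dl.
apply: meaM; last exact: mea_dl.
apply: mea_mid => // s *.
by apply: meaM; [exact: mea_const|exact: mX].
Qed.

Let om s : rfun := fun w x => P1 s w x * Q2 s w x - P2 s w x * Q1 s w x.

Let dens w s x := drift_density (fun s => P1 s w) (fun s => Q1 s w)
    (fun s => P2 s w) (fun s => Q2 s w) (fun s => a1 s w) (fun s => c1 s w)
    (fun s => a2 s w) (fun s => c2 s w) s x.

Let good w := [/\ [/\ path_coef L t0 t (fun s => P1 s w), path_coef L t0 t (fun s => Q1 s w),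
    path_coef L t0 t (fun s => P2 s w) & path_coef L t0 t (fun s => Q2 s w)] &
  [/\ space_time_L1 L t0 t (fun s => a1 s w), space_time_L1 L t0 t (fun s => c1 s w),
    space_time_L1 L t0 t (fun s => a2 s w) & space_time_L1 L t0 t (fun s => c2 s w)]].

Let ae_good : {ae Pr, forall w, good w}.
Proof.
have [_ [_ [_ _ _ i1 _]]] := hP1; have [_ [_ [_ _ _ i2 _]]] := hQ1.
have [_ [_ [_ _ _ i3 _]]] := hP2; have [_ [_ [_ _ _ i4 _]]] := hQ2.
have [n1 n2] := (nice_path nP1, nice_path nQ1).
have [n3 n4] := (nice_path nP2, nice_path nQ2).
have j12 := aeS2 (fun w p q => conj p q) i1 i2.
have j34 := aeS2 (fun w p q => conj p q) i3 i4.
have m12 := aeS2 (fun w p q => conj p q) n1 n2.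
have m34 := aeS2 (fun w p q => conj p q) n3 n4.
have j := aeS2 (fun w p q => conj p q) j12 j34.
have m := aeS2 (fun w p q => conj p q) m12 m34.
by move: m j; apply: aeS2 => w [[? ?] [? ?]] [[? ?] [? ?]].
Qed.

(* By the midpoint product rule the increment of P1 Q2 - P2 Q1 is the drift sum
   plus Stratonovich errors: the terms eps * mid * mid * dW cancel in pairs. *)
Lemma om_drift : AE2 (fun w x => om t w x - om t0 w x -
  \int[mu]_(s in `[t0, t]) dens w s x = 0).
Proof.
have [mP1 _ _ _] := nP1; have [mP2 _ _ _] := nP2.
have [mQ1 _ _ _] := nQ1; have [mQ2 _ _ _] := nQ2.
have N1 : (-1) ^+ 2 = 1 :> R by rewrite sqrrN expr1n.
have sc X : nice X -> nice (scaled X) by exact: nice_scale.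
have tQ1 := tight_half_equation N1 (sc _ nP1) mQ1 hP1.
have tQ2 := tight_half_equation N1 (sc _ nP2) mQ2 hP2.
have tP1 := tight_half_equation (expr1n _ _) (sc _ nQ1) mP1 hQ1.
have tP2 := tight_half_equation (expr1n _ _) (sc _ nQ2) mP2 hQ2.
have mSP1 := half_equation_tmea hP1; have mSP2 := half_equation_tmea hP2.
have mSQ1 := half_equation_tmea hQ1; have mSQ2 := half_equation_tmea hQ2.
(* The noise parts of the two errors in [V1] are both eps mid P1 mid P2 dW and cancel; likewise with
   Q1 and Q2 in [V2]. Only products of midpoints with increments of the Stratonovich integrals
   remain. *)
pose V1 n : rfun := fun w x => strat_err P2 P1 SP1 n w x - strat_err P1 P2 SP2 n w x.
pose V2 n : rfun := fun w x => strat_err Q2 Q1 SQ1 n w x - strat_err Q1 Q2 SQ2 n w x.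
have mV1 n : mea (V1 n) by apply: meaB; exact: mea_err.
have mV2 n : mea (V2 n) by apply: meaB; exact: mea_err.
have k1 : to0 (fun n => kap (V1 n)).
  apply: (@to0D _ _ _ Pr L L0 _ (strat_err P2 P1 SP1) (strat_err P1 P2 SP2)) => //.
  - by move=> n; exact: mea_err.
  - by move=> n; exact: mea_err.
  - by apply: AE2T => w x _ n; exact: ler_normB.
  - exact: strat_err_small hP1 _ _.
  - exact: strat_err_small hP2 _ _.
have k2 : to0 (fun n => kap (V2 n)).
  apply: (@to0D _ _ _ Pr L L0 _ (strat_err Q2 Q1 SQ1) (strat_err Q1 Q2 SQ2)) => //.
  - by move=> n; exact: mea_err.
  - by move=> n; exact: mea_err.
  - by apply: AE2T => w x _ n; exact: ler_normB.
  - exact: strat_err_small hQ1 _ _.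
  - exact: strat_err_small hQ2 _ _.
apply: (@kap_pointwise_lim _ _ _ Pr L L0 (fun n w x => V1 n w x + V2 n w x)).
- by move=> n; exact: meaD.
- have [_ [_ [_ _ _ _ e1]]] := hP1; have [_ [_ [_ _ _ _ e2]]] := hQ1.
  have [_ [_ [_ _ _ _ e3]]] := hP2; have [_ [_ [_ _ _ _ e4]]] := hQ2.
  have cv : AE2 (fun w x => drift_sum t0 t (fun s => P1 s w) (fun s => Q1 s w)
      (fun s => P2 s w) (fun s => Q2 s w) (fun s => a1 s w) (fun s => c1 s w)
      (fun s => a2 s w) (fun s => c2 s w) n x @[n --> \oo] -->
      \int[mu]_(s in `[t0, t]) dens w s x).
    move: ae_good; apply: aeS => w [[? ? ? ?] [? ? ? ?]].
    exact: drift_sum_cvg.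
  have e := AE2I (AE2I e1 e2) (AE2I e3 e4).
  move: (AE2I cv e); apply: AE2S => w x Dx [{}cv [[{}e1 {}e2] [{}e3 {}e4]]].
  rewrite (_ : (fun n => V1 n w x + V2 n w x) = (fun n => (om t w x - om t0 w x) -
    drift_sum t0 t (fun s => P1 s w) (fun s => Q1 s w)
      (fun s => P2 s w) (fun s => Q2 s w) (fun s => a1 s w) (fun s => c1 s w)
      (fun s => a2 s w) (fun s => c2 s w) n x)).
    by apply: cvgB => //; exact: cvg_cst.
  apply/funext => n; rewrite /V1 /V2 /strat_err /drift_sum.
  have -> : om t w x - om t0 w x =
      \sum_(i < 2 ^ n) (om (tau n i.+1) w x - om (tau n i) w x).
    rewrite -(big_mkord xpredT (fun i => om (tau n i.+1) w x - om (tau n i) w x)).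
    by rewrite telescope_sumr// tau_last// tau0.
  rewrite -!sumrB -big_split; apply: eq_bigr => i _ /=.
  have {}e1 := e1 n i (ltn_ord i); have {}e2 := e2 n i (ltn_ord i).
  have {}e3 := e3 n i (ltn_ord i); have {}e4 := e4 n i (ltn_ord i).
  rewrite -e1 -e2 -e3 -e4 /om /mid /dl /scaled.
  by field.
apply: (@to0D _ _ _ Pr L L0 _ V1 V2) => //.
- by move=> n; exact: meaD.
- by apply: AE2T => w x _ n; exact: ler_normD.
Qed.

Lemma om_integral : {ae Pr, forall w,
  \int[mu]_(x in D) om t w x = \int[mu]_(x in D) om t0 w x}.
Proof.
have mD := measurable_dom L.
have At : `[t0, t]%classic t by rewrite /= in_itv/= lexx ltW.
have At0 : `[t0, t]%classic t0 by rewrite /= in_itv/= lexx ltW.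
move: (aeS2 (fun w p q => conj p q) om_drift zero) ae_good.
apply: aeS2 => w [od z] [[p1 p2 p3 p4] [i1 i2 i3 i4]].
have io s : `[t0, t]%classic s -> mu.-integrable D (EFin \o om s w).
  move=> As; rewrite (_ : _ \o _ =
    (fun x => (P1 s w x * Q2 s w x)%:E - (P2 s w x * Q1 s w x)%:E)%E)//.
  apply: integrableB => //; apply: inU_integrableM;
    [exact: (path_coef_inU L0 p1)|exact: (path_coef_inU L0 p4)|
     exact: (path_coef_inU L0 p3)|exact: (path_coef_inU L0 p2)].
apply/eqP; rewrite -subr_eq0 -RintegralB//; [|exact: io..].
have [md fd] := space_time_L1_density t0t p1 p2 p3 p4 i1 i2 i3 i4.
have mA : measurable (`[t0, t]%classic : set (measurableTypeR R)) by exact: measurable_itv.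
rewrite -(drift_density_integral t0t p1 p2 p3 p4 i1 i2 i3 i4 z).
apply/eqP; congr fine; apply: ae_eq_integral => //.
- apply/measurable_EFinP; apply: measurable_funB; apply/measurable_EFinP.
    exact: measurable_int (io t At).
  exact: measurable_int (io t0 At0).
- exact: measurable_int (rect_integrable mA mD md fd).
move: od; apply: aeS => x h Dx; congr EFin; apply/eqP.
by rewrite -subr_eq0 h.
Qed.

End Conservation.

End RiemannSums.

(** * Continuous functions on a rectangle *)

Section Rectangle.
Context {R : realType}.
Variables (a b c e : R) (g : R * R -> R).
Local Notation A := (`[a, b] `*` `[c, e] : set (R * R)).
Hypothesis cg : {within A, continuous g}.

Let compactA : compact A.
Proof. by apply: compact_setX; exact: segment_compact. Qed.

Lemma rectangle_bounded : exists B, forall s x, s \in `[a, b] -> x \in `[c, e] ->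
  `|g (s, x)| <= B.
Proof.
have [M [_ hM]] := compact_bounded (continuous_compact cg compactA).
exists (M + 1) => s x sab xce; apply: hM; first by rewrite ltrDl.
by exists (s, x).
Qed.

(** Heine-Cantor for continuity relative to the rectangle: compactness turns the local moduli into a
    common one. *)
Lemma rectangle_unif (eps : R) : 0 < eps -> exists2 dlt : R, 0 < dlt &
  forall s s' x x', s \in `[a, b] -> s' \in `[a, b] -> x \in `[c, e] -> x' \in `[c, e] ->
    `|s - s'| <= dlt -> `|x - x'| <= dlt -> `|g (s, x) - g (s', x')| <= eps.
Proof.
move=> eps0; have [/(_ compactA) nc _] := compact_near_coveringP A.
pose P (dlt : R) p := A p -> forall q, A q -> `|p.1 - q.1| <= dlt ->
  `|p.2 - q.2| <= dlt -> `|g p - g q| <= eps.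
have : \forall dlt \near 0^'+, A `<=` P dlt.
  apply: nc => p Ap.
  have /subspace_continuousP/(_ p Ap)/cvgrPdist_le/(_ (eps / 2)) := cg.
  rewrite divr_gt0// => /(_ isT); rewrite near_withinE /= => /nbhs_ballP[r /= r0 hr].
  have r2 : 0 < r / 2 by rewrite divr_gt0.
  (* With both radii halved, [p'] and [q] stay within r of [p], where [g] differs from [g p] by at
     most eps / 2. *)
  exists (ball p (r / 2), [set dlt | 0 < dlt < r / 2]).
    split => /=; first exact: nbhsx_ballx.
    exists (r / 2) => // y /=; rewrite sub0r normrN => h1 h2.
    by rewrite h2 /=; apply: le_lt_trans h1; exact: ler_norm.
  move=> [p' dlt] [/= [h1 h2] /andP[d0 dr]] Ap' q Aq q1 q2 /=.
  have k1 : ball p r p'.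
    by split => /=; [move: h1|move: h2]; rewrite /ball /= => h; lra.
  have k2 : ball p r q.
    split; rewrite /ball /=.
      have := ler_distD p'.1 p.1 q.1; move: h1; rewrite /ball /= => h1 h3; lra.
    have := ler_distD p'.2 p.2 q.2; move: h2; rewrite /ball /= => h2 h3; lra.
  have {}k1 : `|g p - g p'| <= eps / 2 := hr _ k1 Ap'.
  have {}k2 : `|g p - g q| <= eps / 2 := hr _ k2 Aq.
  have := ler_distD (g p) (g p') (g q); rewrite (distrC (g p') (g p)); move: k1 k2.
  by move: `|g p - g p'| `|g p - g q| `|g p' - g q| => *; lra.
move=> [dl /= dl0 h]; exists (dl / 2); first by rewrite divr_gt0.
move=> s s' x x' s1 s2 x1 x2 ss xx.
apply: (h (dl / 2) _ _ (s, x) _ _ (s', x')) => //=; last by rewrite divr_gt0.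
by rewrite sub0r normrN gtr0_norm; lra.
Qed.

End Rectangle.

(** * From limits over partitions to dyadic grids *)

Section Leaves.
Context {R : realType} {d : measure_display} {Omega : measurableType d}.
Variables (Pr : probability Omega R) (L r0 t0 T : R).
Variables (F : R -> set (set Omega)).
Local Notation mu := (@lebesgue_measure R).
Local Notation D := (dom L).
Local Notation rfun := (Omega -> R -> R).
Local Notation field := (@field R d Omega R).
Local Notation mea := (@mea R d Omega L).
Local Notation AE2 := (@AE2 R d Omega Pr L).
Local Notation kap := (@kap R d Omega Pr L).
Hypothesis L0 : 0 < L.
Implicit Types (Y W J C : field).

(** [prob_kap] converts bounds in probability on L^p norms into bounds on [kap]; the limit over all
    partitions is specialised to one sequence of vanishing mesh. *)
Lemma cvg_in_prob_kap p a b (Y : seq R -> rfun) (Z : rfun) (s_ : nat -> seq R) :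
  (0 < p)%N -> (forall l, mea (fun w x => Y (s_ l) w x - Z w x)) ->
  (forall l, itv_partition a b (s_ l)) ->
  (forall r : R, 0 < r -> exists N, forall l, (N <= l)%N -> forall i,
     (i < size (s_ l))%N -> knot a b (s_ l) i.+1 - knot a b (s_ l) i < r) ->
  cvg_in_prob Pr L p (mesh_to_0 a b) Y Z ->
  to0 (fun l => kap (fun w x => Y (s_ l) w x - Z w x)).
Proof.
move=> p0 mYZ part mesh cv e e0; have [dl dl0 hdl] := prob_kap Pr L0 p0 e0.
have := cv _ dl0 => {}cv; have := cv [set y | (y < dl%:E)%E].
case.
  exact: (@nbhs_open_ereal_lt _ 0 (fun=> dl)).
move=> r r_gt0 hr; have [N hN] := mesh _ r_gt0.
exists N => l Nl; apply: hdl => //; apply: hr => //; exact: hN.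
Qed.

Variable t : R.
Hypothesis t0t : t0 < t.
Hypothesis tT : t <= T.
Hypothesis r0t0 : r0 <= t0.
Local Notation tau := (tau t0 t).

Lemma measurable_field_tmea Y : measurable_field L T t0 Y -> tmea L t0 t Y.
Proof.
by move=> mY s t0s st; apply: mY; rewrite in_itv/= t0s (le_trans st).
Qed.

Lemma gridseq_mesh0 n i (r : R) : 0 < r -> exists N, forall l, (N <= l)%N -> forall j,
  (j < size (gridseq t0 t (n + l) (i * 2 ^ l)))%N ->
  knot t0 (tau n i) (gridseq t0 t (n + l) (i * 2 ^ l)) j.+1 -
  knot t0 (tau n i) (gridseq t0 t (n + l) (i * 2 ^ l)) j < r.
Proof.
move=> r0'; have r2 : 0 < r / 2 by lra.
have [N hN] := step_cvg0 t0t r2; exists N => l Nl j jl.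
rewrite -(tauM t0 t n l i) gridseq_mesh//.
by have := hN (n + l)%N (leq_trans Nl (leq_addl _ _)); lra.
Qed.

(** [g s s'] is the summand over a cell with ends s and s', so that Ito sums (p = 2) and bracket
    sums (p = 1) are treated alike. *)
Lemma grid_kap p (g : R -> R -> rfun) J n i : (0 < p)%N ->
  (forall s s', t0 <= s -> s <= t -> t0 <= s' -> s' <= t -> mea (g s s')) ->
  tmea L t0 t J -> (i <= 2 ^ n)%N ->
  cvg_in_prob Pr L p (mesh_to_0 t0 (tau n i))
    (fun s w x => \sum_(j < size s)
       g (knot t0 (tau n i) s j) (knot t0 (tau n i) s j.+1) w x) (J (tau n i)) ->
  to0 (fun l => kap (fun w x => \sum_(j < i * 2 ^ l)
    g (tau (n + l) j) (tau (n + l) j.+1) w x - J (tau n i) w x)).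
Proof.
move=> p0 mg mJ i_n cv.
pose s_ l := gridseq t0 t (n + l) (i * 2 ^ l).
pose Sg (s : seq R) : rfun := fun w x => \sum_(j < size s)
  g (knot t0 (tau n i) s j) (knot t0 (tau n i) s j.+1) w x.
have E l : (fun w x => \sum_(j < i * 2 ^ l)
    g (tau (n + l) j) (tau (n + l) j.+1) w x - J (tau n i) w x) =
    (fun w x => Sg (s_ l) w x - J (tau n i) w x).
  apply/funext => w; apply/funext => x; rewrite /Sg /s_ size_gridseq.
  rewrite -(tauM t0 t n l i); congr (_ - _); apply: eq_bigr => j _.
  by rewrite !knot_gridseq// ltnW.
have mE l : mea (fun w x => Sg (s_ l) w x - J (tau n i) w x).
  rewrite -E; apply: meaB; last by apply: mJ; [exact: tau_ge|exact: tau_le].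
  apply: mea_sumo => j.
  have jn : (j < 2 ^ (n + l))%N.
    by apply: leq_trans (ltn_ord j) _; rewrite expnD leq_mul2r i_n orbT.
  by apply: mg; [exact: tau_ge|apply: tau_le => //; exact: ltnW|
    exact: tau_ge|exact: tau_le].
have part l : itv_partition t0 (tau n i) (s_ l).
  by rewrite /s_ -(tauM t0 t n l i); exact: gridseq_partition.
move=> e e0; have [N hN] := cvg_in_prob_kap p0 mE part (gridseq_mesh0 n i) cv e0.
by exists N => l Nl; rewrite E; exact: hN.
Qed.

Let tau_in n i : (i <= 2 ^ n)%N -> tau n i \in `[t0, T].
Proof.
by move=> i_n; rewrite in_itv/= tau_ge//= (le_trans _ tT)// tau_le.
Qed.

Lemma ito_integral_ito Y W J : tmea L t0 t Y -> tmea L t0 t W ->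
  ito_integral Pr L t0 T Y W J -> ito Pr L t0 t W Y J.
Proof.
move=> mY mW [mJ cJ]; have {}mJ := measurable_field_tmea mJ.
split=> // n i i_n.
apply: (grid_kap (p := 2) (g := fun s s' w x => Y s w x * (W s' w x - W s w x))) => //.
  by move=> s s' *; apply: meaM; [exact: mY|apply: meaB; exact: mW].
by apply: cJ; exact: tau_in.
Qed.

Lemma bracket_brk Y W C : tmea L t0 t Y -> tmea L t0 t W ->
  bracket Pr L t0 T Y W C -> brk Pr L t0 t W Y C.
Proof.
move=> mY mW [mC cC bC]; have {}mC := measurable_field_tmea mC.
split=> // [n i i_n|].
  apply: (grid_kap (p := 1) (g := fun s s' w x =>
    (Y s' w x - Y s w x) * (W s' w x - W s w x))) => //.
    by move=> s s' *; apply: meaM; apply: meaB; [exact: mY|exact: mY|exact: mW|exact: mW].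
  by apply: cC; exact: tau_in.
move: bC; apply: AE2S => w x _ /(bounded_variationl (ltW t0t) tT)[B hB].
exists B => n; apply: hB; exists (gridseq t0 t n (2 ^ n)).
  by rewrite -[X in itv_partition _ X](tau_last t0 t n); exact: gridseq_partition.
rewrite /variation size_gridseq big_mkord; apply: eq_bigr => i _ /=.
have kE j : (j <= 2 ^ n)%N -> nth t (t0 :: gridseq t0 t n (2 ^ n)) j = tau n j.
  by move=> jn; rewrite -(knot_gridseq t0 t n jn) /knot tau_last.
by rewrite -[nth _ _ _]/(nth t (t0 :: gridseq t0 t n (2 ^ n)) i.+1) !kE// ltnW.
Qed.

Lemma adapted_continuous_nice Y : adapted_continuous Pr F L t0 T Y ->
  nice Pr L r0 t0 t T F Y.
Proof.
have inD s : t0 <= s -> s <= t -> s \in `[t0, T].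
  by move=> t0s st; rewrite in_itv/= t0s (le_trans st).
move=> [mY aY cY]; split.
- exact: measurable_field_tmea.
- move=> s x t0s st Dx; split; first exact: le_trans t0s.
  by split; [exact: le_trans tT|apply: aY => //; exact: inD].
- move: cY; apply: aeS => w /rectangle_bounded[B hB]; exists B => s x t0s st Dx.
  by apply: (hB s x) => //; exact: inD.
move: cY; apply: aeS => w cw e e0; have [dl dl0 hdl] := rectangle_unif cw e0.
exists dl => // s s' x t0s st t0s' st' Dx ss.
by apply: (hdl s s' x x) => //; [exact: inD|exact: inD|rewrite subrr normr0 ltW].
Qed.

End Leaves.

(** * The phase flow *)

(** Multiplication by i moves the imaginary part, with a minus sign, to the real part: hence the
    factors -1 and 1 of [half_equation]. *)
Lemma schroedinger_parts {R : realType} (z p : R[i]) (u v : R) (S : R[i]) :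
  ('i)%C * (z - p) + (u +i* v)%C = S ->
  - 1 * (complex.Im z - complex.Im p) + u = complex.Re S /\
  1 * (complex.Re z - complex.Re p) + v = complex.Im S.
Proof.
by case: z => a b; case: p => a' b' <- /=; split; ring.
Qed.

Section Flow.
Context {R : realType} {d : measure_display} {Omega : measurableType d}.
Variables (Pr : probability Omega R) (L t0 T eps r0 : R).
Variables (Psi : R -> R -> R -> R) (Q Qhalf : (R -> R) -> R -> R).
Variables (e : nat -> R -> R) (F : R -> set (set Omega)).
Variables (beta : nat -> R -> Omega -> R) (W : @field R d Omega R).
Local Notation mu := (@lebesgue_measure R).
Local Notation D := (dom L).
Local Notation C := R[i].
Local Notation rfun := (Omega -> R -> R).
Local Notation field := (@field R d Omega).
Local Notation mea := (@mea R d Omega L).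
Local Notation AE2 := (@AE2 R d Omega Pr L).
Hypothesis L0 : 0 < L.
Hypothesis t0T : t0 < T.
Hypothesis r0t0 : r0 <= t0.
Hypothesis bQ : bounded_op L Q.
Hypothesis be : orthonormal_basis L e.
Hypothesis trQ : finite_trace L Q e.
Hypothesis sqQ : sqrt_op L Q Qhalf.
Hypothesis filtF : filtration r0 T F.
Hypothesis brown : brownian_motions Pr r0 T F beta.
Hypothesis wienerW : Q_wiener Pr L T r0 Qhalf e beta W.
Hypothesis dPsiP : forall r x t : R, 0 <= r -> dom L x -> t \in `[t0, T] ->
  derivable (fun r' => dPsi Psi r' x t) r 1.

Let ie k : inU L (e k). Proof. by have [] := be. Qed.

Let phi k := Qhalf (e k).

Let mphi k : measurable_fun D (phi k).
Proof. by have [[bH _ _] _ _ _] := sqQ; have [] := bH _ (ie k). Qed.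

Let trace : (\sum_(k <oo) \int[mu]_(x in D) (phi k x ^+ 2)%:E < +oo)%E.
Proof. exact: (trace_half bQ sqQ ie trQ). Qed.

Let mW s : r0 <= s -> s <= T -> mea (W s).
Proof. by have [mW _] := wienerW => rs sT; apply: mW; rewrite in_itv/= rs. Qed.

Let cvW s : r0 <= s -> s <= T ->
  (fun n => II Pr L (fun w x => (W s w x - \sum_(k < n) beta k s w * phi k x) ^+ 2)%R)
    @ \oo --> 0%E.
Proof. by have [_ cW] := wienerW => rs sT; apply: cW; rewrite in_itv/= rs. Qed.

Section Solution.
Variables (xi : R -> C) (z N : field C) (t : R).
Hypothesis t0t : t0 < t.
Hypothesis tT : t <= T.

Let mWt s : t0 <= s -> s <= t -> mea (W s).
Proof. by move=> t0s st; apply: mW; [exact: le_trans t0s|exact: le_trans tT]. Qed.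

Lemma reF_scale : reF (fun s w x => (eps%:C)%C * z s w x) =
  fun s w x => eps * reF z s w x.
Proof.
apply/funext => s; apply/funext => w; apply/funext => x; rewrite /reF.
by case: (z s w x) => p q /=; ring.
Qed.

Lemma imF_scale : imF (fun s w x => (eps%:C)%C * z s w x) =
  fun s w x => eps * imF z s w x.
Proof.
apply/funext => s; apply/funext => w; apply/funext => x; rewrite /imF.
by case: (z s w x) => p q /=; ring.
Qed.

(** The integral equation holds almost everywhere at each fixed time, with an exceptional set
    depending on the time. Only the countably many grid times occur, so a single null set suffices;
    taking differences removes the initial value. *)
Lemma half_equation_of (c : R) (X Y b S : @Defs.field R d Omega R) (y0 : R -> R) :
  tmea L t0 t X -> stratonovich_integral Pr L t0 T X W S ->
  integrable_field Pr L t0 T b ->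
  (forall s, s \in `[t0, T] -> AE2 (fun w x =>
     c * (Y s w x - y0 x) + \int[mu]_(r in `[t0, s]) b r w x = S s w x)) ->
  half_equation Pr L t0 t W c X Y b S.
Proof.
move=> mX [J [B [iJ bB defS]]] ib eqS.
exists J, B; split => //.
- exact: ito_integral_ito iJ.
- exact: bracket_brk bB.
- exact: (integrable_field_L1 L0 tT ib).
have : AE2 (fun w x => forall n i, (i <= 2 ^ n)%N ->
    c * (Y (tau t0 t n i) w x - y0 x) +
      \int[mu]_(r in `[t0, tau t0 t n i]) b r w x = S (tau t0 t n i) w x).
  apply: AE2_forall => n; apply: AE2_forall => i.
  have [i_n|ni] := boolP (i <= 2 ^ n)%N; last by apply: AE2T.
  have := eqS (tau t0 t n i); rewrite in_itv/= tau_ge// (le_trans _ tT) ?tau_le//.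
  by move=> /(_ isT); apply: AE2S.
apply: AE2S => w x _ h n i i_n; rewrite /dl /drift_incr.
have := h n i (ltnW i_n); have := h n i.+1 i_n.
by move=> <- <-; ring.
Qed.

Lemma strong_solution_half_equations : strong_solution Pr F L t0 T eps W xi z N ->
  exists Apsi S : field C,
  let a : field C := fun t w x => Apsi t w x + N t w x in
  [/\ nice Pr L r0 t0 t T F (reF z) /\ nice Pr L r0 t0 t T F (imF z),
    field_laplacian Pr L t0 T (reF z) (reF Apsi) /\
    field_laplacian Pr L t0 T (imF z) (imF Apsi),
    half_equation Pr L t0 t W (-1) (fun s w x => eps * reF z s w x) (imF z)
      (reF a) (reF S) &
    half_equation Pr L t0 t W 1 (fun s w x => eps * imF z s w x) (reF z)
      (imF a) (imF S)].
Proof.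
move=> [Apsi [S [[aP aQ] [_ [[lP lQ] [[ia ib] [[sP sQ] eqS]]]]]]].
have nP := adapted_continuous_nice tT r0t0 aP.
have nQ := adapted_continuous_nice tT r0t0 aQ.
exists Apsi, S; split; [by split|by split|..].
- apply: (half_equation_of (y0 := fun x => complex.Im (xi x))); [..|exact: ia|].
  + by move=> s *; apply: meaM; [exact: mea_const|have [mz _ _ _] := nP; exact: mz].
  + by rewrite -reF_scale.
  + move=> s /eqS; apply: AE2S => w x _ h; have [h1 _] := schroedinger_parts h.
    exact: h1.
apply: (half_equation_of (y0 := fun x => complex.Re (xi x))); [..|exact: ib|].
+ by move=> s *; apply: meaM; [exact: mea_const|have [mz _ _ _] := nQ; exact: mz].
+ by rewrite -imF_scale.
+ move=> s /eqS; apply: AE2S => w x _ h; have [_ h1] := schroedinger_parts h.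
  exact: h1.
Qed.

End Solution.

Section Linearized.
Variables (xi eta : R -> C) (z0 z1 z2 : field C).
Let lin (z : field C) : field C :=
  fun t w x => dnonlinearity Psi x t (z0 t w x) (z t w x).
Hypothesis sol1 : strong_solution Pr F L t0 T eps W xi z1 (lin z1).
Hypothesis sol2 : strong_solution Pr F L t0 T eps W eta z2 (lin z2).

Let omega t w x : R :=
  reF z1 t w x * imF z2 t w x - reF z2 t w x * imF z1 t w x.

Lemma symplectic_at t : t0 < t -> t <= T -> {ae Pr, forall w,
  \int[mu]_(x in D) omega t w x = \int[mu]_(x in D) omega t0 w x}.
Proof.
move=> t0t tT.
have [A1 [S1 [[nP1 nQ1] [lP1 lQ1] hP1 hQ1]]] :=
  strong_solution_half_equations t0t tT sol1.
have [A2 [S2 [[nP2 nQ2] [lP2 lQ2] hP2 hQ2]]] :=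
  strong_solution_half_equations t0t tT sol2.
(* The abstract isometry is realised with the pointwise variance [cov phi], where phi k = Qhalf (e
   k). *)
have iW : forall N (u : nat -> R) (H : nat -> rfun) (K : R),
  (forall j, (j < N)%N -> [/\ r0 <= u j, u j <= u j.+1 & u j.+1 <= T]) ->
  (forall j, (j < N)%N -> mea (H j)) ->
  (forall j x, (j < N)%N -> D x -> adp r0 T F (u j) (H j ^~ x)) ->
  (forall j w x, (j < N)%N -> D x -> `|H j w x| <= K) ->
  (II Pr L (fun w x => (\sum_(j < N) H j w x * (W (u j.+1) w x - W (u j) w x)) ^+ 2)%R <=
   II Pr L (fun w x => 12 * (cov phi x * \sum_(j < N) (u j.+1 - u j) * H j w x ^+ 2))%R)%E.
  by move=> M u H K; exact: (W_isometry filtF brown mphi trace mW cvW).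
have mWt s : t0 <= s -> s <= t -> mea (W s).
  by move=> t0s st; apply: mW; [exact: le_trans t0s|exact: le_trans tT].
apply: (om_integral L0 r0t0 t0t tT filtF (measurable_cov mphi)
  (integrable_cov mphi trace) (cov_ge0 phi) mWt iW nP1 nQ1 nP2 nQ2 hP1 hQ1 hP2 hQ2).
have paths := aeS2 (fun w p q => conj p q)
  (aeS2 (fun w p q => conj p q) (nice_path nP1) (nice_path nQ1))
  (aeS2 (fun w p q => conj p q) (nice_path nP2) (nice_path nQ2)).
have laps := aeS2 (fun w p q => conj p q)
  (aeS2 (fun w p q => conj p q) lP1 lQ1) (aeS2 (fun w p q => conj p q) lP2 lQ2).
move: paths laps; apply: aeS2 => w [[p1 q1] [p2 q2]] [[l1 m1] [l2 m2]].
apply: (drift_density_zero L0 p1 q1 p2 q2 (Apsi1 := fun s => reF A1 s w)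
  (Apsi2 := fun s => reF A2 s w) (B1 := fun s => imF A1 s w) (B2 := fun s => imF A2 s w)).
  have k := aeS2 (fun s p q => conj p q)
    (aeS2 (fun s p q => conj p q) l1 m1) (aeS2 (fun s p q => conj p q) l2 m2).
  move: k; apply: aeS => s [[k1 k2] [k3 k4]]; rewrite /= in_itv/= => /andP[t0s st].
  have sT : s \in `[t0, T] by rewrite in_itv/= t0s (le_trans st).
  by split; [exact: k1|exact: k3|exact: k2|exact: k4].
move=> s x; rewrite /= in_itv/= => /andP[t0s st] Dx.
have sT : s \in `[t0, T] by rewrite in_itv/= t0s (le_trans st).
(* [a] and [b] depend on the base point [z0] only and are therefore common to both directions, which
   is what makes the zeroth-order terms cancel. *)
have [a [b h]] := dnonlinearityE (dPsiP
  (addr_ge0 (sqr_ge0 (complex.Re (z0 s w x))) (sqr_ge0 (complex.Im (z0 s w x)))) Dx sT).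
have [e1 e2] := h (z1 s w x); have [e3 e4] := h (z2 s w x).
rewrite /drift_density /reF /imF.
have ReD (u v : C) : complex.Re (u + v) = complex.Re u + complex.Re v by case: u; case: v.
have ImD (u v : C) : complex.Im (u + v) = complex.Im u + complex.Im v by case: u; case: v.
rewrite /lin; move: (dnonlinearity _ _ _ _ (z1 s w x)) e1 e2 => n1 e1 e2.
move: (dnonlinearity _ _ _ _ (z2 s w x)) e3 e4 => n2 e3 e4.
rewrite !ReD !ImD e1 e2 e3 e4.
move: (complex.Re (z0 s w x)) (complex.Im (z0 s w x)) => zr zi.
move: (complex.Re (z1 s w x)) (complex.Im (z1 s w x)) => x1 y1.
move: (complex.Re (z2 s w x)) (complex.Im (z2 s w x)) => x2 y2.
move: (complex.Re (A1 s w x)) (complex.Im (A1 s w x)) => r1 i1.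
by move: (complex.Re (A2 s w x)) (complex.Im (A2 s w x)) => r2 i2; ring.
Qed.

Lemma symplectic_constant : {ae Pr, forall w, forall t, t \in `[t0, T] ->
  \int[mu]_(x in D) omega t w x = \int[mu]_(x in D) omega t0 w x}.
Proof.
have L00 := L0.
have [A1 [S1 [[nP1 nQ1] _ _ _]]] := strong_solution_half_equations t0T (lexx T) sol1.
have [A2 [S2 [[nP2 nQ2] _ _ _]]] := strong_solution_half_equations t0T (lexx T) sol2.
have paths := aeS2 (fun w p q => conj p q)
  (aeS2 (fun w p q => conj p q) (nice_path nP1) (nice_path nQ1))
  (aeS2 (fun w p q => conj p q) (nice_path nP2) (nice_path nQ2)).
have dyadic : {ae Pr, forall w, forall n i, (i <= 2 ^ n)%N ->
    \int[mu]_(x in D) omega (tau t0 T n i) w x = \int[mu]_(x in D) omega t0 w x}.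
  apply: ae_foralln => n; apply: ae_foralln => i.
  (* [symplectic_at] needs a nondegenerate interval. *)
  have [->|i0] := eqVneq i 0%N; first by apply: aeW => w _; rewrite tau0.
  have [i_n|ni] := boolP (i <= 2 ^ n)%N; last by apply: aeW.
  have ti : t0 < tau t0 T n i by rewrite -[ltLHS](tau0 t0 T n) tau_lt// lt0n.
  by have := symplectic_at ti (tau_le t0T i_n); apply: aeS.
move: paths dyadic; apply: aeS2 => w [[p1 q1] [p2 q2]] dy t.
rewrite in_itv/= => /andP[t0t tT].
have At : `[t0, T]%classic t by rewrite /= in_itv/= t0t.
have iom s : `[t0, T]%classic s -> mu.-integrable D (EFin \o omega s w).
  move=> As; rewrite (_ : _ \o _ = (fun x => (reF z1 s w x * imF z2 s w x)%:E -
    (reF z2 s w x * imF z1 s w x)%:E)%E)//.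
  apply: integrableB; first exact: measurable_dom.
    by apply: inU_integrableM; [exact: (path_coef_inU L0 p1)|exact: (path_coef_inU L0 q2)].
  by apply: inU_integrableM; [exact: (path_coef_inU L0 p2)|exact: (path_coef_inU L0 q1)].
apply/eqP; rewrite -subr_eq0 -normr_le0; apply/ler_addgt0Pr => e' e'0; rewrite add0r.
have [_ [B1 b1] u1] := p1; have [_ [B2 b2] u2] := p2.
have [_ [B3 b3] u3] := q1; have [_ [B4 b4] u4] := q2.
pose B := `|B1| + `|B2| + `|B3| + `|B4| + 1.
have B0 : 0 < B by rewrite /B ltr_wpDl// !addr_ge0.
(* The integrand varies by a combination of four products, each of a variation at most [dl] and a
   factor at most [B], and [-L, L] has length 2L. *)
pose dl := e' / (4 * B * (L + L)).
have dl0 : 0 < dl by rewrite divr_gt0// !mulr_gt0//; lra.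
have [d1 d10 h1] := u1 _ dl0; have [d2 d20 h2] := u2 _ dl0.
have [d3 d30 h3] := u3 _ dl0; have [d4 d40 h4] := u4 _ dl0.
pose dd := Num.min (Num.min d1 d2) (Num.min d3 d4).
have dd0 : 0 < dd by rewrite !lt_min d10 d20 d30 d40.
have [n0 hn0] := step_cvg0 t0T dd0; have {}hn0 := hn0 n0 (leqnn _).
have [k [kn ks sk]] := tau_floor t0T n0 t0t tT.
set s := tau t0 T n0 k in ks.
have As : `[t0, T]%classic s by rewrite /= in_itv/= tau_ge//= tau_le.
have ts : `|t - s| <= dd.
  rewrite ger0_norm ?subr_ge0//; apply: le_trans hn0.
  by rewrite -(tau_step t0 T n0 k) lerD2r ltW.
have : dd <= d1 /\ dd <= d2 /\ dd <= d3 /\ dd <= d4.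
  by rewrite /dd !ge_min !lexx !orbT.
move=> [dd1 [dd2 [dd3 dd4]]].
rewrite -(dy n0 k kn) -RintegralB//; [|exact: measurable_dom|exact: iom..].
have iD : mu.-integrable D (EFin \o (fun x => omega t w x - omega s w x)).
  rewrite (_ : _ \o _ = (fun x => (omega t w x)%:E - (omega s w x)%:E)%E)//.
  by apply: integrableB; [exact: measurable_dom|exact: iom..].
apply: (le_trans (le_normr_Rintegral (measurable_dom L) iD)).
apply: (@le_trans _ _ (\int[mu]_(x in D) (4 * B * dl))).
  apply: le_Rintegral.
  - exact: measurable_dom.
  - by have := integrable_abse iD; apply: eq_integrable => //; exact: measurable_dom.
  - exact: integrable_dom_cst.
  move=> x Dx; have {}h1 := h1 t s x At As Dx (le_trans ts dd1).
  have {}h2 := h2 t s x At As Dx (le_trans ts dd2).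
  have {}h3 := h3 t s x At As Dx (le_trans ts dd3).
  have {}h4 := h4 t s x At As Dx (le_trans ts dd4).
  have {}b1 := b1 s x As Dx; have {}b2 := b2 s x As Dx.
  have {}b3 := b3 t x At Dx; have {}b4 := b4 t x At Dx.
  have k1 := ler_norm B1; have k2 := ler_norm B2.
  have k3 := ler_norm B3; have k4 := ler_norm B4.
  have g1 := normr_ge0 B1; have g2 := normr_ge0 B2.
  have g3 := normr_ge0 B3; have g4 := normr_ge0 B4.
  rewrite /omega [X in `|X|](_ : _ =
    ((reF z1 t w x - reF z1 s w x) * imF z2 t w x +
      reF z1 s w x * (imF z2 t w x - imF z2 s w x)) -
    ((reF z2 t w x - reF z2 s w x) * imF z1 t w x +
      reF z2 s w x * (imF z1 t w x - imF z1 s w x))); last by ring.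
  apply: (le_trans (ler_normB _ _)).
  have m1 (u v m : R) : `|u| <= dl -> `|v| <= m -> m <= B -> `|u * v| <= B * dl.
    move=> ud vm mB; rewrite normrM mulrC; apply: ler_pM => //.
    exact: le_trans mB.
  have t1 : `|(reF z1 t w x - reF z1 s w x) * imF z2 t w x +
      reF z1 s w x * (imF z2 t w x - imF z2 s w x)| <= B * dl + B * dl.
    apply: (le_trans (ler_normD _ _)); apply: lerD; first by apply: m1 h1 b4 _; rewrite /B; lra.
    by rewrite mulrC; apply: m1 h4 b1 _; rewrite /B; lra.
  have t2 : `|(reF z2 t w x - reF z2 s w x) * imF z1 t w x +
      reF z2 s w x * (imF z1 t w x - imF z1 s w x)| <= B * dl + B * dl.
    apply: (le_trans (ler_normD _ _)); apply: lerD; first by apply: m1 h2 b3 _; rewrite /B; lra.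
    by rewrite mulrC; apply: m1 h3 b2 _; rewrite /B; lra.
  by apply: (le_trans (lerD t1 t2)); rewrite le_eqVlt; apply/orP; left; apply/eqP; ring.
rewrite Rintegral_cst; last exact: measurable_dom.
have muE : fine (mu D) = L + L by exact: (congr1 fine (mu_dom L0)).
rewrite [leLHS](_ : _ = 4 * B * dl * (L + L)); last by congr (_ * _); exact: muE.
rewrite /dl le_eqVlt; apply/orP; left; apply/eqP.
by field; rewrite !gt_eqF//; lra.
Qed.

End Linearized.

End Flow.

Theorem theorem2p4 (R : realType) (d : measure_display)
    (Omega : measurableType d) (Pr : probability Omega R)
    (L t0 T eps r0 : R) (Psi : R -> R -> R -> R)
    (Q Qhalf : (R -> R) -> R -> R) (e : nat -> R -> R)
    (F : R -> set (set Omega)) (beta : nat -> R -> Omega -> R)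
    (W : field R) (E : set (R -> R[i]))
    (psi : (R -> R[i]) -> field R[i])
    (Dpsi : (R -> R[i]) -> (R -> R[i]) -> field R[i]) :
  0 < L -> t0 < T ->
  r0 <= t0 ->
  bounded_op L Q -> symmetric_op L Q -> nonneg_op L Q ->
  orthonormal_basis L e -> finite_trace L Q e ->
  (forall k, exists l : R, eqU L (Q (e k)) (fun x => l * e k x)) ->
  sqrt_op L Q Qhalf ->
  filtration r0 T F -> brownian_motions Pr r0 T F beta ->
  Q_wiener Pr L T r0 Qhalf e beta W ->
  (forall r x t : R, 0 <= r -> dom L x -> t \in `[t0, T] ->
     derivable (fun r' => Psi r' x t) r 1 /\
     derivable (fun r' => dPsi Psi r' x t) r 1) ->
  phase_flow Pr F L t0 T Psi eps W E psi ->
  flow_derivative Pr F L t0 T Psi eps W E psi Dpsi ->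
  forall phi xi eta : R -> R[i], E phi -> E xi -> E eta ->
  {ae Pr, forall w, forall t, t \in `[t0, T] ->
     symplectic_form L Dpsi t w phi xi eta =
     symplectic_form L Dpsi t0 w phi xi eta}.
Proof.
move=> L0 t0T r0t0 bQ _ _ be trQ _ sqQ filtF brown wienerW PsiP _ flow phi xi eta.
move=> Ephi Exi Eeta.
have dPsiP : forall r x t : R, 0 <= r -> dom L x -> t \in `[t0, T] ->
    derivable (fun r' => dPsi Psi r' x t) r 1.
  by move=> r x t r0' Dx tT; have [] := PsiP r x t r0' Dx tT.
have [_ sol1] := flow phi xi Ephi Exi; have [_ sol2] := flow phi eta Ephi Eeta.
exact: (symplectic_constant L0 t0T r0t0 bQ be trQ sqQ filtF brown wienerW dPsiP sol1 sol2).
Qed.
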